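(* Let $\mathbb{G}$ be a homogeneous Lie group of homogeneous dimension $Q$, $|\cdot|$ any homogeneous quasi-norm, $R>0$, $B(0,R)=\{x\in\mathbb{G}:|x|<R\}$, $1<p<\infty$, $\alpha,\beta\in\mathbb{R}$, and $L(x)=\log\frac{R}{|x|}$. (i) If $(Q-\alpha-p)(\beta+p)\ge0$, then for all complex-valued $f\in C_0^\infty(B(0,R)\setminus\{0\})$, $$\left|\frac{\beta+p}{p}\right|^p\int_{B(0,R)}\frac{|f|^p}{|x|^{\alpha+p}L^{\beta+p+1}}dx\le\int_{B(0,R)}\frac{|\mathcal{R}_{|x|}f|^p}{|x|^{\alpha}L^{\beta+1}}dx,$$ and when $\beta\neq-p$ the constant $\left|\frac{\beta+p}{p}\right|^p$ is sharp. (ii) For all complex-valued $f\in C_0^\infty(B(0,R)\setminus\{0\})$, $$\left|\frac{\beta+p}{p}\right|^p\int_{B(0,R)}\frac{|f|^p}{|x|^{\alpha+p}L^{\beta+p+1}}dx=\int_{B(0,R)}\frac{|\mathcal{R}_{|x|}f|^p}{|x|^{\alpha}L^{\beta+1}}dx-(Q-\alpha-p)\frac{\beta+p}{p}\left|\frac{\beta+p}{p}\right|^{p-2}\int_{B(0,R)}\frac{|f|^p}{|x|^{\alpha+p}L^{\beta+p}}dx-\int_{B(0,R)}C_p(\xi,\eta)dx,$$ where $\xi=\dfrac{\mathcal{R}_{|x|}f}{|x|^{\alpha/p}L^{(\beta+1)/p}}$ and $\eta=\xi+\dfrac{\beta+p}{p}\dfrac{f}{|x|^{(\alpha+p)/p}L^{(\beta+p+1)/p}}$.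 (iii) If $Q=\alpha+p$ and $p\ge2$, then $\int_{B(0,R)}C_p(\xi,\eta)dx$ vanishes only if $f=L^{(\beta+p)/p}\varphi(x/|x|)$ for some $\varphi:\mathfrak{S}\to\mathbb{C}$, which for $f\in C_0^\infty(B(0,R)\setminus\{0\})$ forces $f=0$; hence the inequality in (i) is strict for every nonzero such $f$.
   Context: A homogeneous Lie group is a connected simply connected (nilpotent) Lie group $\mathbb{G}$, identified with $\mathbb{R}^n$, whose Lie algebra carries dilations $D_\lambda=\exp(A\ln\lambda)$ with $A$ diagonalisable with positive eigenvalues and each $D_\lambda$ a Lie algebra automorphism, inducing dilations $x\mapsto\lambda x$ on $\mathbb{G}$; $Q=\operatorname{Tr}A$ and the Haar (Lebesgue) measure satisfies $\int f(\lambda x)dx=\lambda^{-Q}\int f dx$. A homogeneous quasi-norm is a continuous $|\cdot|:\mathbb{G}\to[0,\infty)$ with $|x^{-1}|=|x|$, $|\lambda x|=\lambda|x|$, $|x|=0$ iff $x=0$. $\mathfrak{S}=\{|x|=1\}$ and there is a Borel measure $\sigma$ on $\mathfrak{S}$ with $\int_{\mathbb{G}}f\,dx=\int_0^\infty\int_{\mathfrak{S}}f(ry)r^{Q-1}d\sigma(y)dr$. The radial derivative is $\mathcal{R}_{|x|}f(x)=\frac{d}{dr}f(ry)$ at $r=|x|$, $y=x/|x|$. For complex $\xi,\eta$, $C_p(\xi,\eta):=|\xi|^p-|\xi-\eta|^p-p|\xi-\eta|^{p-2}\operatorname{Re}((\xi-\eta)\overline{\eta})$ (last term $0$ when $\xi=\eta$).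 *)

(* Defs.v *)
(* mathcomp-analysis (R : realType), complex values in R[i]
   (mathcomp-real-closed's complex). *)
From HB Require Import structures.
From mathcomp Require Import all_boot all_order all_algebra.
From mathcomp Require Import all_classical all_reals all_analysis.
From mathcomp Require Import complex.
Import Order.TTheory GRing.Theory Num.Theory.
Import numFieldNormedType.Exports.
Set Implicit Arguments. Unset Strict Implicit. Unset Printing Implicit Defensive.
Local Open Scope ring_scope.
Local Open Scope classical_set_scope.

(* The underlying space R^n of the homogeneous group (exponential coordinates
   in a basis of eigenvectors of the dilation generator A).                 *)
Definition Rn (R : realType) (n : nat) := 'rV[R]_n.
HB.instance Definition _ (R : realType) (n : nat) :=
  NormedModule.copy (Rn R n) ('rV[R]_n : normedModType R).

Definition coor (R : realType) n (i : 'I_n) (x : Rn R n) : R := x ord0 i.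

(* Borel sigma-algebra of R^n: generated by the coordinate functions. *)
Section RnMeasurable.
Variables (R : realType) (n : nat).
Let s0 : g_sigma_preimage (@coor R n) set0. Proof. exact: sigma_algebra0. Qed.
Let sC A : g_sigma_preimage (@coor R n) A -> g_sigma_preimage (@coor R n) (~` A).
Proof. exact: sigma_algebraC. Qed.
Let sU (F : _^nat) : (forall i, g_sigma_preimage (@coor R n) (F i)) ->
  g_sigma_preimage (@coor R n) (\bigcup_i (F i)).
Proof. exact: sigma_algebra_bigcup. Qed.
HB.instance Definition _ :=
  @isMeasurable.Build (measure_tuple_display default_measure_display)
  (Rn R n) (g_sigma_preimage (@coor R n)) s0 sC sU.
End RnMeasurable.

(* Lebesgue measure on R^n: the (unique) measure on the Borel sets giving
   every half-open box its volume. *)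
Definition is_lebesgue_measure (R : realType) (n : nat)
    (mu : {measure set (Rn R n) -> \bar R}) : Prop :=
  forall a b : Rn R n, (forall i, coor i a <= coor i b) ->
    mu [set x | forall i, coor i a <= coor i x < coor i b] =
    (\prod_(i < n) (coor i b - coor i a))%:E.

(* Dilations: D_lambda = exp(A ln lambda) with A = diag(nu_1,...,nu_n). *)
Definition dil (R : realType) n (nu : 'I_n -> R) (r : R) (x : Rn R n) : Rn R n :=
  \row_i (r `^ nu i * x ord0 i).

(* homogeneous dimension Q = Tr A *)
Definition hdim (R : realType) n (nu : 'I_n -> R) : R := \sum_(i < n) nu i.

(* each coordinate of the group law is a polynomial in (x, y) *)
Definition polynomial_law (R : realType) n (mul : Rn R n -> Rn R n -> Rn R n) :=
  forall k : 'I_n, exists s : seq (R * ('I_n -> nat) * ('I_n -> nat)),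
    forall x y : Rn R n, mul x y ord0 k =
      \sum_(t <- s) (t.1.1 * \prod_(i < n) x ord0 i ^+ t.1.2 i
                           * \prod_(i < n) y ord0 i ^+ t.2 i).

(* A homogeneous (Lie) group structure on R^n (exponential coordinates):
   polynomial group law with identity 0 and inverse x |-> -x, for which the
   dilations (positive weights nu_i) are group automorphisms. *)
Definition homogeneous_group (R : realType) n (nu : 'I_n -> R)
    (mul : Rn R n -> Rn R n -> Rn R n) : Prop :=
  [/\ (forall i, 0 < nu i),
      polynomial_law mul,
      (forall x y z, mul x (mul y z) = mul (mul x y) z),
      (forall x, mul 0 x = x /\ mul x 0 = x) &
      (forall x, mul x (- x) = 0 /\ mul (- x) x = 0)] /\
  (forall r x y, 0 < r -> dil nu r (mul x y) = mul (dil nu r x) (dil nu r y)).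

(* homogeneous quasi-norm (x^{-1} = -x in exponential coordinates) *)
Definition quasi_norm (R : realType) n (nu : 'I_n -> R) (qn : Rn R n -> R) :=
  [/\ continuous qn,
      forall x, 0 <= qn x,
      forall x, qn (- x) = qn x,
      forall r x, 0 < r -> qn (dil nu r x) = r * qn x &
      forall x, qn x = 0 <-> x = 0].

(* Smoothness: all partial derivatives of all orders exist and are continuous *)
Definition evec (R : realType) n (i : 'I_n) : Rn R n := delta_mx ord0 i.

Fixpoint dpart (R : realType) n (f : Rn R n -> R) (s : seq 'I_n) : Rn R n -> R :=
  match s with
  | [::] => f
  | i :: s' => fun x => 'D_(evec R i) (dpart f s') x
  end.

Definition smooth (R : realType) n (f : Rn R n -> R) : Prop :=
  forall s : seq 'I_n, continuous (dpart f s) /\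
    forall (i : 'I_n) (x : Rn R n), derivable (dpart f s) x (evec R i).

(* modulus of a complex number *)
Definition cabs (R : realType) (z : R[i]) : R :=
  Num.sqrt (complex.Re z ^+ 2 + complex.Im z ^+ 2).

(* f in C_0^infty(B(0,R0) \ {0}), complex valued *)
Definition C0inf_punct (R : realType) n (qn : Rn R n -> R) (R0 : R)
    (f : Rn R n -> R[i]) : Prop :=
  smooth (fun x => complex.Re (f x)) /\ smooth (fun x => complex.Im (f x)) /\
  exists K : set (Rn R n), [/\ compact K,
    K `<=` [set x | qn x < R0] `\ 0 &
    forall x, ~ K x -> f x = 0].

(* radial derivative R_{|x|} f(x) = d/dr f(r y) at r = |x|, y = x/|x| *)
Definition radderiv (R : realType) n (nu : 'I_n -> R) (qn : Rn R n -> R)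
    (f : Rn R n -> R[i]) (x : Rn R n) : R[i] :=
  let y := dil nu (qn x)^-1 x in
  Complex (derive1 (fun r => complex.Re (f (dil nu r y))) (qn x))
          (derive1 (fun r => complex.Im (f (dil nu r y))) (qn x)).

(* C_p(xi, eta) *)
Definition Cp (R : realType) (p : R) (xi eta : R[i]) : R :=
  cabs xi `^ p - cabs (xi - eta) `^ p -
  (if xi == eta then 0
   else p * cabs (xi - eta) `^ (p - 2) * complex.Re ((xi - eta) * eta^*)).

(* The quantities appearing in the theorem. *)
Section Quantities.
Variables (R : realType) (n : nat) (nu : 'I_n -> R) (qn : Rn R n -> R)
  (mu : {measure set (Rn R n) -> \bar R}) (R0 p alpha beta : R).

Definition qball : set (Rn R n) := [set x | qn x < R0].
Definition Lw (x : Rn R n) : R := ln (R0 / qn x).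

(* int_B |f|^p / (|x|^(alpha+p) L^(beta+p+1)) *)
Definition I_f (f : Rn R n -> R[i]) : R :=
  Rintegral mu qball (fun x =>
    cabs (f x) `^ p / (qn x `^ (alpha + p) * Lw x `^ (beta + p + 1))).

(* int_B |R f|^p / (|x|^alpha L^(beta+1)) *)
Definition I_Rf (f : Rn R n -> R[i]) : R :=
  Rintegral mu qball (fun x =>
    cabs (radderiv nu qn f x) `^ p / (qn x `^ alpha * Lw x `^ (beta + 1))).

(* int_B |f|^p / (|x|^(alpha+p) L^(beta+p)) *)
Definition I_f' (f : Rn R n -> R[i]) : R :=
  Rintegral mu qball (fun x =>
    cabs (f x) `^ p / (qn x `^ (alpha + p) * Lw x `^ (beta + p))).

Definition xi_f (f : Rn R n -> R[i]) (x : Rn R n) : R[i] :=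
  radderiv nu qn f x / real_complex R (qn x `^ (alpha / p) * Lw x `^ ((beta + 1) / p)).

Definition eta_f (f : Rn R n -> R[i]) (x : Rn R n) : R[i] :=
  xi_f f x + real_complex R ((beta + p) / p) * f x /
    real_complex R (qn x `^ ((alpha + p) / p) * Lw x `^ ((beta + p + 1) / p)).

Definition I_Cp (f : Rn R n -> R[i]) : R :=
  Rintegral mu qball (fun x => Cp p (xi_f f x) (eta_f f x)).

End Quantities.

(* Main.v *)
Require Import Defs.
From HB Require Import structures.
From mathcomp Require Import all_boot all_order all_algebra.
From mathcomp Require Import all_classical all_reals all_analysis.
From mathcomp Require Import complex measurable_realfun ring lra.
Import Order.TTheory GRing.Theory Num.Theory.
Import numFieldNormedType.Exports.
Set Implicit Arguments. Unset Strict Implicit. Unset Printing Implicit Defensive.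
Local Open Scope ring_scope.
Local Open Scope classical_set_scope.

(** Lebesgue measure is scaled by r^Q under the dilations; differentiating the
    scaling law at r = 1 gives [int E h = - Q int h] for the Euler field
    [E = |x| R_{|x|}].  No polar decomposition is needed, and only the regularity
    of h along the dilation rays matters, so h may involve the merely continuous
    quasi-norm.  Taking [h = |f|^p |x|^(-alpha-p) L^(-beta-p)] and expanding C_p
    pointwise yields (ii).  By strict convexity of [t^p], C_p >= 0 with equality
    only for eta = 0, which gives (i); if C_p = 0 almost everywhere then eta
    vanishes, [f L^(-(beta+p)/p)] is constant on rays, and compactness of the
    support forces f = 0.

    For sharpness, blow up at the point of the sphere |x| = R on a coordinate
    half-axis, with test functions that are products of one-variable functions of
    the rescaled coordinates z.  With y the axis coordinate, pointing inwards, the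
    log weight L becomes y / nu_i in the limit, and the inequality becomes the Hardy
    inequality [C int |F|^p y^(-beta-p-1) <= int |d_i F|^p y^(-beta-1)].
    It is tested on [y^((beta+p)/p)] times a plateau equal to 1 on [2, 2^N]:
    all dyadic shells have the same mass for dy / y, hence the N - 1 shells of the
    plateau dominate the two transition shells as N grows. *)

(** * Boxes and Borel sets of R^n *)

Section Boxes.
Context {R : realType} {n : nat}.
Implicit Types (a b : 'I_n -> R) (x y : Rn R n).

Lemma norm_coor i x : `|coor i x| <= `|x|.
Proof.
rewrite /coor (_ : `|x| = mx_norm x)// mx_normrE.
exact: (le_bigmax _ (fun ij : 'I_1 * 'I_n => `|x ij.1 ij.2|) (ord0, i)).
Qed.

Lemma norm_le_coor x (e : R) : 0 <= e -> (forall i, `|coor i x| <= e) -> `|x| <= e.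
Proof.
move=> e0 xe; rewrite (_ : `|x| = mx_norm x)// mx_normrE.
by apply: bigmax_le => // -[i j] _; rewrite ord1; exact: xe.
Qed.

Lemma ball_coor x y (e : R) : 0 < e ->
  (forall i, `|coor i x - coor i y| < e) -> ball x e y.
Proof. by move=> e0 xy; split => // i j; rewrite ord1; exact: xy. Qed.

Lemma continuous_coor i : continuous (@coor R n i).
Proof. exact: coord_continuous. Qed.

Lemma continuous_norm_Rn : continuous (fun x : Rn R n => `|x| : R).
Proof. by move=> x; exact: (@norm_continuous R (Rn R n) x). Qed.

Lemma compact_closed_Rn (K : set (Rn R n)) : compact K -> closed K.
Proof. by move=> cK; apply: compact_closed => //; exact: norm_hausdorff. Qed.

Lemma compact_norm_bounded (K : set (Rn R n)) : compact K ->
  exists B : R, forall x, B < `|x| -> ~ K x.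
Proof.
move=> /compact_bounded[B [_ KB]]; exists (B + 1) => x Bx Kx.
have : `|x| <= B + 1 by apply: (KB (B + 1)) => //; rewrite ltrDl.
by rewrite leNgt Bx.
Qed.

Definition boxco a b : set (Rn R n) := [set x | forall i, a i <= coor i x < b i].

Lemma measurable_coor i : measurable_fun [set: Rn R n] (@coor R n i).
Proof.
move=> _ Y mY; apply: sub_sigma_algebra => /=.
rewrite -bigcup_seq/=; exists i => /=; first by rewrite mem_index_enum.
by exists Y.
Qed.

Lemma measurable_fun_coor d (T : measurableType d) (f : T -> Rn R n) :
  (forall i, measurable_fun [set: T] (@coor R n i \o f)) ->
  measurable_fun [set: T] f.
Proof.
move=> mf; apply: (measurability
  (\big[setU/set0]_(i < n) preimage_set_system setT (@coor R n i) measurable)).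
  by [].
move=> _ [B + <-]; rewrite -bigcup_seq/= => -[i _ [C mC <-]].
by rewrite [setT `&` _ in X in measurable X]setTI; exact: mf.
Qed.

Lemma boxcoE a b :
  boxco a b = \bigcap_(i in [set: 'I_n]) (coor i @^-1` `[a i, b i[).
Proof.
apply/seteqP; split => x /= abx; first by move=> i _ /=; rewrite in_itv/= abx.
by move=> i; have /= := abx i I; rewrite in_itv.
Qed.

Lemma measurable_boxco a b : measurable (boxco a b).
Proof.
rewrite boxcoE; apply: fin_bigcap_measurable => // i _.
by rewrite -[X in measurable X]setTI; apply: measurable_coor.
Qed.

Lemma boxcoI a b a' b' : boxco a b `&` boxco a' b' =
  boxco (fun i => Num.max (a i) (a' i)) (fun i => Num.min (b i) (b' i)).
Proof.
apply/seteqP; split => x /=.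
  move=> [abx abx'] i; rewrite ge_max lt_min.
  by have /andP[-> ->] := abx i; have /andP[-> ->] := abx' i.
move=> abx; split => i; have := abx i; rewrite ge_max lt_min;
  by case/andP => /andP[? ?] /andP[? ?]; apply/andP.
Qed.

Lemma boxco_eq0 a b : ~ (forall i, a i <= b i) -> boxco a b = set0.
Proof.
move=> /existsNP[i /negP]; rewrite -ltNge => ba.
by apply/seteqP; split => // x /(_ i) /andP[? ?]; lra.
Qed.

Definition cube (k : nat) : set (Rn R n) := boxco (fun=> - k%:R) (fun=> k%:R).

Lemma norm_lt_cube x k : `|x| < k%:R -> cube k x.
Proof.
move=> xk i; have := le_lt_trans (norm_coor i x) xk.
by rewrite ltr_norml => /andP[/ltW -> ->].
Qed.

Lemma bigcup_cube : \bigcup_k cube k = setT.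
Proof.
apply/seteqP; split => // x _.
by exists (Num.truncn `|x|).+1 => //; apply: norm_lt_cube; exact: truncnS_gt.
Qed.

Definition boxes_co : set (set (Rn R n)) := [set A | exists a b, A = boxco a b].

Lemma coor_ge_bigcup_boxco i (t : R) : coor i @^-1` `[t, +oo[ =
  \bigcup_k boxco (fun j => if j == i then t else - k%:R) (fun=> k%:R).
Proof.
apply/seteqP; split => x /=.
  rewrite in_itv/= andbT => tx; exists (Num.truncn `|x|).+1 => // j.
  have /(_ j)/andP[lex ->] := norm_lt_cube (truncnS_gt `|x|).
  by rewrite andbT; case: ifPn => // /eqP ->.
by move=> [k _ /(_ i)]; rewrite eqxx in_itv/= andbT => /andP[].
Qed.

Lemma measurable_RnE : @measurable _ (Rn R n) = <<s boxes_co >>.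
Proof.
apply/seteqP; split; last first.
  apply: smallest_sub; first exact: sigma_algebra_measurable.
  by move=> _ [a [b ->]]; exact: measurable_boxco.
apply: smallest_sub; first exact: smallest_sigma_algebra.
move=> A; rewrite -bigcup_seq/= => -[i _ [C mC <-]].
suff mcoor : measurable_fun [set: g_sigma_algebraType boxes_co]
    (@coor R n i : g_sigma_algebraType boxes_co -> R) by exact: mcoor.
apply: (measurability _ (RGenCInfty.measurableE R)).
move=> _ [_ [t ->] <-]; rewrite setTI coor_ge_bigcup_boxco.
by apply: bigcupT_measurable => k; apply: sub_sigma_algebra; do 2 eexists.
Qed.

Lemma open_measurable_Rn (U : set (Rn R n)) : open U -> measurable U.
Proof.
move=> oU.
pose box (q : {ffun 'I_n -> rat} * {ffun 'I_n -> rat}) : set (Rn R n) :=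
  boxco (ratr \o q.1) (ratr \o q.2).
pose box_in_U q := if `[< box q `<=` U >] then box q else set0.
rewrite (_ : U = \bigcup_q box_in_U q).
  apply: countable_bigcupT_measurable => // q.
  by rewrite /box_in_U; case: ifPn => // _; exact: measurable_boxco.
apply/seteqP; split => [x Ux|x [q _]]; last first.
  by rewrite /box_in_U; case: ifPn => // /asboolP; exact.
have /nbhs_ballP[e /= e0 eU] : nbhs x U by rewrite nbhsE; exists U.
have left_rat i : exists q : rat, ratr q \in `]coor i x - e, coor i x[%R.
  by apply: rat_in_itvoo; rewrite ltrBlDr ltrDl.
have right_rat i : exists q : rat, ratr q \in `]coor i x, coor i x + e[%R.
  by apply: rat_in_itvoo; rewrite ltrDl.
have [l lx] := choice left_rat; have [r xr] := choice right_rat.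
exists ([ffun i => l i], [ffun i => r i]) => //; rewrite /box_in_U ifT.
  move=> i; rewrite /= !ffunE.
  by have := lx i; have := xr i; rewrite !in_itv/=; lra.
apply/asboolP => y lyr; apply: eU; apply: ball_coor => // j.
have := lx j; have := xr j; rewrite !in_itv/= => /andP[? ?] /andP[? ?].
have := lyr j; rewrite /= !ffunE => /andP[? ?].
by rewrite ltr_norml; apply/andP; split; lra.
Qed.

Lemma continuous_measurable_Rn (f : Rn R n -> R) :
  continuous f -> measurable_fun setT f.
Proof.
move=> /continuousP cf; apply: (measurability _ (RGenOpens.measurableE R)).
move=> _ [_ [a [b ->]] <-]; rewrite setTI; apply: open_measurable_Rn.
by apply: cf; exact: interval_open.
Qed.

Definition affine (a d : 'I_n -> R) x : Rn R n := \row_i (a i + d i * coor i x).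

Lemma coor_affine a (d : 'I_n -> R) i x : coor i (affine a d x) = a i + d i * coor i x.
Proof. by rewrite /coor mxE. Qed.

Lemma measurable_affine (a d : 'I_n -> R) : measurable_fun setT (affine a d).
Proof.
apply: measurable_fun_coor => i; rewrite /comp.
under eq_fun do rewrite coor_affine.
apply: measurable_funD => //; apply: measurable_funM => //.
exact: measurable_coor.
Qed.

Lemma preimage_affine_boxco a (d u v : 'I_n -> R) : (forall i, 0 < d i) ->
  affine a d @^-1` boxco u v =
  boxco (fun i => (u i - a i) / d i) (fun i => (v i - a i) / d i).
Proof.
move=> d0; apply/seteqP; split => x /= uxv i; have := uxv i; rewrite coor_affine;
  by rewrite ler_pdivrMr// ltr_pdivlMr// lerBlDl ltrBrDl [d i * _]mulrC.
Qed.

End Boxes.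

(** * Lebesgue integrals on R^n *)

Lemma integral_mscale d (T : measurableType d) (R : realType)
    (mu : {measure set T -> \bar R}) (k : {nonneg R}) (D : set T) (f : T -> \bar R) :
  measurable D -> mu.-integrable D f ->
  (\int[mscale k mu]_(x in D) f x = k%:num%:E * \int[mu]_(x in D) f x)%E.
Proof.
move=> mD intf; have /integrableP[mf _] := intf.
rewrite [LHS]integralE [in RHS]integralE.
rewrite !ge0_integral_mscale//; [|exact: measurable_funeneg|exact: measurable_funepos].
rewrite [RHS]muleBr//; apply: fin_num_adde_defl; rewrite fin_numN.
exact: integrable_neg_fin_num.
Qed.

Lemma Rintegral_off_support d (T : measurableType d) (R : realType)
    (mu : {measure set T -> \bar R}) (D : set T) (f : T -> R) :
  (forall x, ~ D x -> f x = 0) -> (\int[mu]_(x in D) f x = \int[mu]_x f x)%R.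
Proof.
move=> f0; rewrite Rintegral_mkcond; apply: eq_Rintegral => x _.
by rewrite patchE; case: ifPn => //; rewrite notin_setE => /f0 ->.
Qed.

Section LebesgueMeasure.
Context {R : realType} {n : nat}.
Variable mu : {measure set (Rn R n) -> \bar R}.
Hypothesis mu_lebesgue : is_lebesgue_measure mu.
Implicit Types (a b d : 'I_n -> R) (x : Rn R n).

Lemma lebesgue_boxco a b : (forall i, a i <= b i) ->
  mu (boxco a b) = (\prod_(i < n) (b i - a i))%:E.
Proof.
move=> ab.
have coor_row c i : coor i (\row_j c j : Rn R n) = c i by rewrite /coor mxE.
have -> : boxco a b = [set x | forall i,
    coor i (\row_j a j : Rn R n) <= coor i x < coor i (\row_j b j : Rn R n)].
  by apply/seteqP; split => x /= abx i; have := abx i; rewrite !coor_row.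
rewrite mu_lebesgue; last by move=> i; rewrite !coor_row.
by congr EFin; apply: eq_bigr => i _; rewrite !coor_row.
Qed.

Lemma lebesgue_cube_lty k : (mu (cube k) < +oo)%E.
Proof. by rewrite lebesgue_boxco ?ltry// => i; have := ler0n R k; lra. Qed.

Lemma lebesgue_unique (m : {measure set (Rn R n) -> \bar R}) :
  (forall a b, (forall i, a i <= b i) ->
    m (boxco a b) = (\prod_(i < n) (b i - a i))%:E) ->
  forall A, measurable A -> mu A = m A.
Proof.
move=> m_boxco; apply: (measure_unique boxes_co cube).
- exact: measurable_RnE.
- move=> _ _ [a [b ->]] [a' [b' ->]]; rewrite boxcoI.
  by eexists; eexists.
- by move=> k; eexists; eexists.
- exact: bigcup_cube.
- move=> _ [a [b ->]].
  have [ab|ab] := pselect (forall i, a i <= b i).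
    by rewrite lebesgue_boxco// m_boxco.
  by rewrite boxco_eq0// !measure0.
- by move=> k; exact: lebesgue_cube_lty.
Qed.

Section AffineChange.
Variables a d : 'I_n -> R.
Hypothesis d_gt0 : forall i, 0 < d i.

Let affine_image : {measure set (Rn R n) -> \bar R} :=
  measure_function_pushforward__canonical__measure_function_Measure mu
    (measurable_affine a d).

Let jacobian_ge0 : 0 <= \prod_(i < n) d i.
Proof. by apply: prodr_ge0 => i _; exact: ltW. Qed.

Let lebesgue_affine_image A : measurable A ->
  mu A = mscale (NngNum jacobian_ge0) affine_image A.
Proof.
apply: lebesgue_unique => u v uv.
transitivity ((\prod_(i < n) d i)%:E * mu (affine a d @^-1` boxco u v))%E; first by [].
rewrite preimage_affine_boxco// lebesgue_boxco; last first.
  by move=> i; rewrite ler_wpM2r ?invr_ge0 ?(ltW (d_gt0 i))// lerD2r.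
rewrite -EFinM -big_split/=; congr EFin; apply: eq_bigr => i _.
by field; exact: lt0r_neq0.
Qed.

Lemma ge0_integral_affine (f : Rn R n -> \bar R) :
  measurable_fun setT f -> (forall x, 0 <= f x)%E ->
  (\int[mu]_x f x =
   (\prod_(i < n) d i)%:E * \int[mu]_x f (affine a d x))%E.
Proof.
move=> mf f0; rewrite (eq_measure_integral (mscale (NngNum jacobian_ge0) affine_image)).
  rewrite ge0_integral_mscale//= ge0_integral_pushforward//.
  exact: measurable_affine.
by move=> A mA _; exact: lebesgue_affine_image.
Qed.

Lemma integrable_affine (f : Rn R n -> R) :
  mu.-integrable setT (EFin \o f) ->
  mu.-integrable setT (EFin \o (f \o affine a d)).
Proof.
move=> /integrableP[mf intf].
have jacobian_gt0 : 0 < \prod_(i < n) d i by exact: prodr_gt0.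
apply/integrableP; split.
  by rewrite compA; apply: measurableT_comp => //; exact: measurable_affine.
move: intf; rewrite ge0_integral_affine//; last first.
  by apply: measurableT_comp => //; exact: measurable_abse.
move: (\int[mu]_x _)%E => [r| |]//=; first by rewrite !ltry.
by rewrite mulry gtr0_sg// mul1e.
Qed.

Lemma Rintegral_affine (f : Rn R n -> R) :
  mu.-integrable setT (EFin \o f) ->
  (\int[mu]_x f x)%R = (\prod_(i < n) d i) * (\int[mu]_x f (affine a d x))%R.
Proof.
move=> intf; have /integrableP[mf _] := intf.
have intf_affine := integrable_affine intf.
rewrite /Rintegral.
rewrite (eq_measure_integral (mscale (NngNum jacobian_ge0) affine_image)).
  rewrite integral_mscale//; last first.
    exact: (integrable_pushforward (measurable_affine a d)).
  rewrite /= (integral_pushforward (measurable_affine a d))// preimage_setT.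
  by rewrite fineM// integrable_fin_num.
by move=> A mA _; exact: lebesgue_affine_image.
Qed.

End AffineChange.

Lemma lebesgue_open_gt0 (U : set (Rn R n)) x : open U -> U x -> (0 < mu U)%E.
Proof.
move=> oU Ux.
have /nbhs_ballP[e /= e0 eU] : nbhs x U by rewrite nbhsE; exists U.
pose box := boxco (fun i => coor i x - e / 2) (fun i => coor i x + e / 2).
have boxU : box `<=` U.
  move=> y xy; apply: eU; apply: ball_coor => // j.
  have := xy j => /andP[? ?].
  by rewrite ltr_norml; apply/andP; split; lra.
have mbox : measurable box by exact: measurable_boxco.
apply: (@lt_le_trans _ _ (mu box)); last first.
  by rewrite le_measure// ?inE//; exact: open_measurable_Rn.
rewrite lebesgue_boxco//; last by move=> i; lra.
by rewrite lte_fin; apply: prodr_gt0 => i _; lra.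
Qed.

Lemma Rintegral_gt0 (g : Rn R n -> R) (U : set (Rn R n)) x :
  mu.-integrable setT (EFin \o g) -> (forall y, 0 <= g y) ->
  open U -> U x -> (forall y, U y -> g y != 0) -> 0 < (\int[mu]_y g y)%R.
Proof.
move=> ig g0 oU Ux gU; rewrite lt_neqAle Rintegral_ge0// andbT.
apply/eqP => /esym Ig0; have /integrableP[mg _] := ig.
have [N [mN N0 gN]] : ae_eq mu setT (EFin \o g) (cst 0%E).
  apply/(ae_eq_integral_abs mu measurableT) => //.
  under eq_integral do rewrite /= ger0_norm//.
  by rewrite -[LHS]fineK ?integrable_fin_num// [fine _]Ig0.
have UN : U `<=` N.
  by move=> y Uy; apply: gN => /= /(_ I) [gy]; have := gU y Uy; rewrite gy eqxx.
have : (mu U <= mu N)%E.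
  by apply: le_measure => //; rewrite inE//; exact: open_measurable_Rn.
rewrite N0 => U0; have := lt_le_trans (lebesgue_open_gt0 oU Ux) U0.
by rewrite ltxx.
Qed.

End LebesgueMeasure.

Lemma continuous_compact_bounded (R : realType) (T : topologicalType) (K : set T)
    (f : T -> R) : compact K -> {in K, continuous f} ->
  exists2 M : R, 0 <= M & forall x, K x -> `|f x| <= M.
Proof.
move=> cK cf.
have /compact_bounded[M [_ fM]] := continuous_compact (continuous_in_subspaceT cf) cK.
exists (`|M| + 1) => [|x Kx]; first by rewrite addr_ge0.
apply: (fM (`|M| + 1)); last by exists x.
by rewrite (le_lt_trans (ler_norm _))// ltrDl.
Qed.

Section BoundedSupport.
Context {R : realType} {n : nat}.
Implicit Types (f g h : Rn R n -> R) (K : set (Rn R n)).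

Definition bounded_with_support f :=
  [/\ measurable_fun setT f, exists M : R, forall x, `|f x| <= M &
      exists B : R, forall x, B < `|x| -> f x = 0].

Lemma bounded_with_supportD f g : bounded_with_support f -> bounded_with_support g ->
  bounded_with_support (fun x => f x + g x).
Proof.
move=> [mf [M fM] [B fB]] [mg [N gN] [C gC]]; split.
- exact: measurable_funD.
- by exists (M + N) => x; rewrite (le_trans (ler_normD _ _))// lerD.
- exists (Num.max B C) => x; rewrite gt_max => /andP[Bx Cx].
  by rewrite fB// gC// addr0.
Qed.

Lemma bounded_with_supportZ (c : R) f : bounded_with_support f ->
  bounded_with_support (fun x => c * f x).
Proof.
move=> [mf [M fM] [B fB]]; split.
- exact: measurable_funM.
- by exists (`|c| * M) => x; rewrite normrM ler_wpM2l.
- by exists B => x /fB ->; rewrite mulr0.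
Qed.

Lemma bounded_with_support_compact K f : compact K -> measurable_fun setT f ->
  (exists2 M : R, 0 <= M & forall x, K x -> `|f x| <= M) ->
  (forall x, ~ K x -> f x = 0) -> bounded_with_support f.
Proof.
move=> /compact_norm_bounded[B KB] mf [M M0 fM] f0; split => //.
- by exists M => x; have [/fM//|/f0 ->] := pselect (K x); rewrite normr0.
- by exists B => x /KB/f0.
Qed.

Variable mu : {measure set (Rn R n) -> \bar R}.
Hypothesis mu_lebesgue : is_lebesgue_measure mu.

Lemma bounded_with_support_integrable f : bounded_with_support f ->
  mu.-integrable setT (EFin \o f).
Proof.
move=> [mf [M fM] [B fB]]; pose k := (Num.truncn B).+1.
have mk : measurable (cube k : set (Rn R n)) by exact: measurable_boxco.
have -> : EFin \o f = (EFin \o f) \_ (cube k).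
  apply/funext => x; rewrite patchE; case: ifPn => //; rewrite notin_setE => kx.
  rewrite /= fB// ltNge; apply/negP => xB; apply: kx.
  by apply: norm_lt_cube; exact: le_lt_trans xB (truncnS_gt _).
apply/(integrable_mkcond _ mk); apply: measurable_bounded_integrable => //.
- exact: lebesgue_cube_lty.
- exact: measurable_funTS.
- by exists M; split => [|N MN x _ /=]; [exact: num_real|rewrite (le_trans (fM x))// ltW].
Qed.

Lemma bounded_with_support_lincomb (c1 c2 c3 : R) f g h :
  bounded_with_support f -> bounded_with_support g -> bounded_with_support h ->
  bounded_with_support (fun x => c1 * f x + c2 * g x + c3 * h x).
Proof.
by move=> bf bg bh; do 2 (apply: bounded_with_supportD; last exact: bounded_with_supportZ);
  exact: bounded_with_supportZ.
Qed.

Lemma Rintegral_lincomb (c1 c2 c3 : R) f g h :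
  bounded_with_support f -> bounded_with_support g -> bounded_with_support h ->
  (\int[mu]_x (c1 * f x + c2 * g x + c3 * h x) = c1 * \int[mu]_x f x +
    c2 * \int[mu]_x g x + c3 * \int[mu]_x h x)%R.
Proof.
move=> bf bg bh; have int := bounded_with_support_integrable.
have [cf cg ch] := And3 (bounded_with_supportZ c1 bf) (bounded_with_supportZ c2 bg)
  (bounded_with_supportZ c3 bh).
rewrite RintegralD//; [|exact/int/bounded_with_supportD|exact: int].
by rewrite RintegralD ?RintegralZl//; exact: int.
Qed.

Lemma bounded_with_support_indic_ball (M B : R) :
  bounded_with_support (fun x => M * \1_[set x : Rn R n | `|x| <= B] x).
Proof.
apply: bounded_with_supportZ; split.
- apply: measurable_indic.
  rewrite (_ : [set _ | _] = setT `&` (fun x : Rn R n => `|x| : R) @^-1` `]-oo, B]).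
    exact: (continuous_measurable_Rn continuous_norm_Rn).
  by rewrite setTI; apply/seteqP; split => x /=; rewrite in_itv.
- by exists 1 => x; rewrite indicE; case: (_ \in _); rewrite ?normr0 ?normr1.
- exists B => x Bx; rewrite indicE memNset//=.
  by apply/negP; rewrite -ltNge.
Qed.

Lemma le_indic_ball (M B : R) f : (forall x, `|f x| <= M) ->
  (forall x, B < `|x| -> f x = 0) ->
  forall x, `|f x| <= M * \1_[set x : Rn R n | `|x| <= B] x.
Proof.
move=> fM fB x; rewrite indicE; have [/set_mem xB|] := boolP (x \in _); first by rewrite mulr1.
by rewrite notin_setE/= => /negP; rewrite -ltNge => /fB ->; rewrite normr0 mulr0.
Qed.

Lemma bounded_convergence (g_ : (Rn R n -> R)^nat) g (M B : R) :
  (forall k, measurable_fun setT (g_ k)) -> measurable_fun setT g ->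
  (forall k x, `|g_ k x| <= M) -> (forall k x, B < `|x| -> g_ k x = 0) ->
  (forall x, g_ k x @[k --> \oo] --> g x) ->
  (\int[mu]_x g_ k x)%R @[k --> \oo] --> (\int[mu]_x g x)%R /\
  mu.-integrable setT (EFin \o g).
Proof.
move=> mg_ mg g_M g_B g_g.
have [|||||ig _ int_g_g] := @dominated_convergence _ _ R mu setT measurableT
  (fun k => EFin \o g_ k) (EFin \o g)
  (EFin \o (fun x => M * \1_[set x : Rn R n | `|x| <= B] x)).
- by move=> k; exact/measurable_EFinP.
- exact/measurable_EFinP.
- by apply: aeW => x _; apply: cvg_EFin; [exact: nearW|exact: g_g].
- by apply: bounded_with_support_integrable; exact: bounded_with_support_indic_ball.
- apply: aeW => x k _ /=; rewrite lee_fin.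
  by apply: le_indic_ball; [exact: g_M|exact: g_B].
split => //; apply: fine_cvg.
by rewrite fineK//; exact: integrable_fin_num.
Qed.

End BoundedSupport.

(** * Chain rule along curves *)

Section ChainRule.
Context {R : realType} {n : nat}.
Implicit Types (x v : Rn R n) (f : Rn R n -> R).

Lemma is_derive1_cvgP (phi : R -> R) (t l : R) :
  is_derive t 1 phi l <-> (h^-1 * (phi (h + t) - phi t)) @[h --> 0^'] --> l.
Proof.
have quotientE : (fun h : R => h^-1 *: ((phi \o shift t) (h *: (1:R)) - phi t)) =
  (fun h => h^-1 * (phi (h + t) - phi t)).
  by apply/funext => h /=; rewrite [_ *: 1]mulr1.
split=> [[+ <-]|quotient_l]; rewrite /derivable /derive.
  by rewrite quotientE => /cvg_ex[l' quotient_l']; rewrite (cvg_lim _ quotient_l').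
by split; rewrite /derivable /derive quotientE; [apply/cvg_ex; exists l|exact/cvg_lim].
Qed.

Lemma is_derive_continuous (phi : R -> R) (t l : R) :
  is_derive t 1 phi l -> {for t, continuous phi}.
Proof. by case=> dphi _; apply: differentiable_continuous; exact/derivable1_diffP. Qed.

Lemma is_derive_within_continuous (A : set R) (phi dphi : R -> R) :
  (forall t, A t -> is_derive t 1 phi (dphi t)) -> {within A, continuous phi}.
Proof.
move=> phi'; apply: continuous_in_subspaceT => t /set_mem At.
exact: is_derive_continuous (phi' t At).
Qed.

Lemma is_derive_line f x (e : Rn R n) (s : R) :
  derivable f (x + s *: e) e ->
  is_derive s 1 (fun s => f (x + s *: e)) ('D_e f (x + s *: e)).
Proof.
have quotientE h : h^-1 * (f (x + (h + s) *: e) - f (x + s *: e)) =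
    h^-1 *: (f (h *: e + (x + s *: e)) - f (x + s *: e)).
  by rewrite scalerDl addrCA.
by move=> df; apply/is_derive1_cvgP; under eq_fun do rewrite quotientE.
Qed.

Lemma MVT_norm (phi dphi : R -> R) (u : R) :
  (forall s : R, is_derive s 1 phi (dphi s)) ->
  exists2 c, `|c| <= `|u| & phi u - phi 0 = u * dphi c.
Proof.
move=> phi'.
have cphi (A : set R) : {within A, continuous phi}.
  by apply: is_derive_within_continuous => t _; exact: phi'.
have [u0|u0|->] := ltgtP u 0.
- have [c cu phiE] := MVT u0 (fun z _ => phi' z) (cphi _).
  exists c; last by rewrite -opprB phiE; ring.
  by move: cu; rewrite in_itv/= => /andP[? ?]; rewrite !ltr0_norm//; lra.
- have [c cu phiE] := MVT u0 (fun z _ => phi' z) (cphi _).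
  exists c; last by rewrite phiE; ring.
  by move: cu; rewrite in_itv/= => /andP[? ?]; rewrite !gtr0_norm//; lra.
- by exists 0 => //; rewrite subrr mul0r.
Qed.

(* Move from [x] to [x + v] one coordinate at a time. *)
Lemma increment_partials f x v :
  (forall i y, derivable f y (evec R i)) ->
  exists xi : 'I_n -> Rn R n, (forall i, `|xi i - x| <= `|v|) /\
    f (x + v) - f x = \sum_(i < n) coor i v * 'D_(evec R i) f (xi i).
Proof.
move=> df.
pose corner (k : nat) : Rn R n := \row_j (coor j x + (if (j < k)%N then coor j v else 0)).
have cornerS (k : 'I_n) : corner k.+1 = corner k + coor k v *: evec R k.
  apply/rowP => j; rewrite !mxE/= ?eqxx/=.
  have [->|jk] := eqVneq j k; first by rewrite ltnSn ltnn mulr1 addr0.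
  rewrite mulr0 addr0 ltnS leq_eqVlt.
  by rewrite (_ : (j == k :> nat) = false)//; apply/negbTE.
have edge (k : 'I_n) : exists xi, `|xi - x| <= `|v| /\
    f (corner k.+1) - f (corner k) = coor k v * 'D_(evec R k) f xi.
  have [c cv fE] := MVT_norm (coor k v)
    (fun s => is_derive_line (df k (corner k + s *: evec R k))).
  exists (corner k + c *: evec R k); split; last first.
    by rewrite -fE scale0r addr0 cornerS.
  apply: norm_le_coor => // j; rewrite /coor !mxE/= ?eqxx/= -/(coor j x).
  rewrite addrAC [_ - _]addrAC subrr add0r.
  have [->|jk] := eqVneq j k.
    by rewrite ltnn mulr1 add0r; apply: le_trans cv _; exact: norm_coor.
  by rewrite mulr0 addr0; case: ifP => _; rewrite ?normr0//; exact: norm_coor.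
have [xi xiP] := choice edge.
exists xi; split => [i|]; first by have [] := xiP i.
under eq_bigr do rewrite -(xiP _).2.
rewrite -(big_mkord xpredT (fun k => f (corner k.+1) - f (corner k))).
rewrite telescope_sumr//; congr (f _ - f _); apply/rowP => j; rewrite !mxE/=.
  by rewrite ltn_ord.
by rewrite addr0.
Qed.

Lemma cvg_Rn (T : Type) (F : set_system T) {FF : Filter F} (g : T -> Rn R n) (l : Rn R n) :
  (forall i, coor i (g t) @[t --> F] --> coor i l) -> g t @[t --> F] --> l.
Proof.
move=> gl; apply/cvg_ballP => e e0; near=> t.
have : forall i, ball (coor i l) e (coor i (g t)).
  by near: t; apply: filter_forall => i; move/cvg_ballP : (gl i); exact.
exact: ball_coor.
Unshelve. all: by end_near. Qed.

Lemma is_derive_curve f (g : R -> Rn R n) (dg : 'I_n -> R) t :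
  (forall i y, derivable f y (evec R i)) ->
  (forall i, {for g t, continuous ('D_(evec R i) f)}) ->
  (forall i, is_derive t 1 (fun s => coor i (g s)) (dg i)) ->
  is_derive t 1 (f \o g) (\sum_(i < n) dg i * 'D_(evec R i) f (g t)).
Proof.
move=> df cf g'.
have [xi xiP] := choice (fun h => increment_partials (g t) (g (h + t) - g t) df).
apply/is_derive1_cvgP => /=.
have quotientE h : h^-1 * (f (g (h + t)) - f (g t)) = \sum_(i < n)
   (h^-1 * (coor i (g (h + t)) - coor i (g t))) * 'D_(evec R i) f (xi h i).
  have [_] := xiP h; rewrite subrKC => ->.
  by rewrite mulr_sumr; apply: eq_bigr => i _; rewrite mulrA /coor !mxE.
under eq_fun do rewrite quotientE.
have shift_t : h + t @[h --> (0:R)^'] --> t.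
  rewrite -[X in _ --> X]add0r; apply: cvgD; last exact: cvg_cst.
  exact: cvg_within.
have gt : g (h + t) @[h --> 0^'] --> g t.
  by apply: cvg_Rn => i; exact: (cvg_comp _ _ shift_t (is_derive_continuous (g' i))).
apply: cvg_big => [|i _]; first exact: add_continuous.
apply: cvgM; first exact/is_derive1_cvgP.
suff xi_gt : xi h i @[h --> 0^'] --> g t by exact: (cvg_comp _ _ xi_gt (cf i)).
apply/cvgrPdist_le => e e0; near=> h; rewrite distrC.
apply: (le_trans ((xiP h).1 i)); rewrite distrC; near: h.
by move/cvgrPdist_le : gt; exact.
Unshelve. all: by end_near. Qed.

End ChainRule.

(** * The Euler field of the dilations *)

Lemma ler_powR_norm (R : realType) (c r a : R) :
  0 < r -> c^-1 <= r <= c -> r `^ a <= c `^ `|a|.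
Proof.
move=> r0 /andP[cr rc]; have c0 : 0 < c by exact: lt_le_trans rc.
rewrite /powR !gt_eqF// ler_expR; apply: le_trans (ler_norm _) _.
rewrite normrM; apply: ler_wpM2l => //.
by rewrite ler_norml -lnV ?posrE// !ler_ln ?posrE ?invr_gt0// cr.
Qed.

Section Euler.
Context {R : realType} {n : nat}.
Variable nu : 'I_n -> R.
Implicit Types (x : Rn R n) (f h Eh : Rn R n -> R).

Definition euler f x : R := \sum_(i < n) nu i * coor i x * 'D_(evec R i) f x.

(* Regularity is required along the dilation rays only, as for functions of the
   quasi-norm. *)
Definition is_euler h Eh := forall x (r : R), 0 < r ->
  is_derive r 1 (fun s => h (dil nu s x)) (r^-1 * Eh (dil nu r x)).

Lemma coor_dil i (r : R) x : coor i (dil nu r x) = r `^ nu i * coor i x.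
Proof. by rewrite /coor mxE. Qed.

Lemma dil1 x : dil nu 1 x = x.
Proof. by apply/rowP => i; rewrite mxE powR1 mul1r. Qed.

Lemma dilM (r s : R) x : 0 <= r -> 0 <= s -> dil nu r (dil nu s x) = dil nu (r * s) x.
Proof. by move=> r0 s0; apply/rowP => i; rewrite !mxE powRM// mulrA. Qed.

Lemma dilK (r : R) x : 0 < r -> dil nu r (dil nu r^-1 x) = x.
Proof. by move=> r0; rewrite dilM ?invr_ge0 ?(ltW r0)// mulfV ?gt_eqF// dil1. Qed.

Lemma dil_affine (r : R) : dil nu r = affine (fun=> 0) (fun i => r `^ nu i).
Proof. by apply/funext => x; apply/rowP => i; rewrite !mxE add0r. Qed.

Lemma prod_powR_hdim (r : R) : 0 < r -> \prod_(i < n) r `^ nu i = r `^ hdim nu.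
Proof.
move=> r0; rewrite /hdim; elim/big_rec2 : _ => [|i y z _ ->].
  by rewrite powRr0.
by rewrite powRD//; apply/implyP => _; rewrite gt_eqF.
Qed.

Lemma is_derive_coor_dil i (r : R) x : 0 < r ->
  is_derive r 1 (fun s => coor i (dil nu s x)) (r^-1 * (nu i * coor i (dil nu r x))).
Proof.
move=> r0; have -> : (fun s : R => coor i (dil nu s x)) = (@powR R)^~ (nu i) * cst (coor i x).
  by apply/funext => s; rewrite coor_dil.
have powR' := is_derive1_powR (nu i) r0.
apply: is_derive_eq; rewrite [_ *: 0]mulr0 add0r coor_dil.
rewrite powRB ?powRr1 ?(ltW r0)//; last by apply/implyP => _; rewrite gt_eqF.
by rewrite /GRing.scale/=; field; rewrite gt_eqF.
Qed.

Lemma cvg_dil x (r : R) : 0 < r -> dil nu s x @[s --> r] --> dil nu r x.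
Proof.
move=> r0; apply: cvg_Rn => i.
exact: is_derive_continuous (is_derive_coor_dil i x r0).
Qed.

Lemma smooth_is_euler f : smooth f -> is_euler f (euler f).
Proof.
move=> sf x r r0.
apply: (is_derive_eq (is_derive_curve _ _ (fun i => is_derive_coor_dil i x r0))).
- by move=> i y; have [_] := sf [::]; exact.
- by move=> i; have [+ _] := sf [:: i]; exact.
- rewrite /euler mulr_sumr; apply: eq_bigr => i _.
  by rewrite -!mulrA.
Qed.

Lemma smooth_continuous f : smooth f -> continuous f.
Proof. by move=> /(_ [::])[]. Qed.

Lemma continuous_euler f : smooth f -> continuous (euler f).
Proof.
move=> sf x; apply: (@cvg_big _ _ _ _ _ _ _ (nbhs x)) => [|i _]; first exact: add_continuous.
apply: cvgM; last by have [+ _] := sf [:: i]; exact.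
by apply: cvgM; [exact: cvg_cst | exact: continuous_coor].
Qed.

Lemma euler_cst (c : R) x : euler (fun=> c) x = 0.
Proof. by rewrite /euler big1// => i _; rewrite [X in _ * X](@derive_cst _ _ _ c) mulr0. Qed.

Lemma euler_off_support (K : set (Rn R n)) f x : closed K ->
  (forall y, ~ K y -> f y = 0) -> ~ K x -> euler f x = 0.
Proof.
move=> cK f0 Kx; rewrite -[RHS](euler_cst 0 x); apply: eq_bigr => i _; congr (_ * _).
apply: near_eq_derive; have : nbhs x (~` K).
  by apply: open_nbhs_nbhs; split => //; exact: closed_openC.
by apply: filterS => y; exact: f0.
Qed.

Lemma le_norm_dil (r : R) x : 2^-1 < r < 2 ->
  `|x| <= (\sum_(i < n) 2 `^ `|nu i|) * `|dil nu r x|.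
Proof.
move=> /andP[r1 r2]; have r0 : 0 < r by apply: lt_trans r1; rewrite invr_gt0.
apply: norm_le_coor; first by rewrite mulr_ge0// sumr_ge0// => i _; exact: powR_ge0.
move=> i.
have -> : coor i x = r `^ (- nu i) * coor i (dil nu r x).
  by rewrite coor_dil mulrA powRN mulVf ?mul1r// gt_eqF ?powR_gt0.
rewrite normrM; apply: ler_pM => //; last exact: norm_coor.
rewrite ger0_norm ?powR_ge0//; apply: (@le_trans _ _ (2 `^ `|nu i|)).
  by rewrite -(normrN (nu i)); apply: ler_powR_norm => //; rewrite !ltW.
by rewrite (bigD1 i)//= lerDl sumr_ge0// => j _; exact: powR_ge0.
Qed.

Lemma bounded_with_support_dil f : bounded_with_support f -> exists M B : R,
  forall r x, 2^-1 < r < 2 ->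
    `|f (dil nu r x)| <= M * \1_[set x : Rn R n | `|x| <= B] x.
Proof.
move=> [_ [M fM] [B fB]]; exists M, ((\sum_(i < n) 2 `^ `|nu i|) * `|B|) => r x r12.
rewrite indicE; have [_|] := boolP (x \in _); first by rewrite mulr1.
rewrite notin_setE/= => /negP; rewrite -ltNge => Bx.
rewrite fB ?normr0 ?mulr0//; apply: le_lt_trans (ler_norm _) _.
rewrite ltNge; apply/negP => dB; move: Bx; rewrite ltNge => /negP; apply.
apply: le_trans (le_norm_dil x r12) _; apply: ler_wpM2l => //.
by rewrite sumr_ge0// => i _; exact: powR_ge0.
Qed.

Section Integrals.
Variable mu : {measure set (Rn R n) -> \bar R}.
Hypothesis mu_lebesgue : is_lebesgue_measure mu.

Lemma integrable_dil h (r : R) : 0 < r -> mu.-integrable setT (EFin \o h) ->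
  mu.-integrable setT (EFin \o (fun x => h (dil nu r x))).
Proof.
move=> r0 ih; rewrite dil_affine; apply: (integrable_affine mu_lebesgue _ _ ih) => i.
exact: powR_gt0.
Qed.

Lemma Rintegral_dil h (r : R) : mu.-integrable setT (EFin \o h) -> 0 < r ->
  (\int[mu]_x h (dil nu r x))%R = r `^ (- hdim nu) * (\int[mu]_x h x)%R.
Proof.
move=> ih r0; rewrite dil_affine.
rewrite [in RHS](Rintegral_affine mu_lebesgue (fun=> 0) (fun i => powR_gt0 (nu i) r0))//.
by rewrite prod_powR_hdim// mulrA powRN mulVf ?mul1r// gt_eqF ?powR_gt0.
Qed.

(* Differentiate the scaling law [Rintegral_dil] at r = 1. *)
Lemma Rintegral_euler h Eh :
  bounded_with_support h -> bounded_with_support Eh -> is_euler h Eh ->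
  (\int[mu]_x Eh x)%R = - hdim nu * (\int[mu]_x h x)%R.
Proof.
move=> bh bEh hEh; have ih := bounded_with_support_integrable mu_lebesgue bh.
have [M [B EhMB]] := bounded_with_support_dil bEh.
pose G x : R := (2 * `|M|) * \1_[set x : Rn R n | `|x| <= B] x.
have iG : mu.-integrable setT (EFin \o G).
  by apply: bounded_with_support_integrable => //; exact: bounded_with_support_indic_ball.
have ray_gt0 (r : R) : `]2^-1, 2[%classic r -> 0 < r.
  by rewrite /= in_itv/= => /andP[r1 _]; apply: lt_trans r1; rewrite invr_gt0.
have ray_partial (r : R) x : 0 < r ->
    partial1of2 (fun s x => h (dil nu s x)) r x = r^-1 * Eh (dil nu r x).
  by move=> r0; rewrite partial1of2E; have [] := hEh x r r0.
have G_dominates (r : R) x : `]2^-1, 2[%classic r -> setT x ->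
    `|partial1of2 (fun r x => h (dil nu r x)) r x| <= G x.
  move=> r12 _; have r0 := ray_gt0 r r12; rewrite ray_partial// /G -mulrA normrM.
  move: r12; rewrite /= in_itv/= => r12; apply: ler_pM => //.
    rewrite ger0_norm ?invr_ge0 ?(ltW r0)// -[leRHS]invrK lef_pV2 ?posrE ?invr_gt0//.
    by have /andP[/ltW] := r12.
  by apply: le_trans (EhMB r x r12) _; apply: ler_wpM2r; rewrite ?indicE// ler_norm.
have one12 : `]2^-1, 2[%classic (1 : R) by rewrite /= in_itv/=; apply/andP; split; lra.
have int_dil (r : R) (r12 : `]2^-1, 2[%classic r) := integrable_dil (ray_gt0 r r12) ih.
have ray_derivable (r : R) x : `]2^-1, 2[%classic r -> setT x ->
    derivable (fun s => h (dil nu s x)) r 1.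
  by move=> /ray_gt0 r0 _; have [] := hEh x r r0.
have G0 x : 0 <= G x by rewrite /G !mulr_ge0.
have := differentiation_under_integral measurableT one12 int_dil ray_derivable G0 iG G_dominates.
under [in RHS]eq_Rintegral do rewrite ray_partial// invr1 mul1r dil1.
move=> <-; rewrite derive1E.
have := is_deriveZ (\int[mu]_x h x)%R (is_derive1_powR (- hdim nu) (@ltr01 R)).
rewrite powR1 mulr1 => scaling'.
have [] : is_derive (1 : R) 1 (fun r : R => \int[mu]_y h (dil nu r y))%R
    (- hdim nu * (\int[mu]_x h x)%R); last by [].
apply: near_eq_is_derive (is_derive_eq scaling' _); last by rewrite [_ *: _]mulrC.
near=> r; rewrite Rintegral_dil//; first by rewrite mulrC.
by near: r; exact: lt_nbhsr.
Unshelve. all: by end_near. Qed.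

End Integrals.
End Euler.

(** * Real powers *)

(* The library states these rules for sums, products and compositions of functions,
   which do not unify with the pointwise expressions below. *)
Section PointwiseDerivatives.
Context {R : realType}.
Implicit Types (t a c q : R) (f g : R -> R).

Lemma is_derive1D f g t (df dg : R) :
  is_derive t 1 f df -> is_derive t 1 g dg ->
  is_derive t 1 (fun s => f s + g s) (df + dg).
Proof. by move=> f' g'; exact: is_deriveD. Qed.

Lemma is_derive1M f g t (df dg : R) :
  is_derive t 1 f df -> is_derive t 1 g dg ->
  is_derive t 1 (fun s => f s * g s) (df * g t + f t * dg).
Proof.
move=> f' g'; apply: (is_derive_eq (is_deriveM f' g')).
by rewrite addrC; congr (_ + _); rewrite [_ *: _]mulrC.
Qed.

Lemma is_derive1_fun_comp f g t (df dg : R) :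
  is_derive (g t) 1 f df -> is_derive t 1 g dg ->
  is_derive t 1 (fun s => f (g s)) (df * dg).
Proof. by move=> f' g'; exact: is_derive1_comp. Qed.

Lemma is_derive1_powR_comp f t (df : R) a : 0 < f t -> is_derive t 1 f df ->
  is_derive t 1 (fun s => f s `^ a) (a * f t `^ (a - 1) * df).
Proof. by move=> f0 f'; exact: is_derive1_fun_comp (is_derive1_powR a f0) f'. Qed.

Lemma is_derive1_affine t a c : is_derive t 1 (fun s => a * s + c) a.
Proof.
apply: (is_derive_eq (is_derive1D (is_derive1M (is_derive_cst a t 1)
  (is_derive_id t 1)) (is_derive_cst c t 1))).
by rewrite mul0r add0r mulr1 addr0.
Qed.

Lemma is_derive1_Mr t q : is_derive t 1 (fun s => s * q) q.
Proof.
have -> : (fun s : R => s * q) = (fun s => q * s + 0).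
  by apply/funext => s; rewrite addr0 mulrC.
exact: is_derive1_affine.
Qed.

Lemma is_derive1_ln_ratio c q t : 0 < c -> 0 < q -> 0 < t ->
  is_derive t 1 (fun s => ln (c / (s * q))) (- t^-1).
Proof.
move=> c0 q0 t0; have tq0 : 0 < t * q by rewrite mulr_gt0.
have ln' := @is_derive1_fun_comp (@ln R) (fun s => s * q) t _ _
  (is_derive1_ln tq0) (is_derive1_Mr t q).
have diff' := is_derive1D (is_derive_cst (ln c) t 1)
  (is_derive1M (is_derive_cst (-1 : R) t 1) ln').
apply: near_eq_is_derive (is_derive_eq diff' _); last by rewrite /cst mul0r; field; rewrite !gt_eqF.
near=> s; have s0 : 0 < s by near: s; exact: lt_nbhsr.
by rewrite mulN1r ln_div ?posrE// mulr_gt0.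
Unshelve. all: by end_near. Qed.

End PointwiseDerivatives.

Section RealPowers.
Context {R : realType}.
Implicit Types (a b p x y : R).

Lemma powRD_gt0 x a b : 0 < x -> x `^ (a + b) = x `^ a * x `^ b.
Proof. by move=> x0; rewrite powRD//; apply/implyP => _; rewrite gt_eqF. Qed.

Lemma cvg_powR_gt0 (T : Type) (F : set_system T) {FF : Filter F} (f : T -> R) (l a : R) :
  0 < l -> f t @[t --> F] --> l -> (f t `^ a) @[t --> F] --> l `^ a.
Proof.
by move=> l0 fl; exact: (cvg_comp _ _ fl (is_derive_continuous (is_derive1_powR a l0))).
Qed.

Lemma cvg_powR_0 (T : Type) (F : set_system T) {FF : Filter F} (f : T -> R) (a : R) :
  0 < a -> (forall t, 0 <= f t) -> f t @[t --> F] --> 0 ->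
  (f t `^ a) @[t --> F] --> 0.
Proof.
move=> a0 f0 /cvgr0Pnorm_le fl; apply/cvgr0Pnorm_le => e e0.
have := fl (e `^ a^-1) (powR_gt0 _ e0); apply: filterS => t.
rewrite ger0_norm// => ft; rewrite ger0_norm ?powR_ge0//.
have -> : e = (e `^ a^-1) `^ a by rewrite -powRrM mulVf ?gt_eqF// powRr1// ltW.
by apply: ge0_ler_powR => //; rewrite ?nnegrE ?powR_ge0 ?f0 ?(ltW a0).
Qed.

Lemma cvg_powR (T : Type) (F : set_system T) {FF : Filter F} (f : T -> R) (l a : R) :
  0 < a -> (forall t, 0 <= f t) -> 0 <= l -> f t @[t --> F] --> l ->
  (f t `^ a) @[t --> F] --> l `^ a.
Proof.
move=> a0 f0; rewrite le_eqVlt => /predU1P[<-|l0] fl; last exact: cvg_powR_gt0.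
by rewrite powR0 ?gt_eqF//; exact: cvg_powR_0.
Qed.

Lemma powR_le_endpoints lo hi x a : 0 < lo -> lo <= x <= hi ->
  x `^ a <= lo `^ a + hi `^ a.
Proof.
move=> lo0 /andP[lox xhi]; have x0 : 0 < x by exact: lt_le_trans lox.
have [a0|a0] := leP 0 a.
  apply: (@le_trans _ _ (hi `^ a)); last by rewrite lerDr powR_ge0.
  by apply: ge0_ler_powR => //; rewrite nnegrE ?(ltW x0)// (le_trans (ltW x0)).
apply: (@le_trans _ _ (lo `^ a)); last by rewrite lerDl powR_ge0.
rewrite -[a]opprK !(powRN _ (- a)) lef_pV2 ?posrE ?powR_gt0//.
by apply: ge0_ler_powR => //; rewrite ?nnegrE ?oppr_ge0 ?ltW.
Qed.

Lemma bernoulli_powR p x : 1 < p -> 0 <= x -> x != 1 -> 1 + p * (x - 1) < x `^ p.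
Proof.
move=> p1; rewrite le_eqVlt => /predU1P[<- _|x0 x1].
  by rewrite powR0; [lra|rewrite gt_eqF//; lra].
pose gap s := s `^ p + (- p * s + 0).
have gap' (s : R) : 0 < s -> is_derive s 1 gap (p * s `^ (p - 1) - p).
  by move=> s0; exact: is_derive1D (is_derive1_powR p s0) (is_derive1_affine s (- p) 0).
have gap_mvt (u v : R) : 0 < u -> u < v -> exists2 c, u < c < v &
    gap v - gap u = p * (c `^ (p - 1) - 1) * (v - u).
  move=> u0 uv.
  have [| |c cuv gapE] := @MVT R gap (fun s => p * s `^ (p - 1) - p) u v uv.
  - by move=> s; rewrite in_itv/= => /andP[us _]; apply: gap'; exact: lt_trans us.
  - apply: is_derive_within_continuous => s /=; rewrite in_itv/= => /andP[us _].
    by apply: gap'; exact: lt_le_trans us.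
  - by exists c; [move: cuv; rewrite in_itv|rewrite gapE; ring].
have gap1 : gap 1 = 1 - p by rewrite /gap powR1; ring.
suff : gap 1 < gap x by rewrite gap1 /gap; lra.
have powR1_id : 1 `^ (p - 1) = 1 :> R by rewrite powR1.
have p10 : 0 < p - 1 by rewrite subr_gt0.
case: (ltgtP x 1) x1 => // x1 _.
- have [c /andP[xc c1] gapE] := gap_mvt x 1 x0 x1.
  rewrite -subr_lt0 gapE pmulr_llt0 ?subr_gt0// pmulr_rlt0 ?subr_lt0; last by lra.
  by rewrite -[ltRHS]powR1_id gt0_ltr_powR ?nnegrE//; lra.
- have [c /andP[c1 cx] gapE] := gap_mvt 1 x ltr01 x1.
  rewrite -subr_gt0 gapE !pmulr_rgt0 ?subr_gt0//; last exact: lt_trans p1.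
  by rewrite -[ltLHS]powR1_id gt0_ltr_powR ?nnegrE//; lra.
Qed.

Lemma powR_gt_tangent p b x : 1 < p -> 0 <= b -> 0 <= x -> x != b ->
  b `^ p + p * b `^ (p - 1) * (x - b) < x `^ p.
Proof.
move=> p1 + x0; have p0 : 0 < p by exact: lt_trans p1.
rewrite le_eqVlt => /predU1P[<- x_neq0|b0 xb].
  rewrite !powR0 ?gt_eqF ?subr_gt0// mulr0 mul0r addr0 powR_gt0//.
  by rewrite lt_neqAle eq_sym x_neq0.
have xb0 : 0 <= x / b by rewrite divr_ge0// ltW.
have xb1 : x / b != 1.
  by apply: contra xb => /eqP xb1; rewrite -(divfK (lt0r_neq0 b0) x) xb1 mul1r.
have := bernoulli_powR p1 xb0 xb1.
rewrite -(ltr_pM2l (powR_gt0 p b0)) -powRM ?(ltW b0)//.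
rewrite [b * _]mulrC divfK ?gt_eqF//; apply: le_lt_trans.
rewrite -(mulr_powRB1 (ltW b0) p0) le_eqVlt; apply/orP; left; apply/eqP.
by field; rewrite gt_eqF.
Qed.

End RealPowers.

(** * The remainder C_p *)

Section Modulus.
Context {R : realType}.
Implicit Types (z w : R[i]) (c p : R).

Lemma cabsE z : cabs z = Normc.normc z.
Proof. by case: z. Qed.

Lemma cabs_ge0 z : 0 <= cabs z. Proof. exact: sqrtr_ge0. Qed.

Lemma cabs0 : cabs (0 : R[i]) = 0.
Proof. by rewrite cabsE Normc.normc0. Qed.

Lemma cabs_eq0 z : cabs z = 0 -> z = 0.
Proof. by rewrite cabsE => /Normc.eq0_normc. Qed.

Lemma cabs_gt0 z : z != 0 -> 0 < cabs z.
Proof.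
move=> z0; rewrite lt_neqAle cabs_ge0 andbT eq_sym.
by apply: contra z0 => /eqP/cabs_eq0/eqP.
Qed.

Lemma cabs_real c : cabs c%:C%C = `|c|.
Proof. by rewrite /cabs/= expr0n/= addr0 sqrtr_sqr. Qed.

Lemma cabs_Mreal z c : cabs (z * c%:C%C) = cabs z * `|c|.
Proof. by rewrite !cabsE Normc.normcM -!cabsE cabs_real. Qed.

Lemma complex_Mreal z c :
  z * c%:C%C = Complex (complex.Re z * c) (complex.Im z * c).
Proof.
by case: z => a b; apply/eqP; rewrite eq_complex/= !mulr0 subr0 add0r !eqxx.
Qed.

Definition cdot z w : R := complex.Re z * complex.Re w + complex.Im z * complex.Im w.

Lemma cdotzz z : cdot z z = cabs z ^+ 2.
Proof. by rewrite /cabs sqr_sqrtr ?addr_ge0 ?sqr_ge0// /cdot -!expr2. Qed.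

Lemma cdot_Mreal z w (b c : R) : cdot (z * b%:C%C) (w * c%:C%C) = b * c * cdot z w.
Proof. by rewrite !complex_Mreal /cdot/=; ring. Qed.

Lemma norm_cdot_le z w : `|cdot z w| <= cabs z * cabs w.
Proof.
rewrite -[leRHS]ger0_norm ?mulr_ge0 ?cabs_ge0// -ler_sqr ?nnegrE//.
rewrite !real_normK ?num_real// exprMn -!cdotzz /cdot.
have := sqr_ge0 (complex.Re z * complex.Im w - complex.Im z * complex.Re w).
by nra.
Qed.

Lemma cdot_le z w : cdot z w <= cabs z * cabs w.
Proof. exact: le_trans (ler_norm _) (norm_cdot_le z w). Qed.

Lemma cdot_lt z w : z != w -> cabs z = cabs w -> cdot z w < cabs z * cabs w.
Proof.
move=> zw zw_abs; have : 0 < cdot (z - w) (z - w).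
  by rewrite cdotzz exprn_gt0// cabs_gt0// subr_eq0.
have := cdotzz z; have := cdotzz w; rewrite -zw_abs /cdot !raddfB/=.
by nra.
Qed.

Lemma is_derive_cabs_powR_eq0 (u v : R -> R) (t du dv p : R) : 1 < p ->
  is_derive t 1 u du -> is_derive t 1 v dv -> u t = 0 -> v t = 0 ->
  is_derive t 1 (fun s => cabs (Complex (u s) (v s)) `^ p) 0.
Proof.
move=> p1 /is_derive1_cvgP u' /is_derive1_cvgP v' u0 v0; apply/is_derive1_cvgP.
have p0 : p != 0 by rewrite gt_eqF//; lra.
rewrite /= u0 v0 cabs0 powR0//; rewrite u0 in u'; rewrite v0 in v'.
pose N h := cabs (Complex (u (h + t)) (v (h + t))).
pose slope h := cabs (Complex (h^-1 * (u (h + t) - 0)) (h^-1 * (v (h + t) - 0))).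
have slope_cvg : slope h @[h --> 0^'] --> cabs (Complex du dv).
  have c : (h^-1 * (u (h + t) - 0)) ^+ 2 + (h^-1 * (v (h + t) - 0)) ^+ 2
      @[h --> 0^'] --> du ^+ 2 + dv ^+ 2.
    by rewrite !expr2; apply: cvgD; under eq_fun do rewrite expr2; exact: cvgM.
  exact: (cvg_comp _ _ c (@sqrt_continuous R _)).
have NE h : h != 0 -> N h = `|h| * slope h.
  move=> h0; rewrite mulrC /N /slope -cabs_Mreal complex_Mreal/= !subr0.
  by rewrite ![_ * h]mulrC !mulVKf.
have N_cvg0 : N h @[h --> 0^'] --> 0.
  have c : `|h| * slope h @[h --> (0:R)^'] --> 0.
    rewrite -[X in _ --> X](mul0r (cabs (Complex du dv))); apply: cvgM => //.
    by rewrite -[X in _ --> X](@normr0 _ R); apply: cvg_norm; exact: cvg_within.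
  apply: cvg_trans c; apply: near_eq_cvg; near=> h.
  by rewrite NE//; near: h; exact: nbhs_dnbhs_neq.
have c : slope h * N h `^ (p - 1) @[h --> 0^'] --> 0.
  rewrite -[X in _ --> X](mulr0 (cabs (Complex du dv))); apply: cvgM => //.
  by apply: cvg_powR_0 => // [|h]; [rewrite subr_gt0|exact: cabs_ge0].
apply: norm_cvg0; apply: cvg_trans c; apply: near_eq_cvg; near=> h.
have h0 : h != 0 by near: h; exact: nbhs_dnbhs_neq.
rewrite subr0 normrM normfV (ger0_norm (powR_ge0 _ _)) -/(N h).
have -> : N h `^ p = N h * N h `^ (p - 1) by rewrite mulr_powRB1 ?cabs_ge0//; lra.
by rewrite NE// !mulrA mulVf ?mul1r// normr_eq0.
Unshelve. all: by end_near. Qed.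

Lemma is_derive_cabs_powR (u v : R -> R) (t du dv p : R) : 1 < p ->
  is_derive t 1 u du -> is_derive t 1 v dv ->
  is_derive t 1 (fun s => cabs (Complex (u s) (v s)) `^ p)
    (p * cabs (Complex (u t) (v t)) `^ (p - 2) *
     cdot (Complex (u t) (v t)) (Complex du dv)).
Proof.
move=> p1 u' v'; rewrite /cdot/=.
have cabsE2 s q : cabs (Complex (u s) (v s)) `^ q = (u s * u s + v s * v s) `^ (q / 2).
  by rewrite /cabs -powR12_sqrt ?addr_ge0 ?sqr_ge0// -powRrM mulrC !expr2.
have [/cabs_eq0[u0 v0]|nz] := eqVneq (cabs (Complex (u t) (v t))) 0.
  apply: (is_derive_eq (is_derive_cabs_powR_eq0 p1 u' v' u0 v0)).
  by rewrite u0 v0 !mul0r addr0 mulr0.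
have sq0 : 0 < u t * u t + v t * v t.
  have : 0 < cabs (Complex (u t) (v t)) ^+ 2 by rewrite exprn_even_gt0.
  by rewrite -cdotzz.
have powR' := @is_derive1_powR_comp R (fun s => u s * u s + v s * v s) t _ (p / 2)
  sq0 (is_derive1D (is_derive1M u' u') (is_derive1M v' v')).
under eq_fun do rewrite cabsE2.
apply: (is_derive_eq powR').
by rewrite cabsE2 (_ : (p - 2) / 2 = p / 2 - 1); field.
Qed.

End Modulus.

Section Remainder.
Context {R : realType}.
Implicit Types (xi eta : R[i]) (p : R).

Lemma CpE p xi eta : 1 < p ->
  Cp p xi eta = cabs xi `^ p + (p - 1) * cabs (xi - eta) `^ p -
    p * cabs (xi - eta) `^ (p - 2) * cdot (xi - eta) xi.
Proof.
move=> p1; rewrite /Cp.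
have p0 : p != 0 by rewrite gt_eqF//; lra.
have [->|xi_eta] := eqVneq xi eta.
  by rewrite subrr cabs0 powR0// /cdot/= !mul0r addr0 !mulr0 !subr0 addr0.
set b := xi - eta; have b0 : 0 < cabs b by rewrite cabs_gt0// subr_eq0.
have -> : cabs b `^ p = cabs b `^ (p - 2) * cdot b b.
  by rewrite cdotzz -powR_mulrn ?cabs_ge0// -powRD_gt0// subrK.
have -> : eta = xi - b by rewrite /b opprB addrC subrK.
move: b {b0} => [b1 b2]; case: xi {xi_eta} => [x1 x2]; rewrite /cdot/=.
by ring.
Qed.

Lemma Cp_gt0 p xi eta : 1 < p -> eta != 0 -> 0 < Cp p xi eta.
Proof.
move=> p1 eta0; rewrite CpE//; set b := xi - eta.
have xi_b : xi != b by rewrite -subr_eq0 /b opprB addrC subrK.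
have p0 : 0 < p by exact: lt_trans p1.
have [b0|b_neq0] := eqVneq b 0.
  rewrite b0 cabs0 powR0 ?gt_eqF// /cdot/= !mul0r addr0 !mulr0 addr0 subr0.
  by rewrite powR_gt0// cabs_gt0// -b0.
have b0 := cabs_gt0 b_neq0.
have powRp : cabs b `^ p = cabs b `^ (p - 1) * cabs b.
  by rewrite mulrC mulr_powRB1// ltW.
have powRp1 : cabs b `^ (p - 1) = cabs b `^ (p - 2) * cabs b.
  by rewrite -[X in _ * X]powRr1 ?(ltW b0)// -powRD_gt0//; congr (_ `^ _); ring.
have coef0 : 0 < p * cabs b `^ (p - 2) by rewrite mulr_gt0// powR_gt0.
have [xi_abs|xi_abs] := eqVneq (cabs xi) (cabs b).
  have : p * cabs b `^ (p - 2) * cdot b xi < p * cabs b `^ (p - 2) * (cabs b * cabs xi).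
    by rewrite ltr_pM2l// cdot_lt// eq_sym.
  by rewrite xi_abs powRp powRp1; lra.
have := powR_gt_tangent p1 (ltW b0) (cabs_ge0 xi) xi_abs.
have : p * cabs b `^ (p - 2) * cdot b xi <= p * cabs b `^ (p - 2) * (cabs b * cabs xi).
  by rewrite ler_pM2l// cdot_le.
by rewrite powRp powRp1; lra.
Qed.

Lemma Cp0 p xi : Cp p xi 0 = 0.
Proof.
rewrite /Cp subr0 subrr; case: ifP => _; first by rewrite subr0.
by rewrite conjC0 mulr0 mulr0 subr0.
Qed.

Lemma Cp_ge0 p xi eta : 1 < p -> 0 <= Cp p xi eta.
Proof.
move=> p1; have [->|eta0] := eqVneq eta 0; first by rewrite Cp0.
exact/ltW/Cp_gt0.
Qed.

End Remainder.

(** * Weights in the quasi-norm and its logarithm *)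

Section Weights.
Context {R : realType} {n : nat}.
Variables (nu : 'I_n -> R) (qn : Rn R n -> R) (R0 : R).
Hypotheses (qn_quasi : quasi_norm nu qn) (R0_gt0 : 0 < R0).
Implicit Types (x : Rn R n) (a b c : R).

Lemma qn_ge0 x : 0 <= qn x. Proof. by case: qn_quasi. Qed.

Lemma qn_continuous : continuous qn. Proof. by case: qn_quasi. Qed.

Lemma qn_dil (r : R) x : 0 < r -> qn (dil nu r x) = r * qn x.
Proof. by case: qn_quasi => _ _ _ + _; exact. Qed.

Lemma qn_eq0 x : qn x = 0 <-> x = 0. Proof. by case: qn_quasi. Qed.

Lemma qn_gt0 x : x != 0 -> 0 < qn x.
Proof.
by move=> x0; rewrite lt_neqAle qn_ge0 andbT eq_sym; apply: contra_neq x0 => /qn_eq0.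
Qed.

Lemma Lw_gt0 x : 0 < qn x < R0 -> 0 < Lw qn R0 x.
Proof. by move=> /andP[q0 qR]; rewrite /Lw ln_gt0// ltr_pdivlMr// mul1r. Qed.

Lemma Lw_dil (r : R) x : 0 < r -> 0 < qn x -> Lw qn R0 (dil nu r x) = Lw qn R0 x - ln r.
Proof.
move=> r0 q0; rewrite /Lw qn_dil// !ln_div ?posrE ?mulr_gt0// lnM ?posrE//.
by ring.
Qed.

Definition weight a b x : R := qn x `^ (- a) * Lw qn R0 x `^ (- b).

Lemma weightE a b x : (qn x `^ a * Lw qn R0 x `^ b)^-1 = weight a b x.
Proof. by rewrite invfM /weight !powRN. Qed.

Lemma weight_ge0 a b x : 0 <= weight a b x.
Proof. by rewrite mulr_ge0// powR_ge0. Qed.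

Lemma weight_gt0 a b x : 0 < qn x < R0 -> 0 < weight a b x.
Proof. by move=> qx; have /andP[q0 _] := qx; rewrite mulr_gt0 ?powR_gt0 ?Lw_gt0. Qed.

Lemma weight_powR a b c x : weight a b x `^ c = weight (a * c) (b * c) x.
Proof. by rewrite /weight powRM ?powR_ge0// -!powRrM !mulNr. Qed.

Lemma weightM a b a' b' x : 0 < qn x < R0 ->
  weight a b x * weight a' b' x = weight (a + a') (b + b') x.
Proof.
move=> qx; have /andP[q0 _] := qx.
by rewrite /weight !opprD !powRD_gt0 ?Lw_gt0//; ring.
Qed.

Lemma weight_succ_Lw a b x : 0 < qn x < R0 -> weight a (b + 1) x * Lw qn R0 x = weight a b x.
Proof.
move=> qx; have L0 := Lw_gt0 qx; rewrite /weight -mulrA; congr (_ * _).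
by rewrite -[X in _ * X]powRr1 ?(ltW L0)// -powRD_gt0//; congr (_ `^ _); ring.
Qed.

Lemma measurable_weight a b : measurable_fun setT (weight a b).
Proof.
have mqn : measurable_fun setT qn by exact: continuous_measurable_Rn qn_continuous.
apply: measurable_funM; apply: (measurableT_comp (measurable_powR _)) => //.
rewrite /Lw; apply: (measurableT_comp (@measurable_ln R)).
under eq_fun do rewrite -powR_inv1 ?qn_ge0//.
apply: measurable_funM => //.
exact: (measurableT_comp (measurable_powR _)).
Qed.

Lemma continuous_Lw x : 0 < qn x -> {for x, continuous (Lw qn R0)}.
Proof.
move=> q0; have ratio_cvg : R0 / qn y @[y --> x] --> R0 / qn x.
  apply: (@cvgM _ _ (nbhs x) _ (fun=> R0) (fun y => (qn y)^-1)); first exact: cvg_cst.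
  by apply: (@cvgV _ _ (nbhs x) _ qn (qn x)); [exact: lt0r_neq0|exact: qn_continuous].
by apply: (cvg_comp _ _ ratio_cvg); apply: continuous_ln; rewrite divr_gt0.
Qed.

Lemma continuous_weight a b x : 0 < qn x < R0 -> {for x, continuous (weight a b)}.
Proof.
move=> qx; have /andP[q0 _] := qx.
apply: (@cvgM _ _ (nbhs x) _ (fun y => qn y `^ (- a)) (fun y => Lw qn R0 y `^ (- b))).
  by apply: (@cvg_powR_gt0 _ _ (nbhs x)) => //; exact: qn_continuous.
by apply: (@cvg_powR_gt0 _ _ (nbhs x)); [exact: Lw_gt0|exact: continuous_Lw].
Qed.

Lemma is_derive_weight_dil a b x (r : R) : 0 < r -> 0 < qn (dil nu r x) < R0 ->
  is_derive r 1 (fun s => weight a b (dil nu s x))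
    (r^-1 * (b * weight a (b + 1) (dil nu r x) - a * weight a b (dil nu r x))).
Proof.
move=> r0 qy; have L0 := Lw_gt0 qy; rewrite /Lw !qn_dil// in qy L0.
have /andP[rq0 _] := qy; have q0 : 0 < qn x by rewrite pmulr_rgt0 in rq0.
have qn' := @is_derive1_powR_comp R (fun s => s * qn x) r _ (- a) rq0 (is_derive1_Mr r _).
have Lw' := @is_derive1_powR_comp R (fun s => ln (R0 / (s * qn x))) r _ (- b) L0
  (is_derive1_ln_ratio R0_gt0 q0 r0).
have weight' := is_derive1M qn' Lw'.
apply: near_eq_is_derive (is_derive_eq weight' _).
  near=> s; have s0 : 0 < s by near: s; exact: lt_nbhsr.
  by rewrite /weight /Lw qn_dil.
rewrite /weight /Lw qn_dil// opprD.
have -> : (r * qn x) `^ (- a - 1) = (r * qn x) `^ (- a) / (r * qn x).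
  by rewrite powRD_gt0// powR_inv1// ltW.
by field; rewrite !gt_eqF.
Unshelve. all: by end_near. Qed.

End Weights.

(** * The Hardy identity *)

Section ComplexEuler.
Context {R : realType} {n : nat}.
Implicit Types (x : Rn R n) (f : Rn R n -> R[i]).

Definition ceuler (nu : 'I_n -> R) f x : R[i] :=
  Complex (euler nu (fun y => complex.Re (f y)) x) (euler nu (fun y => complex.Im (f y)) x).

Definition ccontinuous f := continuous (fun x => complex.Re (f x)) /\
  continuous (fun x => complex.Im (f x)).

Lemma continuous_cabs (u v : Rn R n -> R) x :
  {for x, continuous u} -> {for x, continuous v} ->
  {for x, continuous (fun y => cabs (Complex (u y) (v y)))}.
Proof.
move=> cu cv.
have sqr_cvg : u y ^+ 2 + v y ^+ 2 @[y --> x] --> u x ^+ 2 + v x ^+ 2.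
  by rewrite !expr2; apply: (@cvgD _ _ _ (nbhs x)); under eq_fun do rewrite expr2;
    apply: (@cvgM _ _ (nbhs x)).
exact: (cvg_comp _ _ sqr_cvg (@sqrt_continuous R _)).
Qed.

Lemma ccontinuous_cabs f : ccontinuous f -> continuous (fun x => cabs (f x)).
Proof. by move=> [cu cv] x; exact: continuous_cabs (cu x) (cv x). Qed.

Lemma ccontinuous_cdot f g : ccontinuous f -> ccontinuous g ->
  continuous (fun x => cdot (f x) (g x)).
Proof.
move=> [cu cv] [cu' cv'] x.
by apply: (@cvgD _ _ _ (nbhs x)); apply: (@cvgM _ _ (nbhs x));
  [exact: cu|exact: cu'|exact: cv|exact: cv'].
Qed.

Lemma ccontinuous_cabs_powR f (a : R) : 0 < a -> ccontinuous f ->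
  continuous (fun x => cabs (f x) `^ a).
Proof.
move=> a0 cf x; apply: (@cvg_powR _ _ (nbhs x)) => //; first by move=> y; exact: cabs_ge0.
- exact: cabs_ge0.
- exact: ccontinuous_cabs.
Qed.

End ComplexEuler.

Section WeightedPowers.
Context {R : realType} {n : nat}.
Variables (nu : 'I_n -> R) (qn : Rn R n -> R) (R0 : R).
Hypotheses (qn_quasi : quasi_norm nu qn) (R0_gt0 : 0 < R0).
Implicit Types (x : Rn R n) (K : set (Rn R n)) (f g : Rn R n -> R[i]) (a b p : R).

Definition weighted_powR p a b g x : R := cabs (g x) `^ p * weight qn R0 a b x.

Definition weighted_cdot p a b f x : R :=
  cabs (f x) `^ (p - 2) * cdot (f x) (ceuler nu f x) * weight qn R0 a b x.

Definition test_function K f :=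
  [/\ smooth (fun x => complex.Re (f x)), smooth (fun x => complex.Im (f x)),
      compact K, K `<=` [set x | qn x < R0] `\ 0 & forall x, ~ K x -> f x = 0].

Variables (K : set (Rn R n)) (f : Rn R n -> R[i]).
Hypothesis f_test : test_function K f.

Lemma ccontinuous_test : ccontinuous f.
Proof. by case: f_test => su sv _ _ _; split; exact: smooth_continuous. Qed.

Lemma ccontinuous_ceuler : ccontinuous (ceuler nu f).
Proof. by case: f_test => su sv _ _ _; split; exact: continuous_euler. Qed.

Lemma test_off_support x : ~ K x -> f x = 0.
Proof. by case: f_test => _ _ _ _; exact. Qed.

Lemma compact_support : compact K. Proof. by case: f_test. Qed.

Lemma ceuler_off_support x : ~ K x -> ceuler nu f x = 0.
Proof.
move=> Kx; have closK := compact_closed_Rn compact_support.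
by rewrite /ceuler !(euler_off_support _ closK)// => y /test_off_support ->.
Qed.

Lemma qn_support x : K x -> 0 < qn x < R0.
Proof.
case: f_test => _ _ _ KR _ /KR[/= -> x0]; rewrite andbT.
by apply: (qn_gt0 qn_quasi); exact/eqP.
Qed.

Lemma off_qball_off_support x : ~ qball qn R0 x -> ~ K x.
Proof. by move=> qRx /qn_support/andP[_]. Qed.

Lemma bounded_with_support_weighted (g : Rn R n -> R) a b :
  measurable_fun setT g -> (exists2 M : R, 0 <= M & forall x, K x -> `|g x| <= M) ->
  (forall x, ~ K x -> g x = 0) ->
  bounded_with_support (fun x => g x * weight qn R0 a b x).
Proof.
move=> mg [M M0 gM] g0; apply: (bounded_with_support_compact compact_support).
- by apply: measurable_funM => //; exact: (measurable_weight _ qn_quasi).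
- have [|N N0 wN] := continuous_compact_bounded (f := weight qn R0 a b) compact_support.
    by move=> x /set_mem Kx; apply: (continuous_weight qn_quasi) => //; exact: qn_support.
  exists (M * N) => [|x Kx]; first exact: mulr_ge0.
  by rewrite normrM; apply: ler_pM => //; [exact: gM|exact: wN].
- by move=> x Kx; rewrite g0// mul0r.
Qed.

Lemma bounded_with_support_powR g p a b : 0 < p -> ccontinuous g ->
  (forall x, ~ K x -> g x = 0) -> bounded_with_support (weighted_powR p a b g).
Proof.
move=> p0 cg g0; have cgp := ccontinuous_cabs_powR p0 cg.
apply: bounded_with_support_weighted.
- exact: continuous_measurable_Rn.
- exact: continuous_compact_bounded compact_support (in1W cgp).
- by move=> x /g0 ->; rewrite cabs0 powR0// gt_eqF.
Qed.

Lemma bounded_with_support_cdot p a b : 1 < p -> bounded_with_support (weighted_cdot p a b f).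
Proof.
move=> p1; have cf := ccontinuous_test; have cEf := ccontinuous_ceuler.
apply: bounded_with_support_weighted.
- apply: measurable_funM; last exact: continuous_measurable_Rn (ccontinuous_cdot cf cEf).
  apply: (measurableT_comp (measurable_powR _)).
  exact: continuous_measurable_Rn (ccontinuous_cabs cf).
- have p10 : 0 < p - 1 by rewrite subr_gt0.
  have [M M0 fM] :=
    continuous_compact_bounded compact_support (in1W (ccontinuous_cabs_powR p10 cf)).
  have [N N0 EfN] := continuous_compact_bounded compact_support (in1W (ccontinuous_cabs cEf)).
  exists (M * N) => [|x Kx]; first exact: mulr_ge0.
  have fxM : cabs (f x) `^ (p - 1) <= M by apply: le_trans (fM x Kx); exact: ler_norm.
  have EfxN : cabs (ceuler nu f x) <= N by apply: le_trans (EfN x Kx); exact: ler_norm.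
  rewrite normrM ger0_norm ?powR_ge0//.
  apply: le_trans (ler_wpM2l (powR_ge0 _ _) (norm_cdot_le _ _)) _.
  rewrite mulrCA mulrA (_ : p - 2 = p - 1 - 1); last by ring.
  rewrite mulr_powRB1 ?cabs_ge0//.
  by apply: ler_pM; rewrite ?powR_ge0 ?cabs_ge0.
- by move=> x /test_off_support ->; rewrite /cdot !mul0r addr0 mulr0.
Qed.

Lemma weighted_powR_is_euler p a b : 1 < p ->
  is_euler nu (weighted_powR p a b f) (fun x => p * weighted_cdot p a b f x +
    - a * weighted_powR p a b f x + b * weighted_powR p a (b + 1) f x).
Proof.
move=> p1 x r r0; set y := dil nu r x.
have [su sv _ _ _] := f_test; have p0 : p != 0 by rewrite gt_eqF//; lra.
have [Ky|Ky] := pselect (K y); last first.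
  rewrite /weighted_powR /weighted_cdot (test_off_support Ky) cabs0 (powR0 p0).
  rewrite /cdot/= !(mulr0, mul0r, addr0).
  apply: near_eq_is_derive (is_derive_cst (0 : R) r 1).
  have closK := compact_closed_Rn compact_support.
  have nbhs_Kc : nbhs y (~` K) by apply: open_nbhs_nbhs; split => //; exact: closed_openC.
  near=> s; have /test_off_support -> : ~ K (dil nu s x).
    by near: s; exact: cvg_dil r0 _ nbhs_Kc.
  by rewrite cabs0 powR0// mul0r.
have powR' := is_derive_cabs_powR p1 (smooth_is_euler nu su x r0)
  (smooth_is_euler nu sv x r0).
have weight' := is_derive_weight_dil qn_quasi R0_gt0 a b r0 (qn_support Ky).
have f_dil s : f (dil nu s x) = Complex (complex.Re (f (dil nu s x))) (complex.Im (f (dil nu s x))).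
  by case: (f _).
rewrite /weighted_powR; under eq_fun do rewrite f_dil.
apply: (is_derive_eq (is_derive1M powR' weight')).
rewrite /weighted_cdot -f_dil -/y (_ : cdot _ _ = r^-1 * cdot (f y) (ceuler nu f y)).
  by ring.
by rewrite /cdot/=; ring.
Unshelve. all: by end_near. Qed.

End WeightedPowers.

Section HardyIdentity.
Context {R : realType} {n : nat}.
Variables (nu : 'I_n -> R) (qn : Rn R n -> R)
  (mu : {measure set (Rn R n) -> \bar R}) (R0 p alpha beta : R).
Hypotheses (mu_lebesgue : is_lebesgue_measure mu) (qn_quasi : quasi_norm nu qn)
  (R0_gt0 : 0 < R0) (p_gt1 : 1 < p).
Implicit Types (x : Rn R n) (f : Rn R n -> R[i]) (K : set (Rn R n)).

Let p_gt0 : 0 < p. Proof. exact: lt_trans p_gt1. Qed.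
Let p_neq0 : p != 0. Proof. exact: lt0r_neq0. Qed.

Local Notation kappa := ((beta + p) / p).
Local Notation xi := (xi_f nu qn R0 p alpha beta).
Local Notation eta := (eta_f nu qn R0 p alpha beta).

Section FixedSupport.
Variables (K : set (Rn R n)) (f : Rn R n -> R[i]).
Hypothesis f_test : test_function qn R0 K f.

Let bounded_powR a b := bounded_with_support_powR qn_quasi R0_gt0 f_test a b p_gt0
  (ccontinuous_test f_test) (test_off_support f_test).
Let bounded_euler_powR a b := bounded_with_support_powR qn_quasi R0_gt0 f_test a b p_gt0
  (ccontinuous_ceuler nu f_test) (ceuler_off_support nu f_test).
Let bounded_cdot a b := bounded_with_support_cdot qn_quasi R0_gt0 f_test a b p_gt1.

Lemma Rintegral_weighted_powR a b :
  p * (\int[mu]_x weighted_cdot nu qn R0 p a b f x)%R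
  + - a * (\int[mu]_x weighted_powR qn R0 p a b f x)%R
  + b * (\int[mu]_x weighted_powR qn R0 p a (b + 1) f x)%R
  = - hdim nu * (\int[mu]_x weighted_powR qn R0 p a b f x)%R.
Proof.
rewrite -Rintegral_lincomb//; apply: (Rintegral_euler mu_lebesgue) => //.
  exact: bounded_with_support_lincomb.
exact: (weighted_powR_is_euler qn_quasi R0_gt0 f_test).
Qed.

Lemma radderivE x : radderiv nu qn f x = ceuler nu f x / (qn x)%:C%C.
Proof.
rewrite -fmorphV complex_Mreal /ceuler/= /radderiv.
have [->|x0] := eqVneq x 0.
  have dil0 (r : R) : dil nu r (0 : Rn R n) = 0 by apply/rowP => i; rewrite !mxE mulr0.
  rewrite (qn_eq0 qn_quasi 0).2// invr0 !mulr0 dil0.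
  by congr Complex; under eq_fun do rewrite dil0; rewrite derive1_cst.
have q0 := qn_gt0 qn_quasi x0; have [su sv _ _ _] := f_test.
have [_ u'] := smooth_is_euler nu su (dil nu (qn x)^-1 x) q0.
have [_ v'] := smooth_is_euler nu sv (dil nu (qn x)^-1 x) q0.
by rewrite !derive1E u' v' dilK// ![_^-1 * _]mulrC.
Qed.

Let qball_support (g : Rn R n -> R[i]) a b : (forall x, ~ K x -> g x = 0) ->
  (\int[mu]_(x in qball qn R0) weighted_powR qn R0 p a b g x)%R =
  (\int[mu]_x weighted_powR qn R0 p a b g x)%R.
Proof.
move=> g0; apply: Rintegral_off_support => x /(off_qball_off_support qn_quasi f_test)/g0 gx.
by rewrite /weighted_powR gx cabs0 powR0// mul0r.
Qed.

Lemma I_fE : I_f qn mu R0 p alpha beta f =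
  (\int[mu]_x weighted_powR qn R0 p (alpha + p) (beta + p + 1) f x)%R.
Proof.
rewrite -(qball_support _ _ (test_off_support f_test)).
by apply: eq_Rintegral => x _; rewrite weightE.
Qed.

Lemma I_f'E : I_f' qn mu R0 p alpha beta f =
  (\int[mu]_x weighted_powR qn R0 p (alpha + p) (beta + p) f x)%R.
Proof.
rewrite -(qball_support _ _ (test_off_support f_test)).
by apply: eq_Rintegral => x _; rewrite weightE.
Qed.

Lemma I_RfE : I_Rf nu qn mu R0 p alpha beta f =
  (\int[mu]_x weighted_powR qn R0 p (alpha + p) (beta + 1) (ceuler nu f) x)%R.
Proof.
rewrite -(qball_support _ _ (ceuler_off_support nu f_test)).
apply: eq_Rintegral => x _; rewrite weightE radderivE /weighted_powR.
have [Kx|Kx] := pselect (K x); last first.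
  by rewrite (ceuler_off_support nu f_test Kx) mul0r cabs0 powR0// !mul0r.
have /andP[q0 _] := qn_support qn_quasi f_test Kx.
rewrite -fmorphV cabs_Mreal powRM ?cabs_ge0// -mulrA; congr (_ * _).
rewrite /weight mulrA ger0_norm ?invr_ge0 ?(ltW q0)//; congr (_ * _).
by rewrite -(powR_inv1 (ltW q0)) -powRrM -powRD_gt0//; congr (_ `^ _); ring.
Qed.

Lemma xi_fE x : 0 < qn x ->
  xi f x = ceuler nu f x * (weight qn R0 ((alpha + p) / p) ((beta + 1) / p) x)%:C%C.
Proof.
move=> q0; rewrite /xi_f radderivE -!fmorphV weightE -mulrA -rmorphM.
congr (_ * _%:C%C); rewrite /weight mulrA -(powR_inv1 (ltW q0)) -powRD_gt0//.
by congr (_ `^ _ * _); field.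
Qed.

Lemma xi_sub_eta x : xi f x - eta f x =
  f x * (- kappa * weight qn R0 ((alpha + p) / p) ((beta + p + 1) / p) x)%:C%C.
Proof.
rewrite /eta_f opprD addrA subrr sub0r -fmorphV weightE.
by rewrite [in RHS]rmorphM [in RHS]rmorphN; ring.
Qed.

Lemma Cp_xi_eta x : Cp p (xi f x) (eta f x) =
  weighted_powR qn R0 p (alpha + p) (beta + 1) (ceuler nu f) x
  + (p - 1) * `|kappa| `^ p * weighted_powR qn R0 p (alpha + p) (beta + p + 1) f x
  + p * kappa * `|kappa| `^ (p - 2) * weighted_cdot nu qn R0 p (alpha + p) (beta + p) f x.
Proof.
rewrite /weighted_powR /weighted_cdot; have [Kx|Kx] := pselect (K x); last first.
  have := xi_sub_eta x; rewrite (test_off_support f_test Kx).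
  rewrite (ceuler_off_support nu f_test Kx) mul0r => /eqP; rewrite subr_eq0 => /eqP <-.
  rewrite /xi_f radderivE (ceuler_off_support nu f_test Kx) !mul0r.
  by rewrite Cp0 cabs0 /cdot/= (powR0 p_neq0) !(mul0r, mulr0, addr0).
have qx := qn_support qn_quasi f_test Kx; have /andP[q0 _] := qx.
rewrite CpE// xi_sub_eta xi_fE// cdot_Mreal !cabs_Mreal.
set w1 := weight _ _ _ ((beta + 1) / p) x; set w2 := weight _ _ _ ((beta + p + 1) / p) x.
have [w1_ge0 w2_ge0] : 0 <= w1 /\ 0 <= w2 by split; exact: weight_ge0.
have <- : w1 `^ p = weight qn R0 (alpha + p) (beta + 1) x.
  by rewrite weight_powR !divfK.
have <- : w2 `^ p = weight qn R0 (alpha + p) (beta + p + 1) x.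
  by rewrite weight_powR !divfK.
have <- : w2 `^ (p - 2) * (w2 * w1) = weight qn R0 (alpha + p) (beta + p) x.
  by rewrite weight_powR !weightM//; congr (weight _ _ _ _ _); field.
move: kappa w1 w2 w1_ge0 w2_ge0 => k w1 w2 w1_ge0 w2_ge0.
rewrite normrM normrN (ger0_norm w1_ge0) (ger0_norm w2_ge0).
rewrite !powRM ?mulr_ge0 ?cabs_ge0//.
by ring.
Qed.

Lemma I_CpE : I_Cp nu qn mu R0 p alpha beta f = (\int[mu]_x Cp p (xi f x) (eta f x))%R.
Proof.
apply: Rintegral_off_support => x /(off_qball_off_support qn_quasi f_test) Kx.
rewrite Cp_xi_eta /weighted_powR /weighted_cdot (test_off_support f_test Kx).
rewrite (ceuler_off_support nu f_test Kx) cabs0 (powR0 p_neq0) /cdot/=.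
by rewrite !(mul0r, mulr0, addr0).
Qed.

Lemma integrable_Cp : mu.-integrable setT (EFin \o (fun x => Cp p (xi f x) (eta f x))).
Proof.
apply: (bounded_with_support_integrable mu_lebesgue).
under eq_fun do rewrite Cp_xi_eta -[X in X + _ + _]mul1r.
exact: bounded_with_support_lincomb.
Qed.

Lemma hardy_identity_supported : `|kappa| `^ p * I_f qn mu R0 p alpha beta f =
  I_Rf nu qn mu R0 p alpha beta f -
  (hdim nu - alpha - p) * kappa * `|kappa| `^ (p - 2) * I_f' qn mu R0 p alpha beta f -
  I_Cp nu qn mu R0 p alpha beta f.
Proof.
rewrite I_fE I_f'E I_RfE I_CpE; under [in X in _ - X]eq_Rintegral do
  rewrite Cp_xi_eta -[X in X + _ + _]mul1r.
rewrite Rintegral_lincomb// mul1r; have := Rintegral_weighted_powR (alpha + p) (beta + p).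
have -> : `|kappa| `^ p = kappa * `|kappa| `^ (p - 2) * kappa.
  have [->|k0] := eqVneq kappa 0; first by rewrite normr0 powR0// !mul0r.
  rewrite mulrAC -expr2 -(real_normK (num_real kappa)) -powR_mulrn// -powRD_gt0 ?normr_gt0//.
  by congr (_ `^ _); ring.
have bE : beta + p = p * kappa by field.
set euler_part := (\int[mu]_x weighted_powR _ _ _ _ _ (ceuler nu f) x)%R.
set mass := (\int[mu]_x weighted_powR _ _ _ _ (beta + p + 1) f x)%R.
set log_mass := (\int[mu]_x weighted_powR _ _ _ _ (beta + p) f x)%R.
set cross := (\int[mu]_x weighted_cdot _ _ _ _ _ _ f x)%R.
move: (`|kappa| `^ (p - 2)) => c crossE.
have {crossE} : p * cross = (alpha + p - hdim nu) * log_mass - p * kappa * mass.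
  by rewrite -bE; lra.
have -> : p * kappa * c * cross = kappa * c * (p * cross) by ring.
by move=> ->; ring.
Qed.

End FixedSupport.

Lemma hardy_identity f : C0inf_punct qn R0 f ->
  `|kappa| `^ p * I_f qn mu R0 p alpha beta f =
  I_Rf nu qn mu R0 p alpha beta f -
  (hdim nu - alpha - p) * kappa * `|kappa| `^ (p - 2) * I_f' qn mu R0 p alpha beta f -
  I_Cp nu qn mu R0 p alpha beta f.
Proof. by move=> [su [sv [K [cK KR fK]]]]; exact: (@hardy_identity_supported K). Qed.

Lemma I_Cp_ge0 f : 0 <= I_Cp nu qn mu R0 p alpha beta f.
Proof. by apply: Rintegral_ge0 => x _; exact: Cp_ge0. Qed.

Lemma I_f'_ge0 f : 0 <= I_f' qn mu R0 p alpha beta f.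
Proof. by apply: Rintegral_ge0 => x _; rewrite divr_ge0 ?mulr_ge0 ?powR_ge0. Qed.

Lemma hardy_inequality f : 0 <= (hdim nu - alpha - p) * (beta + p) ->
  C0inf_punct qn R0 f ->
  `|kappa| `^ p * I_f qn mu R0 p alpha beta f <= I_Rf nu qn mu R0 p alpha beta f.
Proof.
move=> sign f_adm; rewrite hardy_identity// -addrA gerDl -opprD oppr_le0.
apply: addr_ge0; last exact: I_Cp_ge0.
rewrite mulr_ge0 ?I_f'_ge0// mulr_ge0 ?powR_ge0// mulrA.
by rewrite mulr_ge0// invr_ge0 ltW.
Qed.

End HardyIdentity.

(** * Functions with vanishing remainder *)

Section VanishingRemainder.
Context {R : realType} {n : nat}.
Variables (nu : 'I_n -> R) (qn : Rn R n -> R) (R0 : R).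
Hypotheses (qn_quasi : quasi_norm nu qn) (R0_gt0 : 0 < R0).
Implicit Types (x : Rn R n) (K : set (Rn R n)) (g Eg : Rn R n -> R).

Lemma qn_compact_lt K : compact K -> (forall x, K x -> qn x < R0) ->
  exists m : R, [/\ 0 < m, m < R0 & forall x, K x -> qn x < m].
Proof.
have R0_pos := R0_gt0; move=> cK KR; have [K0|/set0P K0] := eqVneq K set0.
  by exists (R0 / 2); split => [||x]; [lra|lra|rewrite K0].
have [y /set_mem Ky qy] :=
  compact_EVT_max K0 cK (continuous_subspaceT (qn_continuous qn_quasi)).
have yR := KR y Ky; have y0 := qn_ge0 qn_quasi y.
exists ((qn y + R0) / 2); split => [||x Kx]; [lra|lra|].
by have := qy x (mem_set Kx); lra.
Qed.

(* On each ray [g * L^(-k)] is constant, and it vanishes near the sphere. *)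
Lemma euler_ode_eq0 K g Eg (k : R) : compact K -> (forall x, K x -> qn x < R0) ->
  is_euler nu g Eg -> (forall x, ~ K x -> g x = 0) ->
  (forall x, 0 < qn x < R0 -> Lw qn R0 x * Eg x + k * g x = 0) ->
  forall x, 0 < qn x < R0 -> g x = 0.
Proof.
move=> cK KR g_euler g0 ode x qx; have /andP[q0 qR] := qx.
have [Kx|] := pselect (K x); last exact: g0.
have [m [m0 mR Km]] := qn_compact_lt cK KR.
pose t := m / qn x; have tq : t * qn x = m by rewrite divfK// gt_eqF.
have t1 : 1 < t by rewrite ltr_pdivlMr// mul1r Km.
pose phi (s : R) := g (dil nu s x) * weight qn R0 0 k (dil nu s x).
have phi' (s : R) : 1 <= s <= t -> is_derive s 1 phi 0.
  move=> /andP[s1 st]; have s0 : 0 < s by lra.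
  have qy : 0 < qn (dil nu s x) < R0.
    by rewrite (qn_dil qn_quasi)// mulr_gt0//=; apply: le_lt_trans mR; rewrite -tq ler_pM2r.
  apply: (is_derive_eq (is_derive1M (g_euler x s s0)
    (is_derive_weight_dil qn_quasi R0_gt0 0 k s0 qy))).
  rewrite -(weight_succ_Lw _ _ qy) mul0r subr0.
  set y := dil nu s x; set w := weight _ _ _ _ _.
  by transitivity (s^-1 * w * (Lw qn R0 y * Eg y + k * g y)); [ring|rewrite ode// mulr0].
have [| |s _] := @MVT R phi (fun=> 0) 1 t t1.
- by move=> s; rewrite in_itv/= => /andP[s1 st]; apply: phi'; rewrite !ltW.
- by apply: is_derive_within_continuous => s /=; rewrite in_itv/=; exact: phi'.
rewrite mul0r /phi dil1 g0; last first.
  by move=> /Km; rewrite (qn_dil qn_quasi) ?tq ?ltxx//; lra.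
rewrite mul0r sub0r => /eqP; rewrite oppr_eq0 mulf_eq0 => /orP[/eqP//|].
by rewrite gt_eqF// weight_gt0.
Qed.

Section ZeroRemainder.
Variables (mu : {measure set (Rn R n) -> \bar R}) (p alpha beta : R).
Hypotheses (mu_lebesgue : is_lebesgue_measure mu) (p_gt1 : 1 < p).
Variables (K : set (Rn R n)) (f : Rn R n -> R[i]).
Hypothesis f_test : test_function qn R0 K f.

Local Notation kappa := ((beta + p) / p).
Local Notation xi := (xi_f nu qn R0 p alpha beta).
Local Notation eta := (eta_f nu qn R0 p alpha beta).

Definition log_ode x : R[i] := ceuler nu f x * (Lw qn R0 x)%:C%C + f x * kappa%:C%C.

Lemma log_odeE x : log_ode x =
  Complex (complex.Re (ceuler nu f x) * Lw qn R0 x + complex.Re (f x) * kappa)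
          (complex.Im (ceuler nu f x) * Lw qn R0 x + complex.Im (f x) * kappa).
Proof. by rewrite /log_ode !complex_Mreal. Qed.

Lemma eta_fE x : 0 < qn x < R0 ->
  eta f x = log_ode x * (weight qn R0 ((alpha + p) / p) ((beta + p + 1) / p) x)%:C%C.
Proof.
move=> qx; have /andP[q0 _] := qx; have p0 : p != 0 by rewrite gt_eqF// (lt_trans _ p_gt1).
rewrite -[LHS](subKr (xi f x)) xi_sub_eta (xi_fE _ _ qn_quasi p_gt1 f_test)//.
rewrite (_ : (beta + p + 1) / p = (beta + 1) / p + 1); last by field.
rewrite -(weight_succ_Lw _ _ qx) /log_ode !rmorphM rmorphN.
by ring.
Qed.

Lemma continuous_cabs_log_ode x : 0 < qn x -> {for x, continuous (fun y => cabs (log_ode y))}.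
Proof.
move=> q0; have [cu cv] := ccontinuous_test f_test.
have [cEu cEv] := ccontinuous_ceuler nu f_test.
have cL := continuous_Lw qn_quasi R0_gt0 q0.
have cpart (g Eg : Rn R n -> R) : continuous g -> continuous Eg ->
    {for x, continuous (fun y => Eg y * Lw qn R0 y + g y * kappa)}.
  move=> cg cEg; apply: (@cvgD _ _ _ (nbhs x)); apply: (@cvgM _ _ (nbhs x)) => //.
  - exact: cEg.
  - exact: cg.
  - exact: cvg_cst.
rewrite (funext (fun y => congr1 (@cabs R) (log_odeE y))).
by apply: continuous_cabs; exact: cpart.
Qed.

Lemma log_ode_eq0 : I_Cp nu qn mu R0 p alpha beta f = 0 ->
  forall x, 0 < qn x < R0 -> log_ode x = 0.
Proof.
rewrite (I_CpE _ _ _ qn_quasi p_gt1 f_test) => ICp0 x qx; apply: contrapT => /eqP ode_x.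
pose U := [set y | 0 < qn y < R0 /\ cabs (log_ode y) != 0].
have nbhsU : nbhs x U.
  have /andP[q0 qR] := qx; have cqn := qn_continuous qn_quasi.
  near=> y; split; first (apply/andP; split); near: y.
  - exact: (cvgr_gt _ (cqn x)).
  - exact: (cvgr_lt _ (cqn x)).
  - by apply: (cvgr_neq0 _ (continuous_cabs_log_ode q0)); rewrite gt_eqF// cabs_gt0.
suff : 0 < 0 :> R by rewrite ltxx.
rewrite -[ltRHS]ICp0; apply: (Rintegral_gt0 mu_lebesgue _ _ (@open_interior _ U) nbhsU).
- exact: (integrable_Cp _ _ mu_lebesgue qn_quasi R0_gt0 p_gt1 f_test).
- by move=> y; exact: Cp_ge0.
- move=> y /interior_subset[qy ode_y]; rewrite gt_eqF// Cp_gt0// eta_fE//.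
  rewrite mulf_neq0//; first by apply: contra_neq ode_y => ->; rewrite cabs0.
  by rewrite fmorph_eq0 gt_eqF// weight_gt0.
Unshelve. all: by end_near. Qed.

Lemma I_Cp_eq0_supported : I_Cp nu qn mu R0 p alpha beta f = 0 -> f = (fun=> 0).
Proof.
move=> /log_ode_eq0 ode0; have [su sv cK KR f0] := f_test.
have qK x : K x -> qn x < R0 by move=> /(qn_support qn_quasi f_test)/andP[].
have part_eq0 g : smooth g -> (forall x, ~ K x -> g x = 0) ->
    (forall x, 0 < qn x < R0 -> Lw qn R0 x * euler nu g x + kappa * g x = 0) ->
    forall x, K x -> g x = 0.
  move=> sg g0 ode x /(qn_support qn_quasi f_test).
  exact: (euler_ode_eq0 cK qK (smooth_is_euler nu sg) g0 ode).
have odes y : 0 < qn y < R0 ->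
    Lw qn R0 y * euler nu (fun z => complex.Re (f z)) y + kappa * complex.Re (f y) = 0 /\
    Lw qn R0 y * euler nu (fun z => complex.Im (f z)) y + kappa * complex.Im (f y) = 0.
  move=> /ode0; rewrite log_odeE => -[uy vy].
  by rewrite ![_ * euler _ _ _]mulrC ![kappa * _]mulrC.
apply/funext => x; have [Kx|] := pselect (K x); last exact: f0.
have u0 : complex.Re (f x) = 0.
  by apply: (part_eq0 _ su) => // y; [move=> /f0 ->|case/odes].
have v0 : complex.Im (f x) = 0.
  by apply: (part_eq0 _ sv) => // y; [move=> /f0 ->|case/odes].
by case: (f x) u0 v0 => a b /= -> ->.
Qed.

End ZeroRemainder.

Lemma I_Cp_eq0 (mu : {measure set (Rn R n) -> \bar R}) (p alpha beta : R)
    (f : Rn R n -> R[i]) : is_lebesgue_measure mu -> 1 < p -> C0inf_punct qn R0 f ->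
  I_Cp nu qn mu R0 p alpha beta f = 0 -> f = (fun=> 0).
Proof.
move=> mu_lebesgue p1 [su [sv [K [cK KR fK]]]].
exact: (@I_Cp_eq0_supported mu p alpha beta mu_lebesgue p1 K).
Qed.

End VanishingRemainder.

(** * Smooth functions of one variable *)

Section Derivability.
Context {R : realType}.
Implicit Types (U V : set R) (f g : R -> R) (k m : nat) (x a b : R).

Fixpoint nderivable U k f : Prop :=
  if k is k'.+1 then (forall x, U x -> derivable f x 1) /\ nderivable U k' (derive1 f)
  else True.

Lemma is_derive_derive1 f x : derivable f x 1 -> is_derive x 1 f (derive1 f x).
Proof. by move=> df; split; [exact: df|rewrite derive1E]. Qed.

Lemma derive1_val f x (d : R) : is_derive x 1 f d -> derive1 f x = d.
Proof. by move=> [_ <-]; rewrite derive1E. Qed.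

Lemma eq_nderivable U k f g : open U -> (forall x, U x -> f x = g x) ->
  nderivable U k f -> nderivable U k g.
Proof.
move=> oU; elim: k f g => [//|k IH] f g fg [df f'k].
have g' x : U x -> is_derive x 1 g (derive1 f x).
  move=> Ux; apply: near_eq_is_derive (is_derive_derive1 (df x Ux)).
  by apply: filterS fg _; exact: open_nbhs_nbhs.
split; first by move=> x Ux; have [] := g' x Ux.
by apply: IH f'k => x Ux; rewrite (derive1_val (g' x Ux)).
Qed.

Lemma nderivable_is_derive U k f g : open U ->
  (forall x, U x -> is_derive x 1 f (g x)) -> nderivable U k g -> nderivable U k.+1 f.
Proof.
move=> oU f' gk; split; first by move=> x Ux; have [] := f' x Ux.
by apply: eq_nderivable gk => // x Ux; rewrite (derive1_val (f' x Ux)).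
Qed.

Lemma nderivableW U k f : nderivable U k.+1 f -> nderivable U k f.
Proof. by elim: k f => [//|k IH] f [df f'k]; split => //; exact: IH. Qed.

Lemma nderivableU U V k f :
  nderivable U k f -> nderivable V k f -> nderivable (U `|` V) k f.
Proof.
elim: k f => [//|k IH] f [dfU f'U] [dfV f'V]; split; last exact: IH.
by move=> x [Ux|Vx]; [exact: dfU|exact: dfV].
Qed.

Lemma nderivable_cst U k a : open U -> nderivable U k (fun=> a).
Proof.
move=> oU; elim: k a => [//|k IH] a.
have cst' x (_ : U x) := is_derive_cst a x 1.
exact: (nderivable_is_derive oU cst' (IH 0)).
Qed.

Lemma nderivable_affine U k a b : open U -> nderivable U k (fun x => a * x + b).
Proof.
move=> oU; case: k => // k; have affine' x (_ : U x) := is_derive1_affine x a b.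
exact: (nderivable_is_derive oU affine' (nderivable_cst k a oU)).
Qed.

Lemma nderivableD U k f g : open U ->
  nderivable U k f -> nderivable U k g -> nderivable U k (fun x => f x + g x).
Proof.
move=> oU; elim: k f g => [//|k IH] f g [df f'k] [dg g'k].
have sum' x (Ux : U x) :=
  is_derive1D (is_derive_derive1 (df x Ux)) (is_derive_derive1 (dg x Ux)).
exact: (nderivable_is_derive oU sum' (IH _ _ f'k g'k)).
Qed.

Lemma nderivableM U k f g : open U ->
  nderivable U k f -> nderivable U k g -> nderivable U k (fun x => f x * g x).
Proof.
move=> oU; elim: k f g => [//|k IH] f g fk gk.
have [df f'k] := fk; have [dg g'k] := gk.
have prod' x (Ux : U x) :=
  is_derive1M (is_derive_derive1 (df x Ux)) (is_derive_derive1 (dg x Ux)).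
apply: (nderivable_is_derive oU prod').
by apply: nderivableD => //; apply: IH => //; exact: nderivableW.
Qed.

Lemma nderivable_comp U V k f g : open U -> open V -> (forall x, U x -> V (g x)) ->
  nderivable V k f -> nderivable U k g -> nderivable U k (fun x => f (g x)).
Proof.
move=> oU oV gUV; elim: k f g gUV => [//|k IH] f g gUV [df f'k] gk.
have [dg g'k] := gk.
have comp' x (Ux : U x) := is_derive1_fun_comp
  (is_derive_derive1 (df (g x) (gUV x Ux))) (is_derive_derive1 (dg x Ux)).
apply: (nderivable_is_derive oU comp').
by apply: nderivableM => //; apply: IH => //; exact: nderivableW.
Qed.

Lemma nderivableV U k f : open U -> (forall x, U x -> f x != 0) ->
  nderivable U k f -> nderivable U k (fun x => (f x)^-1).
Proof.
move=> oU f0; elim: k => [//|k IH] fk; have [df f'k] := fk.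
have inv' x (Ux : U x) :
    is_derive x 1 (fun x => (f x)^-1) (-1 * derive1 f x * ((f x)^-1 * (f x)^-1)).
  apply: (is_derive_eq (is_deriveV (f0 x Ux) (is_derive_derive1 (df x Ux)))).
  by rewrite /GRing.scale/= expr2 invfM; ring.
apply: (nderivable_is_derive oU inv'); have fV := IH (nderivableW fk).
by apply: nderivableM => //; apply: nderivableM => //; exact: nderivable_cst.
Qed.

Lemma nderivable_powR k a : nderivable [set x : R | 0 < x] k (fun x => x `^ a).
Proof.
have oU : open [set x : R | 0 < x] by exact: open_gt.
elim: k a => [//|k IH] a.
have powR' x (x0 : 0 < x) := is_derive1_powR a x0.
apply: (nderivable_is_derive oU powR').
by apply: nderivableM => //; exact: nderivable_cst.
Qed.

Definition smoothR f := forall k, nderivable setT k f.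

Lemma smoothR_derive1 f : smoothR f -> smoothR (derive1 f).
Proof. by move=> sf k; have [] := sf k.+1. Qed.

Lemma smoothR_is_derive f x : smoothR f -> is_derive x 1 f (derive1 f x).
Proof. by move=> sf; apply: is_derive_derive1; have [df _] := sf 1%N; exact: df. Qed.

Lemma smoothR_continuous f : smoothR f -> continuous f.
Proof. by move=> sf x; exact: is_derive_continuous (smoothR_is_derive x sf). Qed.

Lemma smoothRM f g : smoothR f -> smoothR g -> smoothR (fun x => f x * g x).
Proof. by move=> sf sg k; apply: nderivableM => //; exact: openT. Qed.

Lemma smoothR_comp_affine f g a b : smoothR f -> (forall x, g x = a * x + b) ->
  smoothR (fun x => f (g x)).
Proof.
move=> sf gE k; have oT : open (setT : set R) by exact: openT.
apply: (@nderivable_comp _ setT) => //.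
by apply: eq_nderivable (nderivable_affine k a b oT) => // x _; rewrite gE.
Qed.

Lemma derive1_comp_affine f g a b x : smoothR f -> (forall y, g y = a * y + b) ->
  derive1 (fun y => f (g y)) x = a * derive1 f (g x).
Proof.
move=> sf gE; apply: derive1_val; rewrite [X in is_derive _ _ X](funext (fun y => congr1 f (gE y))).
rewrite gE mulrC.
exact: (is_derive1_fun_comp (smoothR_is_derive _ sf) (is_derive1_affine x a b)).
Qed.

Lemma derive1_within_supp f a b t : (forall x, f x != 0 -> a <= x <= b) ->
  derive1 f t != 0 -> a <= t <= b.
Proof.
move=> f_supp; apply: contraR => t_out; apply/eqP/derive1_val.
apply: near_eq_is_derive (is_derive_cst (0 : R) t 1).
have : \forall s \near t, ~~ (a <= s <= b).
  move: t_out; rewrite negb_and -!ltNge => /orP[ta|tb]; near=> s;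
    rewrite negb_and -!ltNge; apply/orP; [left|right]; near: s.
    exact: lt_nbhsl.
  exact: lt_nbhsr.
by apply: filterS => s; apply: contraNeq => fs; apply: f_supp; rewrite eq_sym.
Unshelve. all: by end_near. Qed.

End Derivability.

Section CutOffs.
Context {R : realType}.
Implicit Types (x : R) (k m : nat).

Definition flat_exp m x : R := if 0 < x then x^-1 ^+ m * expR (- x^-1) else 0.

Lemma flat_exp_ge0 m x : 0 <= flat_exp m x.
Proof.
rewrite /flat_exp; case: ifP => // x0.
by rewrite mulr_ge0 ?expR_ge0// exprn_ge0// invr_ge0 ltW.
Qed.

Lemma flat_exp_gt0 m x : 0 < x -> 0 < flat_exp m x.
Proof. by move=> x0; rewrite /flat_exp x0 mulr_gt0 ?expR_gt0// exprn_gt0// invr_gt0. Qed.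

Lemma flat_exp_eq0 m x : x <= 0 -> flat_exp m x = 0.
Proof. by move=> x0; rewrite /flat_exp ltNge x0. Qed.

Lemma flat_exp_le m x : flat_exp m.+1 x <= m.+1%:R ^+ m.+1.
Proof.
rewrite /flat_exp; case: ifP => [x0|_]; last by rewrite exprn_ge0.
set y := x^-1; have y0 : 0 < y by rewrite invr_gt0.
rewrite expRN ler_pdivrMr ?expR_gt0//.
have -> : y = m.+1%:R * (y / m.+1%:R) by rewrite mulrCA mulfV ?mulr1// pnatr_eq0.
rewrite expRM_natl exprMn; apply: ler_wpM2l; first exact: exprn_ge0.
apply: lerXn2r; rewrite ?nnegrE ?expR_ge0 ?divr_ge0 ?(ltW y0)//.
by apply: le_trans (expR_ge1Dx _); rewrite lerDr.
Qed.

Lemma flat_exp0_le1 x : flat_exp 0 x <= 1.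
Proof.
rewrite /flat_exp; case: ifP => // x0.
by rewrite expr0 mul1r -expR0 ler_expR oppr_le0 invr_ge0 ltW.
Qed.

Lemma flat_expS m x : x != 0 -> x^-1 * flat_exp m x = flat_exp m.+1 x.
Proof. by move=> x0; rewrite /flat_exp; case: ifP => _; rewrite ?mulr0// mulrA -exprS. Qed.

Lemma is_derive_exprV m x : x != 0 ->
  is_derive x 1 (fun y : R => y^-1 ^+ m) (- (m%:R * x^-1 ^+ m.+1)).
Proof.
move=> x0; elim: m => [|m IH]; first by rewrite mul0r oppr0; exact: is_derive_cst.
have V' : is_derive x 1 (fun y : R => y^-1) (- (x^-1 * x^-1)).
  apply: (is_derive_eq (is_deriveV x0 (is_derive_id x 1))).
  by rewrite /GRing.scale/= expr2 invfM mulr1.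
under eq_fun do rewrite exprS.
apply: (is_derive_eq (is_derive1M V' IH)).
by rewrite -natr1 !exprS; ring.
Qed.

Lemma is_derive_flat_exp_gt0 m x : 0 < x ->
  is_derive x 1 (flat_exp m) (- m%:R * flat_exp m.+1 x + flat_exp m.+2 x).
Proof.
move=> x0; have x_neq0 := lt0r_neq0 x0.
have inv' := is_derive_exprV 1 x_neq0.
have exp' := @is_derive1_fun_comp R (@expR R) (fun y => -1 * y^-1 ^+ 1) x _ _
  (is_derive_expR _) (is_derive1M (is_derive_cst (-1 : R) x 1) inv').
apply: near_eq_is_derive (is_derive_eq (is_derive1M (is_derive_exprV m x_neq0) exp') _).
  near=> y; rewrite /flat_exp ifT ?expr1 ?mulN1r//.
  by near: y; exact: lt_nbhsr.
by rewrite /flat_exp x0 !exprS expr0 mulr1 mulN1r /cst mul0r; ring.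
Unshelve. all: by end_near. Qed.

Lemma is_derive_flat_exp0 m : is_derive (0 : R) 1 (flat_exp m) 0.
Proof.
apply/is_derive1_cvgP; rewrite (flat_exp_eq0 _ (lexx 0)); apply: norm_cvg0.
have bound_cvg0 : `|h| * m.+2%:R ^+ m.+2 @[h --> (0 : R)^'] --> (0 : R).
  rewrite -[X in _ --> X](mul0r (m.+2%:R ^+ m.+2)); apply: cvgMr_tmp.
  by rewrite -[X in _ --> X](@normr0 _ R); apply: cvg_norm; exact: cvg_within.
apply: (squeeze_cvgr _ (cvg_cst 0) bound_cvg0).
near=> h; have h0 : h != 0 by near: h; exact: nbhs_dnbhs_neq.
rewrite addr0 subr0 flat_expS// normr_ge0/=.
have -> : flat_exp m.+1 h = h * flat_exp m.+2 h.
  by rewrite -(flat_expS m.+1 h0) mulrA mulfV// mul1r.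
rewrite normrM; apply: ler_wpM2l => //.
by rewrite ger0_norm ?flat_exp_ge0// flat_exp_le.
Unshelve. all: by end_near. Qed.

Lemma is_derive_flat_exp m x :
  is_derive x 1 (flat_exp m) (- m%:R * flat_exp m.+1 x + flat_exp m.+2 x).
Proof.
have [x0|x0|->] := ltgtP x 0; last first.
- by rewrite !flat_exp_eq0// mulr0 addr0; exact: is_derive_flat_exp0.
- exact: is_derive_flat_exp_gt0.
rewrite !flat_exp_eq0 ?(ltW x0)// mulr0 addr0.
apply: near_eq_is_derive (is_derive_cst (0 : R) x 1).
by near=> y; rewrite flat_exp_eq0//; apply: ltW; near: y; exact: lt_nbhsl.
Unshelve. all: by end_near. Qed.

Lemma smoothR_flat_exp m : smoothR (flat_exp m).
Proof.
have oT : open (setT : set R) by exact: openT.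
move=> k; elim: k m => [//|k IH] m.
have flat_exp' x (_ : setT x) := is_derive_flat_exp m x.
apply: (nderivable_is_derive oT flat_exp').
by apply: nderivableD => //; apply: nderivableM => //; exact: nderivable_cst.
Qed.

Definition smooth_bump x : R := flat_exp 0 (1 + x) * flat_exp 0 (1 - x).

Lemma smoothR_bump : smoothR smooth_bump.
Proof.
apply: smoothRM; [apply: (@smoothR_comp_affine _ _ _ 1 1)|
  apply: (@smoothR_comp_affine _ _ _ (-1) 1)] => [|x|| x];
  by [exact: smoothR_flat_exp|ring].
Qed.

Lemma smooth_bump_ge0 x : 0 <= smooth_bump x.
Proof. by rewrite mulr_ge0 ?flat_exp_ge0. Qed.

Lemma smooth_bump_le1 x : smooth_bump x <= 1.
Proof. by rewrite mulr_ile1 ?flat_exp_ge0 ?flat_exp0_le1. Qed.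

Lemma smooth_bump_gt0 x : `|x| < 1 -> 0 < smooth_bump x.
Proof. by rewrite ltr_norml => /andP[? ?]; rewrite mulr_gt0// flat_exp_gt0//; lra. Qed.

Lemma smooth_bump_supp x : smooth_bump x != 0 -> -1 <= x <= 1.
Proof.
rewrite /smooth_bump; apply: contraR; rewrite negb_and -!ltNge => /orP[x1|x1].
  by rewrite (@flat_exp_eq0 _ (1 + x)) ?mul0r//; lra.
by rewrite (@flat_exp_eq0 _ (1 - x)) ?mulr0//; lra.
Qed.

Definition step x : R :=
  flat_exp 0 (4 * x - 1) / (flat_exp 0 (4 * x - 1) + flat_exp 0 (3 - 4 * x)).

Lemma step_denom_gt0 x : 0 < flat_exp 0 (4 * x - 1) + flat_exp 0 (3 - 4 * x).
Proof.
have [x1|x1] := ltP 0 (4 * x - 1).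
  by apply: ltr_wpDr; [exact: flat_exp_ge0|exact: flat_exp_gt0].
by apply: ltr_wpDl; [exact: flat_exp_ge0|apply: flat_exp_gt0; lra].
Qed.

Lemma smoothR_step : smoothR step.
Proof.
have oT : open (setT : set R) by exact: openT.
have rise : smoothR (fun x => flat_exp 0 (4 * x - 1)).
  by apply: (@smoothR_comp_affine _ _ _ 4 (-1)) => //; exact: smoothR_flat_exp.
have fall : smoothR (fun x => flat_exp 0 (3 - 4 * x)).
  apply: (@smoothR_comp_affine _ _ _ (-4) 3) => [|x]; last by ring.
  exact: smoothR_flat_exp.
move=> k; apply: nderivableM => //; apply: nderivableV => //; last exact: nderivableD.
by move=> x _; rewrite gt_eqF// step_denom_gt0.
Qed.

Lemma step_ge0 x : 0 <= step x.
Proof. by rewrite mulr_ge0 ?flat_exp_ge0// invr_ge0 ltW// step_denom_gt0. Qed.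

Lemma step_le1 x : step x <= 1.
Proof. by rewrite ler_pdivrMr ?step_denom_gt0// mul1r lerDl flat_exp_ge0. Qed.

Lemma step_eq0 x : x <= 1 / 4 -> step x = 0.
Proof. by move=> x_le; rewrite /step flat_exp_eq0 ?mul0r//; lra. Qed.

Lemma step_eq1 x : 3 / 4 <= x -> step x = 1.
Proof.
move=> x_ge; rewrite /step (@flat_exp_eq0 _ (3 - 4 * x)); last by lra.
by rewrite addr0 divff// gt_eqF// flat_exp_gt0//; lra.
Qed.

Lemma derive1_step_eq0 x : x <= 0 \/ 1 <= x -> derive1 step x = 0.
Proof.
move=> [x0|x1]; apply: derive1_val.
  apply: near_eq_is_derive (is_derive_cst (0 : R) x 1).
  near=> y; rewrite step_eq0//; apply: ltW.
  by near: y; apply: lt_nbhsl; lra.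
apply: near_eq_is_derive (is_derive_cst (1 : R) x 1).
near=> y; rewrite step_eq1//; apply: ltW.
by near: y; apply: lt_nbhsr; lra.
Unshelve. all: by end_near. Qed.

Lemma derive1_step_bounded : exists M : R, forall x, `|derive1 step x| <= M.
Proof.
have cstep' := smoothR_continuous (smoothR_derive1 smoothR_step).
have [M M0 step'M] := continuous_compact_bounded (@segment_compact R 0 1) (in1W cstep').
exists M => x; have [x01|] := boolP (x \in `[0, 1]); first exact: step'M (set_mem x01).
rewrite notin_setE/= in_itv/= => /negP; rewrite negb_and -!ltNge => x01.
by rewrite derive1_step_eq0 ?normr0//; case/orP: x01 => /ltW; [left|right].
Qed.

End CutOffs.

(** * Tensor products *)

Section Tensor.
Context {R : realType} {n : nat}.
Implicit Types (phi : 'I_n -> R -> R) (x z : Rn R n) (a d : 'I_n -> R).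

Definition tensor phi x : R := \prod_(j < n) phi j (coor j x).

Definition tensor_partial phi (i : 'I_n) : Rn R n -> R :=
  tensor (fun j => if j == i then derive1 (phi j) else phi j).

Lemma continuous_prod_coor (P : pred 'I_n) phi : (forall j, continuous (phi j)) ->
  continuous (fun x : Rn R n => \prod_(j < n | P j) phi j (coor j x)).
Proof.
move=> cphi x; apply: (@cvg_big _ _ _ _ _ _ _ (nbhs x)) => [|j _].
  by move=> y; exact: mul_continuous.
have cj : coor j y @[y --> x] --> coor j x by exact: continuous_coor.
exact: (cvg_comp _ _ cj (cphi j _)).
Qed.

Lemma continuous_tensor phi : (forall j, continuous (phi j)) -> continuous (tensor phi).
Proof. exact: continuous_prod_coor. Qed.

Lemma tensorE phi i x :
  tensor phi x = phi i (coor i x) * \prod_(j < n | j != i) phi j (coor j x).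
Proof. by rewrite /tensor (bigD1 i). Qed.

Lemma tensor_partialE phi i x : tensor_partial phi i x =
  derive1 (phi i) (coor i x) * \prod_(j < n | j != i) phi j (coor j x).
Proof.
rewrite /tensor_partial (tensorE _ i) eqxx; congr (_ * _).
by apply: eq_bigr => j /negbTE ->.
Qed.

Lemma is_derive_tensor phi (i : 'I_n) x : (forall j, smoothR (phi j)) ->
  is_derive x (evec R i) (tensor phi) (tensor_partial phi i x).
Proof.
move=> sphi; rewrite tensor_partialE; set P := \prod_(j < n | j != i) _.
have quotientE (h : R) : h^-1 *: (tensor phi (h *: evec R i + x) - tensor phi x) =
   (h^-1 * (phi i (h + coor i x) - phi i (coor i x))) * P.
  rewrite !(tensorE _ i) -/P.
  have -> : coor i (h *: evec R i + x) = h + coor i x by rewrite /coor !mxE/= !eqxx mulr1.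
  rewrite [X in _ * X - _](_ : _ = P); last first.
    by apply: eq_bigr => j /negbTE ji; rewrite /coor !mxE/= ji mulr0 add0r.
  by rewrite -mulrBl; exact: mulrA.
have quotient_cvg : h^-1 *: (tensor phi (h *: evec R i + x) - tensor phi x)
    @[h --> (0:R)^'] --> derive1 (phi i) (coor i x) * P.
  under eq_fun do rewrite quotientE.
  by apply: cvgMr_tmp; apply/is_derive1_cvgP; exact: smoothR_is_derive.
by split; [apply/cvg_ex; eexists; exact: quotient_cvg|exact/cvg_lim].
Qed.

Lemma smooth_tensor phi : (forall j, smoothR (phi j)) -> smooth (tensor phi).
Proof.
move=> sphi l.
have [psi [spsi ->]] : exists psi, (forall j, smoothR (psi j)) /\
    dpart (tensor phi) l = tensor psi.
  elim: l => [|i l [psi [spsi dpartE]]]; first by exists phi.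
  exists (fun j => if j == i then derive1 (psi j) else psi j); split.
    by move=> j; case: ifP => _ //; exact: smoothR_derive1.
  apply/funext => x /=; rewrite dpartE.
  by have [_ ->] := is_derive_tensor i x spsi.
split; first by apply: continuous_tensor => j; exact: smoothR_continuous.
by move=> i x; have [] := is_derive_tensor i x spsi.
Qed.

Lemma smooth_cst (c : R) : smooth (fun _ : Rn R n => c).
Proof.
move=> l; have [c' ->] : exists c', dpart (fun _ : Rn R n => c) l = (fun=> c').
  elim: l => [|i l [c' dpartE]]; first by exists c.
  by exists 0; apply/funext => x /=; rewrite dpartE; exact: derive_cst.
split; first exact: cst_continuous.
by move=> i x; have [] := @is_derive_cst _ _ _ c' x (evec R i).
Qed.

Definition rescale phi a d (j : 'I_n) (t : R) : R := phi j ((t - a j) / d j).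

Lemma rescale_arg a d (j : 'I_n) t : (t - a j) / d j = (d j)^-1 * t + - (a j / d j).
Proof. by rewrite mulrBl mulrC. Qed.

Lemma smoothR_rescale phi a d j : smoothR (phi j) -> smoothR (rescale phi a d j).
Proof. by move=> sphi; exact: smoothR_comp_affine sphi (rescale_arg a d j). Qed.

Lemma rescale_affine phi a d j z : d j != 0 ->
  rescale phi a d j (coor j (affine a d z)) = phi j (coor j z).
Proof. by move=> d0; rewrite /rescale coor_affine addrAC subrr add0r mulrC mulKf. Qed.

Lemma tensor_rescale phi a d z : (forall j, d j != 0) ->
  tensor (rescale phi a d) (affine a d z) = tensor phi z.
Proof. by move=> d0; apply: eq_bigr => j _; exact: rescale_affine. Qed.

Lemma tensor_partial_rescale phi a d i z : (forall j, d j != 0) ->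
  (forall j, smoothR (phi j)) ->
  tensor_partial (rescale phi a d) i (affine a d z) = (d i)^-1 * tensor_partial phi i z.
Proof.
move=> d0 sphi; rewrite !tensor_partialE mulrA; congr (_ * _).
  rewrite /rescale (derive1_comp_affine _ (sphi i) (rescale_arg a d i)).
  by rewrite coor_affine addrAC subrr add0r [d i * _]mulrC mulfK.
by apply: eq_bigr => j _; exact: rescale_affine.
Qed.

Lemma euler_rescale nu phi a d z : (forall j, d j != 0) -> (forall j, smoothR (phi j)) ->
  euler nu (tensor (rescale phi a d)) (affine a d z) =
  \sum_(j < n) nu j * (a j + d j * coor j z) * ((d j)^-1 * tensor_partial phi j z).
Proof.
move=> d0 sphi; apply: eq_bigr => j _.
have [_ ->] := is_derive_tensor j (affine a d z) (fun j => smoothR_rescale a d (sphi j)).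
by rewrite tensor_partial_rescale// coor_affine.
Qed.

Definition boxcc (lo hi : 'I_n -> R) : set (Rn R n) :=
  [set z | forall j, lo j <= coor j z <= hi j].

Lemma compact_boxcc lo hi : compact (boxcc lo hi).
Proof.
have := @rV_compact R n (fun j => `[lo j, hi j]%classic) (fun j => @segment_compact R _ _).
rewrite (_ : [set v | _] = boxcc lo hi)//; apply/seteqP; split => z /= z_in j;
  by have := z_in j; rewrite /= in_itv.
Qed.

Lemma tensor_off_box phi lo hi z : (forall j t, phi j t != 0 -> lo j <= t <= hi j) ->
  ~ boxcc lo hi z -> tensor phi z = 0.
Proof.
move=> phi_supp; apply: contra_notP => /eqP.
by move=> /prodf_neq0 phi_neq0 j; exact: phi_supp (phi_neq0 j isT).
Qed.

Lemma tensor_partial_off_box phi lo hi i z :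
  (forall j t, phi j t != 0 -> lo j <= t <= hi j) ->
  ~ boxcc lo hi z -> tensor_partial phi i z = 0.
Proof.
move=> phi_supp; apply: tensor_off_box => j t.
by case: ifP => _; [exact: (derive1_within_supp (phi_supp j))|exact: phi_supp].
Qed.

End Tensor.

(** * Blow-up at a boundary point *)

Lemma ln_onem_bounds (R : realType) (t : R) : 0 <= t <= 1 / 2 ->
  t <= - ln (1 - t) <= t / (1 - t).
Proof.
move=> /andP[t0 t1]; have onem_gt0 : 0 < 1 - t by lra.
apply/andP; split; first by rewrite lerNr; apply: le_ln1Dx; lra.
rewrite -lnV ?posrE//.
rewrite (_ : ln _ = ln (1 + t / (1 - t))); last by congr ln; field; rewrite gt_eqF.
by apply: le_ln1Dx; apply: (@lt_le_trans _ _ 0); [lra|rewrite divr_ge0// ltW].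
Qed.

Section Chart.
Context {R : realType} {n : nat}.
Variables (nu : 'I_n -> R) (qn : Rn R n -> R) (R0 : R) (i0 : 'I_n) (Y : R).
Hypotheses (nu_gt0 : forall i, 0 < nu i) (qn_quasi : quasi_norm nu qn)
  (R0_gt0 : 0 < R0) (Y_ge1 : 1 <= Y).
Implicit Types (x z w : Rn R n) (s eps : R).

Definition pole : Rn R n := - evec R i0.

Definition axis_radius : R := (R0 / qn pole) `^ nu i0.

Definition chart_origin (j : 'I_n) : R := if j == i0 then - axis_radius else 0.

Definition chart_scale s eps (j : 'I_n) : R := if j == i0 then axis_radius * s else eps.

(* [z = 0] is the point of the sphere [qn = R0] on the ray through the pole; moving
   inwards along the axis increases the coordinate [z_i0]. *)
Definition chart s eps : Rn R n -> Rn R n := affine chart_origin (chart_scale s eps).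

Definition box_lo (j : 'I_n) : R := if j == i0 then 1 else -1.
Definition box_hi (j : 'I_n) : R := if j == i0 then Y else 1.

Local Notation box := (boxcc box_lo box_hi).

Lemma box_coor_axis z : box z -> 1 <= coor i0 z <= Y.
Proof. by move=> /(_ i0); rewrite /box_lo /box_hi eqxx. Qed.

Lemma box_coor_cross z j : j != i0 -> box z -> `|coor j z| <= 1.
Proof. by move=> ji /(_ j); rewrite /box_lo /box_hi (negbTE ji) ler_norml. Qed.

Lemma coor_pole j : coor j pole = if j == i0 then -1 else 0.
Proof. by rewrite /coor !mxE eqxx/=; case: eqP; rewrite ?oppr0. Qed.

Lemma qn_pole_gt0 : 0 < qn pole.
Proof.
apply: (qn_gt0 qn_quasi); apply/eqP => /(congr1 (coor i0)).
by rewrite coor_pole eqxx /coor mxE; lra.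
Qed.

Lemma axis_radius_gt0 : 0 < axis_radius.
Proof. by rewrite powR_gt0// divr_gt0// qn_pole_gt0. Qed.

Lemma chart_scale_gt0 s eps j : 0 < s -> 0 < eps -> 0 < chart_scale s eps j.
Proof.
move=> s0 e0; rewrite /chart_scale; case: ifP => // _.
by rewrite mulr_gt0// axis_radius_gt0.
Qed.

Lemma coor_chart_axis s eps z :
  coor i0 (chart s eps z) = - (axis_radius * (1 - s * coor i0 z)).
Proof. by rewrite coor_affine /chart_origin /chart_scale eqxx; ring. Qed.

Lemma coor_chart_cross s eps z j : j != i0 -> coor j (chart s eps z) = eps * coor j z.
Proof. by move=> ji; rewrite coor_affine /chart_origin /chart_scale (negbTE ji) add0r. Qed.

Lemma Lw_near_pole (d : R) : 0 < d -> exists2 del : R, 0 < del &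
  forall w, (forall j, `|coor j pole - coor j w| < del) ->
  0 < qn w /\ `|Lw qn R0 pole - Lw qn R0 w| <= d.
Proof.
move=> d0; have Lw_cvg := continuous_Lw qn_quasi R0_gt0 qn_pole_gt0.
have Lw_close : \forall w \near pole, `|Lw qn R0 pole - Lw qn R0 w| <= d.
  by move/cvgrPdist_le : Lw_cvg; exact.
have qn_pos : \forall w \near pole, 0 < qn w.
  have qn_cvg : qn w @[w --> pole] --> qn pole by exact: (qn_continuous qn_quasi).
  exact: (cvgr_gt _ qn_cvg _ qn_pole_gt0).
have /nbhs_ballP[del /= del0 ball_del] : nbhs pole
  [set w | 0 < qn w /\ `|Lw qn R0 pole - Lw qn R0 w| <= d] by exact: filterI.
by exists del => // w w_close; apply: ball_del; exact: ball_coor.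
Qed.

(* Dilate [chart s eps z] back to the hyperplane through the pole; this is the only
   place where the quasi-norm is used off the axis, near the single point [pole]. *)
Definition ray_param s z : R := (axis_radius * (1 - s * coor i0 z)) `^ (nu i0)^-1.

Section RayParam.
Variables (s : R) (z : Rn R n).
Hypotheses (s_gt0 : 0 < s) (sY : s * Y <= 1 / 2) (box_z : box z).

Lemma onem_scoor_bounds : 1 / 2 <= 1 - s * coor i0 z < 1.
Proof.
have := s_gt0; have := sY; have /andP[] := box_coor_axis box_z.
by move=> z1 zY sY' s0; apply/andP; split; nra.
Qed.

Lemma onem_scoor_gt0 : 0 < 1 - s * coor i0 z.
Proof. by have /andP[+ _] := onem_scoor_bounds; apply: lt_le_trans; lra. Qed.

Lemma ray_param_gt0 : 0 < ray_param s z.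
Proof. by rewrite powR_gt0// mulr_gt0 ?axis_radius_gt0 ?onem_scoor_gt0. Qed.

Lemma ray_param_ge : (axis_radius / 2) `^ (nu i0)^-1 <= ray_param s z.
Proof.
have ar0 := axis_radius_gt0; have /andP[half_le _] := onem_scoor_bounds.
apply: ge0_ler_powR; rewrite ?nnegrE ?invr_ge0 ?(ltW (nu_gt0 i0))//.
- by rewrite divr_ge0// ltW.
- by rewrite mulr_ge0 ?ltW ?onem_scoor_gt0.
- by apply: ler_wpM2l; [exact: ltW|lra].
Qed.

Lemma ln_ray_param : ln (ray_param s z) =
  Lw qn R0 pole + (nu i0)^-1 * ln (1 - s * coor i0 z).
Proof.
rewrite /ray_param ln_powR lnM ?posrE ?axis_radius_gt0 ?onem_scoor_gt0//.
rewrite /axis_radius ln_powR -/(Lw qn R0 pole).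
by field; rewrite gt_eqF.
Qed.

Lemma coor_ray_param j eps :
  coor j (dil nu (ray_param s z)^-1 (chart s eps z)) =
  if j == i0 then -1 else eps * ((ray_param s z)^-1 `^ nu j * coor j z).
Proof.
rewrite coor_dil; have [->|ji] := eqVneq j i0; last first.
  by rewrite coor_chart_cross//; ring.
rewrite coor_chart_axis mulrN; congr (- _).
have <- : ray_param s z `^ nu i0 = axis_radius * (1 - s * coor i0 z).
  rewrite /ray_param -powRrM mulVf ?gt_eqF// powRr1//.
  by rewrite mulr_ge0 ?ltW ?axis_radius_gt0 ?onem_scoor_gt0.
have rp0 := ray_param_gt0.
by rewrite -powRM ?invr_ge0 ?(ltW rp0)// mulVf ?gt_eqF// powR1.
Qed.

End RayParam.

Lemma Lw_chart_close (d : R) : 0 < d -> exists2 eps : R, 0 < eps &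
  forall s z, 0 < s -> s * Y <= 1 / 2 -> box z ->
  0 < qn (chart s eps z) /\
  `|Lw qn R0 (chart s eps z) + (nu i0)^-1 * ln (1 - s * coor i0 z)| <= d.
Proof.
move=> /Lw_near_pole[del del0 near_pole].
pose rho_min := (axis_radius / 2) `^ (nu i0)^-1.
have rho_min_gt0 : 0 < rho_min by rewrite powR_gt0// divr_gt0// axis_radius_gt0.
pose C := \sum_(j < n) rho_min^-1 `^ nu j.
have C_ge0 : 0 <= C by apply: sumr_ge0 => j _; exact: powR_ge0.
have C1 : 0 < C + 1 by rewrite ltr_wpDl.
exists (del / (C + 1)); first by rewrite divr_gt0.
move=> s z s0 sY bz; set x := chart _ _ _.
have rho0 := ray_param_gt0 s0 sY bz; have rho_ge := ray_param_ge s0 sY bz.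
pose w := dil nu (ray_param s z)^-1 x.
have xE : x = dil nu (ray_param s z) w by rewrite /w dilK.
have [j|qw Lw_close] := near_pole w.
  rewrite coor_pole coor_ray_param//; case: eqVneq => [_|ji]; first by rewrite subrr normr0.
  rewrite sub0r normrN normrM gtr0_norm ?divr_gt0// mulrAC ltr_pdivrMr// ltr_pM2l//.
  apply: (@le_lt_trans _ _ C); last by rewrite ltrDl.
  rewrite normrM ger0_norm ?powR_ge0//.
  apply: (@le_trans _ _ ((ray_param s z)^-1 `^ nu j)).
    by rewrite ler_piMr ?powR_ge0// box_coor_cross.
  apply: (@le_trans _ _ (rho_min^-1 `^ nu j)).
    by apply: ge0_ler_powR; rewrite ?nnegrE ?invr_ge0 ?(ltW rho0) ?(ltW rho_min_gt0)
      ?(ltW (nu_gt0 j))// lef_pV2.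
  by rewrite /C (bigD1 j)//= lerDl sumr_ge0// => l _; exact: powR_ge0.
split; first by rewrite xE (qn_dil qn_quasi)// mulr_gt0.
rewrite xE (Lw_dil qn_quasi R0_gt0)// ln_ray_param// distrC in Lw_close *.
by rewrite opprD addrA addrNK.
Qed.

(* [L] is then of order [s k] on the chart: [L / s k] tends to [z_i0 / nu_i0]. *)
Definition blowup_sequence (s eps : R^nat) :=
  [/\ forall k, [/\ 0 < s k, s k <= 1, s k * Y <= 1 / 2 & s k <= (2 * nu i0)^-1],
      forall k, 0 < eps k, s k @[k --> \oo] --> 0 &
      forall k z, box z -> 0 < qn (chart (s k) (eps k) z) /\
        `|Lw qn R0 (chart (s k) (eps k) z)
          + (nu i0)^-1 * ln (1 - s k * coor i0 z)| <= s k ^+ 2].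

Lemma exists_blowup_sequence : exists s eps : R^nat, blowup_sequence s eps.
Proof.
have N0 := nu_gt0 i0; have Y1 := Y_ge1.
pose denom := 2 * Y + 2 * nu i0 + 2; have denom_gt0 : 0 < denom by rewrite /denom; lra.
pose s (k : nat) := denom^-1 / k.+1%:R.
have s_gt0 k : 0 < s k by rewrite divr_gt0// invr_gt0.
have s_le k a : 0 < a -> a <= denom -> s k <= a^-1.
  move=> a0 a_le; apply: (@le_trans _ _ denom^-1); last by rewrite lef_pV2.
  by rewrite ler_pdivrMr// ler_peMr ?invr_ge0 ?(ltW denom_gt0)// ler1n.
have s_le1 k : s k <= 1 by rewrite -invr1 s_le// /denom; lra.
have sN k : s k <= (2 * nu i0)^-1 by apply: s_le; rewrite /denom; lra.
have sY k : s k * Y <= 1 / 2.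
  have Y20 : 0 < 2 * Y by lra.
  have : s k * (2 * Y) <= 1 by rewrite -ler_pdivlMr// mul1r s_le// /denom; lra.
  by lra.
have /choice[eps epsP] : forall k, exists e : R, 0 < e /\ forall z, box z ->
    0 < qn (chart (s k) e z) /\
    `|Lw qn R0 (chart (s k) e z) + (nu i0)^-1 * ln (1 - s k * coor i0 z)| <= s k ^+ 2.
  move=> k; have [e e0 close] := Lw_chart_close (exprn_gt0 2 (s_gt0 k)).
  by exists e; split => // z; exact: close.
exists s, eps; split => // [k||k z].
- by have [] := epsP k.
- by rewrite -[X in _ --> X](mulr0 denom^-1); apply: cvgMl_tmp; exact: cvg_harmonic.
- by have [_] := epsP k; exact.
Qed.

End Chart.

Section BlowUp.
Context {R : realType} {n : nat}.
Variables (nu : 'I_n -> R) (qn : Rn R n -> R) (R0 : R) (i0 : 'I_n) (Y : R).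
Hypotheses (nu_gt0 : forall i, 0 < nu i) (qn_quasi : quasi_norm nu qn)
  (R0_gt0 : 0 < R0).
Variables s eps : R^nat.
Hypothesis blowup : blowup_sequence nu qn R0 i0 Y s eps.
Implicit Types (x z : Rn R n) (k : nat) (a b p : R).

Local Notation box := (boxcc (box_lo i0) (box_hi i0 Y)).
Local Notation chart_k k := (chart nu qn R0 i0 (s k) (eps k)).

Let s_gt0 k : 0 < s k. Proof. by have [+ _ _ _] := blowup; case/(_ k). Qed.
Let s_le1 k : s k <= 1. Proof. by have [+ _ _ _] := blowup; case/(_ k). Qed.
Let s_cvg0 : s k @[k --> \oo] --> 0. Proof. by case: blowup. Qed.
Let eps_gt0 k : 0 < eps k. Proof. by have [_ + _ _] := blowup. Qed.
Let scale_gt0 k j : 0 < chart_scale nu qn R0 i0 (s k) (eps k) j.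
Proof. exact: chart_scale_gt0. Qed.

Definition scaled_Lw k z : R := Lw qn R0 (chart_k k z) / s k.

Lemma mulr_scaled_Lw k z : s k * scaled_Lw k z = Lw qn R0 (chart_k k z).
Proof. by rewrite /scaled_Lw mulrC divfK// gt_eqF. Qed.

Lemma scaled_Lw_bounds k z : box z ->
  coor i0 z / nu i0 - s k <= scaled_Lw k z
    <= coor i0 z / nu i0 / (1 - s k * coor i0 z) + s k.
Proof.
move=> bz; have [/(_ k)[_ _ sY _] _ _ /(_ k z bz)[_]] := blowup.
have s0 := s_gt0 k; have /andP[z1 zY] := box_coor_axis bz.
have NV : 0 < (nu i0)^-1 by rewrite invr_gt0.
have sz : 0 <= s k * coor i0 z <= 1 / 2 by apply/andP; split; nra.
have /andP[] := ln_onem_bounds sz.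
rewrite -(ler_pM2l NV) => log_ge; rewrite -(ler_pM2l NV) => log_le.
rewrite ler_norml => /andP[Lw_ge Lw_le].
rewrite /scaled_Lw ler_pdivlMr// ler_pdivrMr//; apply/andP; split; first by nra.
have -> : (coor i0 z / nu i0 / (1 - s k * coor i0 z) + s k) * s k =
  (nu i0)^-1 * (s k * coor i0 z / (1 - s k * coor i0 z)) + s k ^+ 2 by ring.
by lra.
Qed.

Lemma scaled_Lw_range k z : box z ->
  (2 * nu i0)^-1 <= scaled_Lw k z <= 2 * Y / nu i0 + 1.
Proof.
move=> bz; have [/(_ k)[_ _ sY sN] _ _ _] := blowup; have s1 := s_le1 k.
have /andP[Lw_ge Lw_le] := scaled_Lw_bounds k bz; have /andP[z1 zY] := box_coor_axis bz.
have NV : 0 < (nu i0)^-1 by rewrite invr_gt0.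
have halfN : (2 * nu i0)^-1 = (nu i0)^-1 / 2 by rewrite invfM mulrC.
apply/andP; split.
  apply: le_trans Lw_ge; have : (nu i0)^-1 <= coor i0 z / nu i0.
    by rewrite ler_peMl// ltW.
  by rewrite halfN in sN *; lra.
apply: le_trans Lw_le _; apply: lerD => //.
have half_le : 1 / 2 <= 1 - s k * coor i0 z by have := s_gt0 k; nra.
rewrite ler_pdivrMr; last by lra.
rewrite mulrAC ler_pM2r//; nra.
Qed.

Lemma scaled_Lw_gt0 k z : box z -> 0 < scaled_Lw k z.
Proof.
by move=> /(scaled_Lw_range k)/andP[+ _]; apply: lt_le_trans; rewrite invr_gt0 mulr_gt0.
Qed.

Lemma qn_chartE k z : box z -> qn (chart_k k z) = R0 * expR (- (s k * scaled_Lw k z)).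
Proof.
move=> bz; have [_ _ _ /(_ k z bz)[q0 _]] := blowup.
rewrite mulr_scaled_Lw /Lw expRN lnK ?posrE ?divr_gt0// invf_div.
by rewrite mulrCA mulfV ?mulr1// gt_eqF.
Qed.

Lemma qn_chart_lt k z : box z -> 0 < qn (chart_k k z) < R0.
Proof.
move=> bz; rewrite qn_chartE// mulr_gt0 ?expR_gt0//= gtr_pMr//.
by rewrite expR_lt1 oppr_lt0 mulr_gt0// scaled_Lw_gt0.
Qed.

Lemma scaled_Lw_cvg z : box z -> scaled_Lw k z @[k --> \oo] --> coor i0 z / nu i0.
Proof.
move=> bz; have lower : coor i0 z / nu i0 - s k @[k --> \oo] --> coor i0 z / nu i0.
  by rewrite -[X in _ --> X]subr0; apply: cvgB => //; exact: cvg_cst.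
have upper : coor i0 z / nu i0 / (1 - s k * coor i0 z) + s k @[k --> \oo] -->
    coor i0 z / nu i0.
  rewrite -[X in _ --> X]addr0; apply: cvgD => //.
  rewrite -[X in _ --> X]divr1; apply: cvgMl_tmp; apply: cvgV => //.
  rewrite -[X in _ --> X]subr0; apply: cvgB; first exact: cvg_cst.
  by rewrite -[X in _ --> X](mul0r (coor i0 z)); apply: cvgMr_tmp.
apply: (squeeze_cvgr _ lower upper).
by near=> k; exact: scaled_Lw_bounds.
Unshelve. all: by end_near. Qed.

Lemma qn_chart_cvg z : box z -> qn (chart_k k z) @[k --> \oo] --> R0.
Proof.
move=> bz; rewrite (funext (fun k => qn_chartE k bz)).
rewrite -[X in _ --> X]mulr1; apply: cvgMl_tmp; rewrite -expR0.
have exponent : - (s k * scaled_Lw k z) @[k --> \oo] --> (0 : R).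
  rewrite -[X in _ --> X]oppr0; apply: cvgN.
  rewrite -[X in _ --> X](mul0r (coor i0 z / nu i0)); apply: cvgM => //.
  exact: scaled_Lw_cvg.
by apply: (cvg_comp _ _ exponent); exact: continuous_expR.
Qed.

Definition scaled_weight a b k z : R := s k `^ b * weight qn R0 a b (chart_k k z).

Lemma scaled_weightE a b k z : box z ->
  scaled_weight a b k z = qn (chart_k k z) `^ (- a) * scaled_Lw k z `^ (- b).
Proof.
move=> bz; have L0 := ltW (scaled_Lw_gt0 k bz); rewrite /scaled_weight.
have -> : weight qn R0 a b (chart_k k z) =
    qn (chart_k k z) `^ (- a) * (s k `^ (- b) * scaled_Lw k z `^ (- b)).
  by rewrite /weight -powRM ?(ltW (s_gt0 k))// mulr_scaled_Lw.
rewrite mulrCA; congr (_ * _); rewrite mulrA powRN mulfV ?mul1r//.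
by rewrite gt_eqF// powR_gt0.
Qed.

Lemma scaled_weight_bounded a b : exists2 M : R, 0 <= M & forall k z, box z ->
  `|scaled_weight a b k z| <= M.
Proof.
pose L_min := (2 * nu i0)^-1; pose L_max := 2 * Y / nu i0 + 1.
have L_min_gt0 : 0 < L_min by rewrite invr_gt0 mulr_gt0.
exists (((R0 * expR (- L_max)) `^ (- a) + R0 `^ (- a)) *
        (L_min `^ (- b) + L_max `^ (- b))) => [|k z bz].
  by rewrite mulr_ge0 ?addr_ge0 ?powR_ge0.
have L_range := scaled_Lw_range k bz; have L0 := scaled_Lw_gt0 k bz.
rewrite scaled_weightE// ger0_norm ?mulr_ge0 ?powR_ge0//.
apply: ler_pM; rewrite ?powR_ge0//; last exact: powR_le_endpoints.
rewrite qn_chartE//; apply: powR_le_endpoints; first by rewrite mulr_gt0// expR_gt0.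
apply/andP; split; last first.
  by have /andP[_ /ltW] := qn_chart_lt k bz; rewrite qn_chartE.
rewrite ler_pM2l// ler_expR lerN2; have /andP[_] := L_range; apply: le_trans.
by rewrite ler_piMl// ltW.
Qed.

Lemma scaled_weight_cvg a b z : box z -> scaled_weight a b k z @[k --> \oo] -->
  R0 `^ (- a) * (coor i0 z / nu i0) `^ (- b).
Proof.
move=> bz; rewrite (funext (fun k => scaled_weightE a b k bz)).
have /andP[z1 _] := box_coor_axis bz.
apply: cvgM; apply: cvg_powR_gt0 => //; [exact: qn_chart_cvg| |exact: scaled_Lw_cvg].
by rewrite divr_gt0//; exact: lt_le_trans z1.
Qed.

Lemma measurable_scaled_weight a b k : measurable_fun setT (scaled_weight a b k).
Proof.
apply: measurable_funM => //.
apply: (measurableT_comp (measurable_weight _ qn_quasi _ _)); exact: measurable_affine.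
Qed.

Variable mu : {measure set (Rn R n) -> \bar R}.
Hypothesis mu_lebesgue : is_lebesgue_measure mu.

Lemma Rintegral_scaled_weight_cvg a b p (w : nat -> Rn R n -> R) (w_lim : Rn R n -> R)
    (M : R) : 0 < p ->
  (forall k, continuous (w k)) -> continuous w_lim ->
  (forall k z, `|w k z| <= M) -> (forall k z, ~ box z -> w k z = 0) ->
  (forall z, w k z @[k --> \oo] --> w_lim z) ->
  (\int[mu]_z (`|w k z| `^ p * scaled_weight a b k z))%R @[k --> \oo] -->
  (\int[mu]_z (`|w_lim z| `^ p * (R0 `^ (- a) * (coor i0 z / nu i0) `^ (- b))))%R /\
  mu.-integrable setT (EFin \o
    (fun z => `|w_lim z| `^ p * (R0 `^ (- a) * (coor i0 z / nu i0) `^ (- b)))).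
Proof.
move=> p0 cw cw_lim w_le w_box w_cvg; have [N N0 weightN] := scaled_weight_bounded a b.
have M0 : 0 <= M by exact: le_trans (w_le 0%N 0).
have p_neq0 : p != 0 by exact: lt0r_neq0.
have mpowR (g : Rn R n -> R) q : measurable_fun setT g -> measurable_fun setT (fun z => g z `^ q).
  by move=> mg; exact: (measurableT_comp (measurable_powR _)).
have mnorm (g : Rn R n -> R) : continuous g -> measurable_fun setT (fun z => `|g z| `^ p).
  move=> cg; apply: mpowR; apply: measurableT_comp => //.
  exact: continuous_measurable_Rn.
have w_lim_box z : ~ box z -> w_lim z = 0.
  move=> bz; rewrite -(cvg_lim (@norm_hausdorff _ R) (w_cvg z)).
  by rewrite (funext (fun k => w_box k z bz)) lim_cst.
have [B boxB] := compact_norm_bounded (@compact_boxcc R n (box_lo i0) (box_hi i0 Y)).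
apply: (bounded_convergence mu_lebesgue (M := M `^ p * N) (B := B)).
- by move=> k; apply: measurable_funM; [exact: mnorm|exact: measurable_scaled_weight].
- apply: measurable_funM; first exact: mnorm.
  apply: measurable_funM => //; apply: mpowR; apply: measurable_funM => //.
  exact: measurable_coor.
- move=> k z; have [bz|bz] := pselect (box z); last first.
    by rewrite w_box// normr0 powR0// mul0r normr0 mulr_ge0// powR_ge0.
  rewrite normrM ger0_norm ?powR_ge0//; apply: ler_pM; rewrite ?powR_ge0 ?weightN//.
  by apply: ge0_ler_powR; rewrite ?nnegrE ?(ltW p0).
- by move=> k z /boxB bz; rewrite w_box// normr0 powR0// mul0r.
- move=> z; have [bz|bz] := pselect (box z); last first.
    rewrite w_lim_box// normr0 powR0// mul0r; apply: cvg_near_cst; near=> k.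
    by rewrite w_box// normr0 powR0// mul0r.
  apply: cvgM; last exact: scaled_weight_cvg.
  by apply: cvg_powR => //; apply: cvg_norm; exact: w_cvg.
Unshelve. all: by end_near. Qed.

End BlowUp.

Section BlowUpTestFunctions.
Context {R : realType} {n : nat}.
Variables (nu : 'I_n -> R) (qn : Rn R n -> R) (R0 : R) (i0 : 'I_n) (Y : R).
Hypotheses (nu_gt0 : forall i, 0 < nu i) (qn_quasi : quasi_norm nu qn)
  (R0_gt0 : 0 < R0).
Variables s eps : R^nat.
Hypothesis blowup : blowup_sequence nu qn R0 i0 Y s eps.
Variable phi : 'I_n -> R -> R.
Hypotheses (smooth_phi : forall j, smoothR (phi j))
  (phi_supp : forall j t, phi j t != 0 -> box_lo i0 j <= t <= box_hi i0 Y j).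
Implicit Types (x z : Rn R n) (k : nat) (p alpha beta : R).

Local Notation box := (boxcc (box_lo i0) (box_hi i0 Y)).
Local Notation origin := (chart_origin nu qn R0 i0).
Local Notation scale k := (chart_scale nu qn R0 i0 (s k) (eps k)).
Local Notation chart_k k := (chart nu qn R0 i0 (s k) (eps k)).

Let s_gt0 k : 0 < s k. Proof. by have [+ _ _ _] := blowup; case/(_ k). Qed.
Let scale_gt0 k j : 0 < scale k j.
Proof. by have [_ + _ _] := blowup => eps_gt0; exact: chart_scale_gt0. Qed.
Let scale_neq0 k j : scale k j != 0. Proof. exact: lt0r_neq0. Qed.

Definition blowup_test k x : R[i] := (tensor (rescale phi origin (scale k)) x)%:C%C.

Definition blowup_support k : set (Rn R n) :=
  boxcc (fun j => origin j + scale k j * box_lo i0 j)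
        (fun j => origin j + scale k j * box_hi i0 Y j).

Lemma chart_surj k x : exists z, x = chart_k k z.
Proof.
exists (\row_j ((x ord0 j - origin j) / scale k j)).
by apply/rowP => j; rewrite !mxE /coor mxE mulrCA mulfV// mulr1 addrC subrK.
Qed.

Lemma blowup_support_chart k z : blowup_support k (chart_k k z) <-> box z.
Proof.
by split=> z_in j; have := z_in j; rewrite coor_affine !lerD2l !ler_pM2l.
Qed.

Lemma blowup_testE k z : blowup_test k (chart_k k z) = (tensor phi z)%:C%C.
Proof. by rewrite /blowup_test tensor_rescale. Qed.

Lemma blowup_test_function k : test_function qn R0 (blowup_support k) (blowup_test k).
Proof.
split.
- by apply: smooth_tensor => j; exact: smoothR_rescale.
- exact: smooth_cst.
- exact: compact_boxcc.
- move=> x; have [z ->] := chart_surj k x; move=> /blowup_support_chart bz.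
  have /andP[q0 qR] := qn_chart_lt nu_gt0 R0_gt0 blowup k bz.
  by split => //= z0; rewrite z0 (qn_eq0 qn_quasi 0).2// ltxx in q0.
- move=> x; have [z ->] := chart_surj k x => supp_z; rewrite blowup_testE.
  by rewrite (tensor_off_box phi_supp)// => /blowup_support_chart.
Qed.

Definition cross_euler z : R := \sum_(j < n | j != i0) nu j * coor j z * tensor_partial phi j z.

Definition scaled_euler k z : R :=
  - (nu i0 * (1 - s k * coor i0 z) * tensor_partial phi i0 z) + s k * cross_euler z.

Lemma ceuler_blowup_test k z :
  (s k)%:C%C * ceuler nu (blowup_test k) (chart_k k z) = (scaled_euler k z)%:C%C.
Proof.
rewrite mulrC complex_Mreal /ceuler/= euler_cst mul0r; congr Complex.
rewrite euler_rescale// (bigD1 i0)//= mulrDl /scaled_euler /cross_euler; congr (_ + _).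
  have ar0 := lt0r_neq0 (axis_radius_gt0 i0 qn_quasi R0_gt0).
  rewrite /chart_origin /chart_scale eqxx; field.
  by rewrite ar0 gt_eqF.
rewrite mulrC; congr (_ * _); apply: eq_bigr => j ji.
rewrite /chart_origin /chart_scale (negbTE ji) add0r; field.
by have := scale_neq0 k j; rewrite /chart_scale (negbTE ji).
Qed.

Lemma continuous_tensor_partial j : continuous (tensor_partial phi j).
Proof.
apply: continuous_tensor => l; apply: smoothR_continuous; case: ifP => _ //.
exact: smoothR_derive1.
Qed.

Lemma continuous_cross_euler : continuous cross_euler.
Proof.
move=> z; apply: (@cvg_big _ _ _ _ _ _ _ (nbhs z)) => [|j _]; first exact: add_continuous.
apply: (@cvgM _ _ (nbhs z)); last exact: continuous_tensor_partial.
by apply: (@cvgM _ _ (nbhs z)); [exact: cvg_cst|exact: continuous_coor].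
Qed.

Lemma continuous_scaled_euler k : continuous (scaled_euler k).
Proof.
move=> z; apply: (@cvgD _ _ _ (nbhs z)); last first.
  by apply: (@cvgM _ _ (nbhs z)); [exact: cvg_cst|exact: continuous_cross_euler].
apply: (@cvgN _ _ _ (nbhs z)); apply: (@cvgM _ _ (nbhs z)); last first.
  exact: continuous_tensor_partial.
apply: (@cvgM _ _ (nbhs z)); first exact: cvg_cst.
apply: (@cvgB _ _ _ (nbhs z)); first exact: cvg_cst.
by apply: (@cvgM _ _ (nbhs z)); [exact: cvg_cst|exact: continuous_coor].
Qed.

Lemma scaled_euler_off_box k z : ~ box z -> scaled_euler k z = 0.
Proof.
move=> bz; rewrite /scaled_euler (tensor_partial_off_box _ phi_supp bz) mulr0 oppr0 add0r.
rewrite /cross_euler big1 ?mulr0// => j _.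
by rewrite (tensor_partial_off_box _ phi_supp bz) mulr0.
Qed.

Lemma scaled_euler_bounded : exists M : R, forall k z, `|scaled_euler k z| <= M.
Proof.
have cbox := @compact_boxcc R n (box_lo i0) (box_hi i0 Y).
have [M M0 axis_le] := continuous_compact_bounded cbox (in1W (continuous_tensor_partial (j := i0))).
have [N N0 cross_le] := continuous_compact_bounded cbox (in1W continuous_cross_euler).
exists (nu i0 * M + N) => k z.
have [bz|bz] := pselect (box z); last first.
  by rewrite scaled_euler_off_box// normr0 addr_ge0// mulr_ge0// ltW.
have [/(_ k)[_ s1 sY _] _ _ _] := blowup.
have /andP[onem_ge onem_lt] := onem_scoor_bounds (s_gt0 k) sY bz.
apply: le_trans (ler_normD _ _) _; apply: lerD; last first.
  rewrite normrM gtr0_norm// -[leRHS]mul1r.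
  by apply: ler_pM => //; [exact: ltW|exact: cross_le].
rewrite normrN -mulrA normrM gtr0_norm//; apply: ler_wpM2l; first exact: ltW.
rewrite normrM -[leRHS]mul1r; apply: ler_pM => //; last exact: axis_le.
by rewrite ger0_norm; lra.
Qed.

Lemma scaled_euler_cvg z :
  scaled_euler k z @[k --> \oo] --> - (nu i0 * tensor_partial phi i0 z).
Proof.
have [_ _ s_cvg0 _] := blowup.
rewrite -[X in _ --> X]addr0; apply: cvgD; last first.
  by rewrite -[X in _ --> X](mul0r (cross_euler z)); exact: cvgMr_tmp.
apply: cvgN; apply: cvgMr_tmp; rewrite -[X in _ --> X]mulr1; apply: cvgMl_tmp.
rewrite -[X in _ --> X]subr0; apply: cvgB; first exact: cvg_cst.
by rewrite -[X in _ --> X](mul0r (coor i0 z)); exact: cvgMr_tmp.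
Qed.

Variables (mu : {measure set (Rn R n) -> \bar R}) (p alpha beta : R).
Hypotheses (mu_lebesgue : is_lebesgue_measure mu) (p_gt1 : 1 < p).

Let p_gt0 : 0 < p. Proof. exact: lt_trans p_gt1. Qed.

Local Notation test_mass k :=
  (weighted_powR qn R0 p (alpha + p) (beta + p + 1) (blowup_test k)).
Local Notation test_energy k :=
  (weighted_powR qn R0 p (alpha + p) (beta + 1) (ceuler nu (blowup_test k))).

Lemma test_mass_chart k z : s k `^ (beta + p + 1) * test_mass k (chart_k k z) =
  `|tensor phi z| `^ p * scaled_weight nu qn R0 i0 s eps (alpha + p) (beta + p + 1) k z.
Proof. by rewrite /weighted_powR blowup_testE cabs_real mulrCA. Qed.

Lemma test_energy_chart k z : s k `^ (beta + p + 1) * test_energy k (chart_k k z) =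
  `|scaled_euler k z| `^ p * scaled_weight nu qn R0 i0 s eps (alpha + p) (beta + 1) k z.
Proof.
rewrite -cabs_real -ceuler_blowup_test mulrC [(s k)%:C%C * _]mulrC cabs_Mreal.
rewrite gtr0_norm// powRM ?cabs_ge0 ?(ltW (s_gt0 k))// /scaled_weight.
rewrite (_ : beta + p + 1 = p + (beta + 1)); last by ring.
by rewrite powRD_gt0// /weighted_powR; ring.
Qed.

Lemma Rintegral_chart (g : Rn R n -> R) k : mu.-integrable setT (EFin \o g) ->
  s k `^ (beta + p + 1) * (\int[mu]_x g x)%R = (\prod_(j < n) scale k j) *
  (\int[mu]_z (s k `^ (beta + p + 1) * g (chart_k k z)))%R.
Proof.
move=> ig; rewrite (Rintegral_affine mu_lebesgue origin (scale_gt0 k) ig) mulrCA RintegralZl//.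
exact: (integrable_affine mu_lebesgue origin (scale_gt0 k) ig).
Qed.

Lemma blowup_inequality_chart (C : R) k :
  C * I_f qn mu R0 p alpha beta (blowup_test k) <=
    I_Rf nu qn mu R0 p alpha beta (blowup_test k) ->
  C * (\int[mu]_z (`|tensor phi z| `^ p *
    scaled_weight nu qn R0 i0 s eps (alpha + p) (beta + p + 1) k z))%R <=
  (\int[mu]_z (`|scaled_euler k z| `^ p *
    scaled_weight nu qn R0 i0 s eps (alpha + p) (beta + 1) k z))%R.
Proof.
have test := blowup_test_function k.
have mass_int : mu.-integrable setT (EFin \o test_mass k).
  apply: bounded_with_support_integrable => //.
  exact: (bounded_with_support_powR qn_quasi R0_gt0 test _ _ p_gt0
    (ccontinuous_test test) (test_off_support test)).
have energy_int : mu.-integrable setT (EFin \o test_energy k).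
  apply: bounded_with_support_integrable => //.
  exact: (bounded_with_support_powR qn_quasi R0_gt0 test _ _ p_gt0
    (ccontinuous_ceuler nu test) (ceuler_off_support nu test)).
rewrite (I_fE mu alpha beta qn_quasi p_gt1 test) (I_RfE mu alpha beta qn_quasi p_gt1 test).
rewrite -(ler_pM2l (powR_gt0 (beta + p + 1) (s_gt0 k))) mulrCA !Rintegral_chart//.
have jacobian_gt0 : 0 < \prod_(j < n) scale k j by exact: prodr_gt0.
rewrite [C * (_ * _)]mulrCA (ler_pM2l jacobian_gt0).
under eq_Rintegral do rewrite test_mass_chart.
by under [X in _ <= X -> _]eq_Rintegral do rewrite test_energy_chart.
Qed.

Definition limit_mass z : R := `|tensor phi z| `^ p *
  (R0 `^ (- (alpha + p)) * (coor i0 z / nu i0) `^ (- (beta + p + 1))).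

Definition limit_energy z : R := `|nu i0 * tensor_partial phi i0 z| `^ p *
  (R0 `^ (- (alpha + p)) * (coor i0 z / nu i0) `^ (- (beta + 1))).

Lemma limit_mass_cvg :
  (\int[mu]_z (`|tensor phi z| `^ p *
    scaled_weight nu qn R0 i0 s eps (alpha + p) (beta + p + 1) k z))%R
    @[k --> \oo] --> (\int[mu]_z limit_mass z)%R /\
  mu.-integrable setT (EFin \o limit_mass).
Proof.
have ctensor : continuous (tensor phi).
  by apply: continuous_tensor => j; exact: smoothR_continuous.
have [M M0 tensor_le] :=
  continuous_compact_bounded (@compact_boxcc R n (box_lo i0) (box_hi i0 Y)) (in1W ctensor).
apply: (Rintegral_scaled_weight_cvg nu_gt0 qn_quasi R0_gt0 blowup mu_lebesgue _ _
  (w := fun=> tensor phi) (M := M)) => //.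
- move=> _ z; have [/tensor_le//|bz] := pselect (box z).
  by rewrite (tensor_off_box phi_supp)// normr0.
- by move=> _ z; exact: tensor_off_box.
- by move=> z; exact: cvg_cst.
Qed.

Lemma limit_energy_cvg :
  (\int[mu]_z (`|scaled_euler k z| `^ p *
    scaled_weight nu qn R0 i0 s eps (alpha + p) (beta + 1) k z))%R
    @[k --> \oo] --> (\int[mu]_z limit_energy z)%R /\
  mu.-integrable setT (EFin \o limit_energy).
Proof.
have [M euler_le] := scaled_euler_bounded.
have -> : limit_energy = fun z => `|- (nu i0 * tensor_partial phi i0 z)| `^ p *
    (R0 `^ (- (alpha + p)) * (coor i0 z / nu i0) `^ (- (beta + 1))).
  by apply/funext => z; rewrite normrN.
apply: (Rintegral_scaled_weight_cvg nu_gt0 qn_quasi R0_gt0 blowup mu_lebesgue _ _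
  (M := M)) => //.
- exact: continuous_scaled_euler.
- move=> z; apply: (@cvgN _ _ _ (nbhs z)).
  by apply: (@cvgM _ _ (nbhs z)); [exact: cvg_cst|exact: continuous_tensor_partial].
- exact: scaled_euler_off_box.
- exact: scaled_euler_cvg.
Qed.

End BlowUpTestFunctions.

Lemma blowup_inequality (R : realType) (n : nat) (nu : 'I_n -> R) (qn : Rn R n -> R)
    (mu : {measure set (Rn R n) -> \bar R}) (R0 p alpha beta : R)
    (i0 : 'I_n) (Y C : R) (phi : 'I_n -> R -> R) :
  (forall i, 0 < nu i) -> is_lebesgue_measure mu -> quasi_norm nu qn ->
  0 < R0 -> 1 < p -> 1 <= Y -> (forall j, smoothR (phi j)) ->
  (forall j t, phi j t != 0 -> box_lo i0 j <= t <= box_hi i0 Y j) ->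
  (forall f, C0inf_punct qn R0 f ->
     C * I_f qn mu R0 p alpha beta f <= I_Rf nu qn mu R0 p alpha beta f) ->
  [/\ mu.-integrable setT (EFin \o limit_mass nu R0 i0 phi p alpha beta),
      mu.-integrable setT (EFin \o limit_energy nu R0 i0 phi p alpha beta) &
      C * (\int[mu]_z limit_mass nu R0 i0 phi p alpha beta z)%R <=
      (\int[mu]_z limit_energy nu R0 i0 phi p alpha beta z)%R].
Proof.
move=> nu_gt0 mu_lebesgue qn_quasi R0_gt0 p1 Y1 sphi phi_supp hardy.
have [s [eps blowup]] := exists_blowup_sequence i0 nu_gt0 qn_quasi R0_gt0 Y1.
have [mass_cvg mass_int] := limit_mass_cvg nu_gt0 qn_quasi R0_gt0 blowup sphi
  phi_supp alpha beta mu_lebesgue p1.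
have [energy_cvg energy_int] := limit_energy_cvg nu_gt0 qn_quasi R0_gt0 blowup sphi
  phi_supp alpha beta mu_lebesgue p1.
split => //; apply: (ler_cvg_to (cvgMl_tmp mass_cvg) energy_cvg); apply: nearW => k.
apply: (blowup_inequality_chart nu_gt0 qn_quasi R0_gt0 blowup sphi phi_supp mu_lebesgue p1).
apply: hardy.
have [su sv cK KR fK] := blowup_test_function nu_gt0 qn_quasi R0_gt0 blowup sphi phi_supp k.
by split => //; split => //; eexists; split; [exact: cK|exact: KR|exact: fK].
Qed.

(** * Truncated extremals *)

Section Plateau.
Context {R : realType}.
Implicit Types (N : nat) (t y kappa : R).

Definition plateau N y : R := step (y - 1) * step (2 - y / 2 ^+ N).

Let pow2_gt0 N : 0 < 2 ^+ N :> R. Proof. exact: exprn_gt0. Qed.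

Let rise_arg y : y - 1 = 1 * y + -1. Proof. by rewrite mul1r. Qed.
Let fall_arg N y : 2 - y / 2 ^+ N = - (2 ^+ N)^-1 * y + 2.
Proof. by rewrite addrC mulNr mulrC. Qed.

Lemma smoothR_plateau N : smoothR (plateau N).
Proof.
apply: smoothRM; first exact: smoothR_comp_affine smoothR_step rise_arg.
exact: smoothR_comp_affine smoothR_step (fall_arg N).
Qed.

Lemma derive1_plateau N y : derive1 (plateau N) y =
  derive1 step (y - 1) * step (2 - y / 2 ^+ N) -
  step (y - 1) * (derive1 step (2 - y / 2 ^+ N) / 2 ^+ N).
Proof.
have rise := smoothR_comp_affine smoothR_step rise_arg.
have fall := smoothR_comp_affine smoothR_step (fall_arg N).
rewrite (derive1_val (is_derive1M (smoothR_is_derive y rise) (smoothR_is_derive y fall))).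
rewrite (derive1_comp_affine _ smoothR_step rise_arg).
rewrite (derive1_comp_affine _ smoothR_step (fall_arg N)).
by rewrite mul1r mulNr mulrN [_^-1 * _]mulrC.
Qed.

Lemma plateau_out N y : y <= 1 \/ 2 ^+ N.+1 <= y ->
  plateau N y = 0 /\ derive1 (plateau N) y = 0.
Proof.
rewrite derive1_plateau /plateau => -[y1|y2].
  have rise0 : step (y - 1) = 0 by apply: step_eq0; lra.
  have rise'0 : derive1 step (y - 1) = 0 by apply: derive1_step_eq0; left; lra.
  by rewrite rise0 rise'0 !mul0r subr0.
have y2N : 2 <= y / 2 ^+ N by rewrite ler_pdivlMr// -exprS.
have fall0 : step (2 - y / 2 ^+ N) = 0 by apply: step_eq0; lra.
have fall'0 : derive1 step (2 - y / 2 ^+ N) = 0 by apply: derive1_step_eq0; left; lra.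
by rewrite fall0 fall'0 mul0r !mulr0 subr0.
Qed.

Lemma plateau_mid N y : 2 <= y <= 2 ^+ N ->
  plateau N y = 1 /\ derive1 (plateau N) y = 0.
Proof.
move=> /andP[y2]; rewrite -[leRHS]mul1r -ler_pdivrMr// => yN.
rewrite derive1_plateau /plateau !step_eq1 ?mulr1; [|lra|lra].
by rewrite !derive1_step_eq0; [rewrite mul0r mulr0 subr0|right; lra|right; lra].
Qed.

Lemma plateau_ge0 N y : 0 <= plateau N y.
Proof. by rewrite mulr_ge0 ?step_ge0. Qed.

Lemma plateau_le1 N y : plateau N y <= 1.
Proof. by rewrite mulr_ile1 ?step_ge0 ?step_le1. Qed.

Lemma derive1_plateau_bounded : exists2 M : R, 0 <= M &
  forall N y, 1 <= y <= 2 ^+ N.+1 -> `|y * derive1 (plateau N) y| <= M.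
Proof.
have [M step'M] := @derive1_step_bounded R.
have M0 : 0 <= M by exact: le_trans (step'M 0).
exists (2 * M + 2 * M) => [|N y /andP[y1]]; first by rewrite addr_ge0 ?mulr_ge0.
rewrite exprS -ler_pdivrMr// => yN; rewrite derive1_plateau mulrBr.
have tN0 : 0 <= y / 2 ^+ N by rewrite divr_ge0//; lra.
apply: le_trans (ler_normB _ _) _; apply: lerD.
  rewrite mulrA normrM (ger0_norm (step_ge0 _)) -[leRHS]mulr1.
  apply: ler_pM; rewrite ?step_ge0 ?step_le1//.
  have [y2|y2] := leP 2 y.
    by rewrite derive1_step_eq0 ?mulr0 ?normr0 ?mulr_ge0//; right; lra.
  by rewrite normrM; apply: ler_pM; rewrite ?step'M// ger0_norm; lra.
have -> : y * (step (y - 1) * (derive1 step (2 - y / 2 ^+ N) / 2 ^+ N)) =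
    step (y - 1) * (y / 2 ^+ N * derive1 step (2 - y / 2 ^+ N)) by ring.
rewrite normrM (ger0_norm (step_ge0 _)).
rewrite -[leRHS]mul1r; apply: ler_pM; rewrite ?step_ge0 ?step_le1//.
by rewrite normrM (ger0_norm tN0); apply: ler_pM.
Qed.

Definition profile kappa N t : R := t `^ kappa * plateau N t.

Lemma profile_supp kappa N t : profile kappa N t != 0 -> 1 <= t <= 2 ^+ N.+1.
Proof.
apply: contraR; rewrite negb_and -!ltNge /profile => t_out.
have [-> _] : plateau N t = 0 /\ derive1 (plateau N) t = 0; last by rewrite mulr0.
by apply: plateau_out; case/orP: t_out => /ltW; [left|right].
Qed.

Lemma smoothR_profile kappa N : smoothR (profile kappa N).
Proof.
move=> k; have -> : setT = [set t : R | 0 < t] `|` [set t | t < 1].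
  by apply/seteqP; split => // t _ /=; have [t1|t1] := ltP t 1; [right|left; lra].
have o0 : open [set t : R | 0 < t] by exact: open_gt.
have o1 : open [set t : R | t < 1] by exact: open_lt.
apply: nderivableU.
  apply: nderivableM => //; first exact: nderivable_powR.
  apply: (@nderivable_comp _ _ setT _ (plateau N) (fun t => t)) => //; first exact: openT.
    exact: smoothR_plateau.
  by apply: eq_nderivable (nderivable_affine k 1 0 o0) => // t _; rewrite mul1r addr0.
apply: (eq_nderivable (f := fun=> 0)) => //; last exact: nderivable_cst.
by move=> t /= t1; apply/esym; apply: contraTeq t1 => /profile_supp/andP[+ _]; rewrite -leNgt.
Qed.

Lemma derive1_profile kappa N t : 0 < t -> derive1 (profile kappa N) t =
  t `^ (kappa - 1) * (kappa * plateau N t + t * derive1 (plateau N) t).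
Proof.
move=> t0; rewrite (derive1_val (is_derive1M (is_derive1_powR kappa t0)
  (smoothR_is_derive t (smoothR_plateau N)))).
have -> : t `^ kappa = t `^ (kappa - 1) * t.
  by rewrite -[X in _ * X]powRr1 ?(ltW t0)// -powRD_gt0// subrK.
by ring.
Qed.

Lemma derive1_profile_eq0 kappa N t : t < 1 -> derive1 (profile kappa N) t = 0.
Proof.
by apply: contraTeq => /(derive1_within_supp (@profile_supp kappa N))/andP[+ _]; rewrite -leNgt.
Qed.

End Plateau.

Section LogShells.
Context {R : realType} {n : nat}.
Variables (i0 : 'I_n) (p : R).
Hypothesis p_gt0 : 0 < p.
Implicit Types (z : Rn R n) (N k : nat) (a b c : R).

Definition cross z : R := \prod_(j < n | j != i0) smooth_bump (coor j z).

Lemma cross_ge0 z : 0 <= cross z.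
Proof. by apply: prodr_ge0 => j _; exact: smooth_bump_ge0. Qed.

Lemma cross_le1 z : cross z <= 1.
Proof. by apply: prodr_ile1 => j _; rewrite smooth_bump_ge0 smooth_bump_le1. Qed.

Lemma continuous_cross : continuous cross.
Proof.
apply: (@continuous_prod_coor _ _ (fun j => j != i0) (fun=> smooth_bump)) => j.
exact: smoothR_continuous smoothR_bump.
Qed.

Lemma cross_supp z j : j != i0 -> cross z != 0 -> `|coor j z| <= 1.
Proof.
move=> ji; rewrite /cross => /prodf_neq0/(_ j ji)/smooth_bump_supp.
by rewrite ler_norml.
Qed.

(* Invariant under dilation of the axis coordinate, as dy / y is. *)
Definition log_density z : R := cross z `^ p * (coor i0 z) `^ (-1).

Lemma log_density_ge0 z : 0 <= log_density z.
Proof. by rewrite mulr_ge0 ?powR_ge0. Qed.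

Definition shell a b z : R := log_density z * \1_[set z : Rn R n | a <= coor i0 z < b] z.

Lemma shellE a b z : shell a b z = if a <= coor i0 z < b then log_density z else 0.
Proof.
rewrite /shell indicE; case: ifPn => yab; first by rewrite mem_set ?mulr1.
by rewrite memNset ?mulr0//; exact/negP.
Qed.

Lemma shell_ge0 a b z : 0 <= shell a b z.
Proof. by rewrite shellE; case: ifP => // _; exact: log_density_ge0. Qed.

Lemma measurable_shell a b : measurable_fun setT (shell a b).
Proof.
have mcoor := @measurable_coor R n i0.
apply: measurable_funM.
  apply: measurable_funM; apply: (measurableT_comp (measurable_powR _)) => //.
  exact: continuous_measurable_Rn continuous_cross.
apply: measurable_indic.
rewrite (_ : [set _ | _] = setT `&` coor i0 @^-1` `[a, b[); first exact: mcoor.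
by rewrite setTI; apply/seteqP; split => z /=; rewrite in_itv.
Qed.

Lemma shell_le1 a b z : 1 <= a -> shell a b z <= 1.
Proof.
move=> a1; rewrite shellE; case: ifP => // /andP[ay _].
rewrite mulr_ile1 ?powR_ge0//; last by rewrite powR_inv1 ?invf_le1; lra.
have -> : 1 = 1 `^ p :> R by rewrite powR1.
by rewrite ge0_ler_powR ?nnegrE ?cross_ge0 ?cross_le1 ?(ltW p_gt0).
Qed.

Lemma bounded_with_support_shell a b : 1 <= a -> bounded_with_support (shell a b).
Proof.
move=> a1; split; first exact: measurable_shell.
  by exists 1 => z; rewrite ger0_norm ?shell_ge0// shell_le1.
exists (Num.max 1 b) => z; apply: contraTeq; rewrite shellE -leNgt.
case: ifPn => [/andP[ay yb] shell_neq0|_]; last by rewrite eqxx.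
apply: norm_le_coor => [|j]; first by rewrite le_max ler01.
have [->|ji] := eqVneq j i0; first by rewrite ger0_norm ?le_max ?(ltW yb) ?orbT//; lra.
rewrite le_max cross_supp//; apply: contra_neq shell_neq0 => c0.
by rewrite /log_density c0 powR0 ?mul0r// gt_eqF.
Qed.

Lemma shell_cat a b c z : a <= b -> b <= c -> shell a c z = shell a b z + shell b c z.
Proof.
move=> ab bc; rewrite !shellE; have [yb|yb] := ltP (coor i0 z) b.
  by rewrite andbT /= addr0 (lt_le_trans yb bc) andbT.
by rewrite andbF add0r (le_trans ab yb).
Qed.

Variable mu : {measure set (Rn R n) -> \bar R}.
Hypothesis mu_lebesgue : is_lebesgue_measure mu.

Lemma integrable_shell a b : 1 <= a -> mu.-integrable setT (EFin \o shell a b).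
Proof.
by move=> a1; apply: bounded_with_support_integrable => //; exact: bounded_with_support_shell.
Qed.

Definition axis_double (j : 'I_n) : R := if j == i0 then 2 else 1.

Lemma shell_axis_double a b z : 0 < a ->
  shell (2 * a) (2 * b) (affine (fun=> 0) axis_double z) = 2^-1 * shell a b z.
Proof.
move=> a0; have axisE : coor i0 (affine (fun=> 0) axis_double z) = 2 * coor i0 z.
  by rewrite coor_affine /axis_double eqxx add0r.
have crossE : cross (affine (fun=> 0) axis_double z) = cross z.
  apply: eq_bigr => j /negbTE ji.
  by rewrite coor_affine /axis_double ji add0r mul1r.
rewrite !shellE axisE ler_pM2l// ltr_pM2l//.
case: ifPn => [/andP[ay _]|_]; last by rewrite mulr0.
have y0 : 0 < coor i0 z by exact: lt_le_trans ay.
rewrite /log_density crossE axisE !powR_inv1 ?mulr_ge0 ?(ltW y0)//.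
by rewrite invfM; ring.
Qed.

Lemma Rintegral_shell_double a b : 1 <= a ->
  (\int[mu]_z shell (2 * a) (2 * b) z)%R = (\int[mu]_z shell a b z)%R.
Proof.
move=> a1; have axis_double_gt0 j : 0 < axis_double j by rewrite /axis_double; case: ifP.
rewrite (Rintegral_affine mu_lebesgue (fun=> 0) axis_double_gt0); last first.
  by apply: integrable_shell; lra.
have -> : \prod_(j < n) axis_double j = 2.
  rewrite (bigD1 i0)//= {1}/axis_double eqxx big1 ?mulr1// => j /negbTE ji.
  by rewrite /axis_double ji.
under eq_Rintegral do rewrite shell_axis_double ?(lt_le_trans ltr01)//.
by rewrite RintegralZl ?integrable_shell// mulrA mulfV ?mul1r.
Qed.

Lemma Rintegral_dyadic_shell k :
  (\int[mu]_z shell (2 ^+ k) (2 ^+ k.+1) z)%R = (\int[mu]_z shell 1 2 z)%R.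
Proof.
elim: k => [|k IH]; first by rewrite expr0 expr1.
by rewrite !(exprS _ k.+1) (exprS _ k) Rintegral_shell_double ?IH -?exprS// exprn_ege1// ler1n.
Qed.

Lemma Rintegral_dyadic_shells N :
  (\int[mu]_z shell 2 (2 ^+ N.+1) z)%R = N%:R * (\int[mu]_z shell 1 2 z)%R.
Proof.
elim: N => [|N IH].
  rewrite expr1 mul0r; under eq_Rintegral => z _.
    rewrite shellE ifF; last by apply/negP => /andP[? ?]; lra.
    over.
  by rewrite Rintegral_cst// mul0r.
have N2 : 2 <= 2 ^+ N.+1 :> R by rewrite exprS ler_peMr// exprn_ege1// ler1n.
have NS : 2 ^+ N.+1 <= 2 ^+ N.+2 :> R by rewrite ler_weXn2l// ler1n.
under eq_Rintegral do rewrite (shell_cat _ N2 NS).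
rewrite RintegralD ?integrable_shell//; [|lra|lra].
by rewrite IH Rintegral_dyadic_shell -[N.+1%:R]natr1 mulrDl mul1r.
Qed.

Lemma Rintegral_unit_shell_gt0 : 0 < (\int[mu]_z shell 1 2 z)%R.
Proof.
pose width (j : 'I_n) : R := if j == i0 then 1 / 2 else 1.
pose center : Rn R n := \row_j (if j == i0 then 3 / 2 else 0).
pose U := [set z | forall j, `|coor j z - coor j center| < width j].
have centerE j : coor j center = if j == i0 then 3 / 2 else 0 by rewrite /coor mxE.
have near_coor j : \forall z \near center, `|coor j z - coor j center| < width j.
  have width0 : 0 < width j by rewrite /width; case: ifP => _; lra.
  have cj : coor j z @[z --> center] --> coor j center by exact: continuous_coor.
  by move/cvgrPdist_lt : cj => /(_ _ width0); apply: filterS => z; rewrite distrC.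
have nbhsU : nbhs center U by near=> z; near: z; exact: filter_forall.
apply: (Rintegral_gt0 mu_lebesgue _ _ (@open_interior _ U) nbhsU) => [||z].
- exact: integrable_shell.
- exact: shell_ge0.
move=> /interior_subset Uz; have := Uz i0; rewrite centerE /width eqxx ltr_norml.
move=> /andP[z1 z2]; rewrite shellE ifT; last by apply/andP; split; lra.
rewrite mulf_neq0// gt_eqF// powR_gt0//; last by lra.
apply: prodr_gt0 => j ji; apply: smooth_bump_gt0; have := Uz j.
by rewrite centerE /width (negbTE ji) subr0.
Unshelve. all: by end_near. Qed.

End LogShells.

(** * Sharpness of the constant *)

Lemma natr_mul_bounded_le0 (R : realType) (x M : R) : (forall N : nat, x * N%:R <= M) -> x <= 0.
Proof.
move=> xM; rewrite leNgt; apply/negP => x0.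
have := xM (Num.truncn (M / x)).+1; apply/negP; rewrite -ltNge.
by rewrite mulrC -ltr_pdivrMr// truncnS_gt.
Qed.

Section PlateauEnergy.
Context {R : realType} {n : nat}.
Variables (mu : {measure set (Rn R n) -> \bar R}) (i0 : 'I_n) (p kappa : R).
Hypotheses (mu_lebesgue : is_lebesgue_measure mu) (p_gt0 : 0 < p).
Implicit Types (z : Rn R n) (N : nat).

Definition plateau_mass N z : R := plateau N (coor i0 z) `^ p * log_density i0 p z.

Definition plateau_energy N z : R :=
  `|kappa * plateau N (coor i0 z) + coor i0 z * derive1 (plateau N) (coor i0 z)| `^ p
  * log_density i0 p z.

Lemma shell_le_plateau_mass N z : shell i0 p 2 (2 ^+ N) z <= plateau_mass N z.
Proof.
rewrite shellE; case: ifPn => [/andP[y2 yN]|_]; last first.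
  by rewrite mulr_ge0 ?powR_ge0 ?log_density_ge0.
have [|plateau1 _] := @plateau_mid R N (coor i0 z); first by rewrite y2 ltW.
by rewrite /plateau_mass plateau1 powR1 mul1r.
Qed.

(* Off the two transition shells the plateau is locally constant. *)
Lemma plateau_energy_le : exists2 M : R, 0 <= M & forall N z, (0 < N)%N ->
  plateau_energy N z <= `|kappa| `^ p * plateau_mass N z +
    M * (shell i0 p 1 2 z + shell i0 p (2 ^+ N) (2 ^+ N.+1) z).
Proof.
have [S S0 plateau'S] := @derive1_plateau_bounded R.
exists ((`|kappa| + S) `^ p) => [|N z N_gt0]; first exact: powR_ge0.
rewrite /plateau_energy /plateau_mass !shellE.
move: (coor i0 z) (log_density i0 p z) (log_density_ge0 i0 p z) => y W W0.
have N2 : 2 <= 2 ^+ N :> R by rewrite -[leLHS]expr1 ler_eXn2l// ltr1n.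
have NS : 2 ^+ N <= 2 ^+ N.+1 :> R by rewrite ler_weXn2l// ler1n.
have [/andP[y1 yN]|y_out] := boolP (1 <= y < 2 ^+ N.+1); last first.
  have [|-> ->] := @plateau_out R N y.
    by move: y_out; rewrite negb_and -ltNge -leNgt => /orP[/ltW|]; [left|right].
  rewrite !mulr0 addr0 normr0 powR0 ?gt_eqF// !mul0r mulr0 add0r.
  by apply: mulr_ge0; rewrite ?powR_ge0 ?addr_ge0//; case: ifP.
have [/andP[y2 /ltW y_mid]|y_trans] := boolP (2 <= y < 2 ^+ N).
  have [|-> ->] := @plateau_mid R N y; first by rewrite y2.
  rewrite mulr0 addr0 mulr1 powR1 mul1r lerDl.
  by apply: mulr_ge0; rewrite ?powR_ge0 ?addr_ge0//; case: ifP.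
have -> : (if 1 <= y < 2 then W else 0) + (if 2 ^+ N <= y < 2 ^+ N.+1 then W else 0) = W.
  rewrite y1 yN andbT/=; have [y2|y2] := ltP y 2.
    by rewrite ifF ?addr0//; apply/negP => ?; lra.
  by rewrite add0r ifT//; move: y_trans; rewrite y2/= -leNgt.
apply: (@le_trans _ _ ((`|kappa| + S) `^ p * W)); last first.
  by rewrite lerDr !mulr_ge0 ?powR_ge0.
apply: ler_wpM2r => //; apply: ge0_ler_powR; rewrite ?nnegrE ?addr_ge0 ?(ltW p_gt0)//.
apply: le_trans (ler_normD _ _) _; apply: lerD; last by apply: plateau'S; rewrite y1 ltW.
by rewrite normrM ler_piMr// ger0_norm ?plateau_ge0 ?plateau_le1.
Qed.

Local Notation unit_shell_mass := (\int[mu]_z shell i0 p 1 2 z)%R.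

Lemma Rintegral_plateau_mass_ge N : mu.-integrable setT (EFin \o plateau_mass N.+1) ->
  N%:R * unit_shell_mass <= (\int[mu]_z plateau_mass N.+1 z)%R.
Proof.
move=> mass_int; rewrite -Rintegral_dyadic_shells//; apply: le_Rintegral => //.
  by apply: integrable_shell => //; lra.
by move=> z _; exact: shell_le_plateau_mass.
Qed.

Lemma Rintegral_plateau_energy_le : exists M : R, forall N, (0 < N)%N ->
  mu.-integrable setT (EFin \o plateau_mass N) ->
  mu.-integrable setT (EFin \o plateau_energy N) ->
  (\int[mu]_z plateau_energy N z)%R <=
  `|kappa| `^ p * (\int[mu]_z plateau_mass N z)%R + M * unit_shell_mass.
Proof.
have [M M0 energy_le] := plateau_energy_le; exists (M * 2) => N N_gt0 mass_int energy_int.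
have N1 : 1 <= 2 ^+ N :> R by rewrite exprn_ege1// ler1n.
have shell1_int := integrable_shell i0 p_gt0 mu_lebesgue 2 (lexx 1).
have shellN_int := integrable_shell i0 p_gt0 mu_lebesgue (2 ^+ N.+1) N1.
have shells_int := integrableD measurableT shell1_int shellN_int.
have Mshells_int := integrableZl measurableT M shells_int.
have kmass_int := integrableZl measurableT (`|kappa| `^ p) mass_int.
have sum_int := integrableD measurableT kmass_int Mshells_int.
apply: le_trans (le_Rintegral measurableT energy_int sum_int _) _.
  by move=> z _; exact: energy_le.
rewrite RintegralD// !RintegralZl// RintegralD// Rintegral_dyadic_shell//.
by rewrite -mulrA mulr_natl mulr2n.
Qed.

Lemma plateau_sharp (C : R) :
  (forall N, (0 < N)%N -> [/\ mu.-integrable setT (EFin \o plateau_mass N),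
     mu.-integrable setT (EFin \o plateau_energy N) &
     C * (\int[mu]_z plateau_mass N z)%R <= (\int[mu]_z plateau_energy N z)%R]) ->
  C <= `|kappa| `^ p.
Proof.
move=> hardy; rewrite -subr_le0 leNgt; apply/negP => gap0.
have [M energy_le] := Rintegral_plateau_energy_le.
have shell0 := Rintegral_unit_shell_gt0 i0 p_gt0 mu_lebesgue.
suff : C - `|kappa| `^ p <= 0 by rewrite leNgt gap0.
apply: (@natr_mul_bounded_le0 _ _ M) => N; rewrite -(ler_pM2r shell0).
have [mass_int energy_int hardyN] := hardy N.+1 isT.
have := energy_le N.+1 isT mass_int energy_int.
have := Rintegral_plateau_mass_ge mass_int; rewrite -(ler_pM2l gap0).
move: hardyN; rewrite mulrBl mulrA.
by lra.
Qed.

End PlateauEnergy.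

Section Extremals.
Context {R : realType} {n : nat}.
Variables (nu : 'I_n -> R) (R0 p alpha beta : R) (i0 : 'I_n).
Hypotheses (nu_gt0 : forall i, 0 < nu i) (R0_gt0 : 0 < R0) (p_gt1 : 1 < p).
Implicit Types (z : Rn R n) (N : nat).

Local Notation kappa := ((beta + p) / p).

Definition extremal N (j : 'I_n) : R -> R := if j == i0 then profile kappa N else smooth_bump.

Lemma smoothR_extremal N j : smoothR (extremal N j).
Proof. by rewrite /extremal; case: ifP => _; [exact: smoothR_profile|exact: smoothR_bump]. Qed.

Lemma extremal_supp N j t : extremal N j t != 0 ->
  box_lo i0 j <= t <= box_hi i0 (2 ^+ N.+1) j.
Proof.
rewrite /extremal /box_lo /box_hi; case: ifP => _; first exact: profile_supp.
exact: smooth_bump_supp.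
Qed.

Let extremal_cross N z :
  \prod_(j < n | j != i0) extremal N j (coor j z) = cross i0 z.
Proof. by apply: eq_bigr => j /negbTE ji; rewrite /extremal ji. Qed.

Lemma tensor_extremal N z :
  tensor (extremal N) z = profile kappa N (coor i0 z) * cross i0 z.
Proof. by rewrite (tensorE _ i0) extremal_cross /extremal eqxx. Qed.

Lemma tensor_partial_extremal N z :
  tensor_partial (extremal N) i0 z = derive1 (profile kappa N) (coor i0 z) * cross i0 z.
Proof. by rewrite tensor_partialE extremal_cross /extremal eqxx. Qed.

Let p_gt0 : 0 < p. Proof. exact: lt_trans p_gt1. Qed.
Let p_neq0 : p != 0. Proof. exact: lt0r_neq0. Qed.

Definition limit_factor : R := R0 `^ (- (alpha + p)) * nu i0 `^ (beta + p + 1).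

Lemma limit_factor_gt0 : 0 < limit_factor.
Proof. by rewrite mulr_gt0// powR_gt0. Qed.

Let powR_div_nu (y b : R) : 0 < y -> (y / nu i0) `^ (- b) = y `^ (- b) * nu i0 `^ b.
Proof.
move=> y0; rewrite powRM ?invr_ge0 ?(ltW y0) ?(ltW (nu_gt0 i0))//; congr (_ * _).
by rewrite -(powR_inv1 (ltW (nu_gt0 i0))) -powRrM mulN1r opprK.
Qed.

Lemma limit_mass_extremal N z :
  limit_mass nu R0 i0 (extremal N) p alpha beta z = limit_factor * plateau_mass i0 p N z.
Proof.
rewrite /limit_mass /plateau_mass tensor_extremal.
have [y0|y0] := leP (coor i0 z) 0.
  have [|plateau0 _] := @plateau_out R N (coor i0 z); first by left; lra.
  by rewrite /profile plateau0 mulr0 mul0r normr0 !powR0// !mul0r mulr0.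
rewrite powR_div_nu// /profile /log_density /limit_factor; move: (coor i0 z) y0 => y y0.
move: (plateau N y) (plateau_ge0 N y) (cross i0 z) (cross_ge0 i0 z) => h h0 b b0.
rewrite ger0_norm ?mulr_ge0 ?powR_ge0// !powRM ?mulr_ge0 ?powR_ge0//.
have -> : y `^ (-1) = y `^ kappa `^ p * y `^ (- (beta + p + 1)).
  by rewrite -powRrM -powRD_gt0//; congr (_ `^ _); field.
by ring.
Qed.

Lemma limit_energy_extremal N z :
  limit_energy nu R0 i0 (extremal N) p alpha beta z =
  limit_factor * plateau_energy i0 p kappa N z.
Proof.
rewrite /limit_energy /plateau_energy tensor_partial_extremal.
have [y0|y0] := leP (coor i0 z) 0.
  have [|-> ->] := @plateau_out R N (coor i0 z); first by left; lra.
  rewrite derive1_profile_eq0; last by lra.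
  by rewrite mul0r !mulr0 addr0 normr0 !powR0// !mul0r mulr0.
rewrite powR_div_nu// derive1_profile// /log_density /limit_factor.
move: (coor i0 z) y0 => y y0; move: (kappa * plateau N y + _) => E.
move: (cross i0 z) (cross_ge0 i0 z) => b b0.
rewrite !normrM (ger0_norm b0) (ger0_norm (powR_ge0 _ _)) (gtr0_norm (nu_gt0 i0)).
rewrite !powRM ?mulr_ge0 ?powR_ge0 ?(ltW (nu_gt0 i0))//.
have -> : y `^ (-1) = y `^ (kappa - 1) `^ p * y `^ (- (beta + 1)).
  by rewrite -powRrM -powRD_gt0//; congr (_ `^ _); field.
have -> : nu i0 `^ (beta + p + 1) = nu i0 `^ p * nu i0 `^ (beta + 1).
  by rewrite -powRD_gt0//; congr (_ `^ _); ring.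
by ring.
Qed.

End Extremals.

Lemma hardy_constant_sharp (R : realType) (n : nat) (nu : 'I_n -> R) (qn : Rn R n -> R)
    (mu : {measure set (Rn R n) -> \bar R}) (R0 p alpha beta C : R) :
  (0 < n)%N -> (forall i, 0 < nu i) -> is_lebesgue_measure mu ->
  quasi_norm nu qn -> 0 < R0 -> 1 < p ->
  (forall f, C0inf_punct qn R0 f ->
     C * I_f qn mu R0 p alpha beta f <= I_Rf nu qn mu R0 p alpha beta f) ->
  C <= `|(beta + p) / p| `^ p.
Proof.
move=> n0 nu_gt0 mu_lebesgue qn_quasi R0_gt0 p1 hardy.
pose i0 := Ordinal n0; have c_gt0 := limit_factor_gt0 p alpha beta i0 nu_gt0 R0_gt0.
apply: (plateau_sharp (i0 := i0) mu_lebesgue (lt_trans ltr01 p1)) => N _.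
have N1 : 1 <= 2 ^+ N.+1 :> R by rewrite exprn_ege1// ler1n.
have [mass_int energy_int] := blowup_inequality nu_gt0 mu_lebesgue qn_quasi R0_gt0 p1 N1
  (@smoothR_extremal _ _ p beta i0 N) (@extremal_supp _ _ p beta i0 N) hardy.
have massE := limit_mass_extremal R0 alpha beta i0 nu_gt0 p1 N.
have energyE := limit_energy_extremal R0 alpha beta i0 nu_gt0 p1 N.
have unscale_int (g h : Rn R n -> R) (c : R) : c != 0 -> (forall z, g z = c * h z) ->
    mu.-integrable setT (EFin \o g) -> mu.-integrable setT (EFin \o h).
  move=> c0 gE /(integrableZl measurableT c^-1); apply: eq_integrable => // z _ /=.
  by rewrite gE -EFinM mulKf.
have {}mass_int := unscale_int _ _ _ (lt0r_neq0 c_gt0) massE mass_int.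
have {}energy_int := unscale_int _ _ _ (lt0r_neq0 c_gt0) energyE energy_int.
under eq_Rintegral do rewrite massE.
under [X in _ <= X -> _]eq_Rintegral do rewrite energyE.
by rewrite !RintegralZl// mulrCA ler_pM2l// => ?; split.
Qed.

Theorem theorem4p2 (R : realType) (n : nat) (nu : 'I_n -> R)
    (mul : Rn R n -> Rn R n -> Rn R n)
    (mu : {measure set (Rn R n) -> \bar R})
    (qn : Rn R n -> R) (R0 p alpha beta : R) :
  (0 < n)%N ->
  homogeneous_group nu mul ->
  is_lebesgue_measure mu ->
  quasi_norm nu qn ->
  0 < R0 -> 1 < p ->
  let Q := hdim nu in
  let c := `|(beta + p) / p| `^ p in
  let I1 := I_f qn mu R0 p alpha beta in
  let I2 := I_Rf nu qn mu R0 p alpha beta in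
  let I3 := I_f' qn mu R0 p alpha beta in
  let ICp := I_Cp nu qn mu R0 p alpha beta in
  let adm := C0inf_punct qn R0 in
  (* (i) *)
  (0 <= (Q - alpha - p) * (beta + p) ->
     (forall f, adm f -> c * I1 f <= I2 f) /\
     (beta != - p ->
        forall C : R, (forall f, adm f -> C * I1 f <= I2 f) -> C <= c)) /\
  (* (ii) *)
  (forall f, adm f ->
     c * I1 f = I2 f
       - (Q - alpha - p) * ((beta + p) / p) * `|(beta + p) / p| `^ (p - 2) * I3 f
       - ICp f) /\
  (* (iii) *)
  (Q = alpha + p -> 2 <= p ->
     forall f, adm f ->
       (ICp f = 0 ->
          (exists phi : Rn R n -> R[i],
             forall x : Rn R n, qball qn R0 x -> x != 0 ->
               f x = real_complex R (Lw qn R0 x `^ ((beta + p) / p)) * phi (dil nu (qn x)^-1 x))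
          /\ f = (fun _ => 0)) /\
       (f <> (fun _ => 0) -> c * I1 f < I2 f)).
Proof.
move=> n0 [[nu_gt0 _ _ _ _] _] mu_lebesgue qn_quasi R0_gt0 p1 Q c I1 I2 I3 ICp adm.
split; [move=> sign; split|split].
- by move=> f; exact: hardy_inequality.
- by move=> _ C; exact: hardy_constant_sharp.
- by move=> f; exact: hardy_identity.
- move=> Q_crit _ f f_adm; have f_eq0 : ICp f = 0 -> f = (fun _ => 0) by exact: I_Cp_eq0.
  split=> [/f_eq0 ->|f_neq0].
    by split=> //; exists (fun _ => 0) => x _ _; rewrite mulr0.
  have -> : c * I1 f = I2 f - ICp f.
    rewrite /c /I1 (hardy_identity alpha beta mu_lebesgue qn_quasi R0_gt0 p1 f_adm).
    by rewrite -/Q Q_crit (addrC alpha) addrK subrr !mul0r subr0.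
  rewrite gtrDl oppr_lt0 lt_neqAle I_Cp_ge0// andbT eq_sym.
  by apply/eqP => /f_eq0.
Qed.
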